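(* Let $\tau,\theta$ be stopping times with $0\le\tau<\infty$ and $\tau\le\theta\le\infty$. The following are equivalent: (1) $\phi$ is a mapping defined on $\mathcal R^\infty_{\tau,\theta}$ that can be represented as $$\phi(X)=\operatorname{ess\,inf}_{a\in\mathcal D_{\tau,\theta}}\{\langle X,a\rangle_{\tau,\theta}-\gamma(a)\},\qquad X\in\mathcal R^\infty_{\tau,\theta},\qquad ( * )$$ for a penalty function $\gamma$ on $\mathcal D_{\tau,\theta}$. (2) $\phi$ is a concave monetary utility functional on $\mathcal R^\infty_{\tau,\theta}$ whose acceptance set $\mathcal C_\phi$ is $\sigma(\mathcal R^\infty,\mathcal A^1)$-closed. (3) $\phi$ is a concave monetary utility functional on $\mathcal R^\infty_{\tau,\theta}$ that is continuous for bounded decreasing sequences. Moreover, if (1)--(3) are satisfied, then $\phi^{\#}$ is a special penalty function on $\mathcal D_{\tau,\theta}$, $\phi^{\#}(a)\ge\gamma(a)$ for all $a\in\mathcal D_{\tau,\theta}$ (for $\gamma$ any penalty function as in (1)), and the representation $( * )$ also holds with $\phi^{\#}$ instead of $\gamma$.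
   Context: Setup. $\mathbb N=\{0,1,2,\dots\}$; $(\Omega,\mathcal F,(\mathcal F_t)_{t\in\mathbb N},P)$ is a filtered probability space with $\mathcal F_0=\{\emptyset,\Omega\}$; stopping times are $(\mathcal F_t)$-stopping times. All equalities and inequalities between random variables or processes (for processes: simultaneously for all $t$) and all equalities and inclusions between events are understood $P$-almost surely. $\mathcal R^0$ is the space of real-valued adapted processes $(X_t)_{t\in\mathbb N}$ (a.s. equal processes are identified); $\mathcal R^\infty$ is the subspace of those with $\sup_{t}|X_t|\le m$ for some $m\in\mathbb R$. For stopping times $0\le\tau<\infty$, $\tau\le\theta\le\infty$, put $\pi_{\tau,\theta}(X)_t:=1_{\{\tau\le t\}}X_{t\wedge\theta}$ and $\mathcal R^\infty_{\tau,\theta}:=\pi_{\tau,\theta}\mathcal R^\infty$. $1_{[\tau,\infty)}$ is the process $t\mapsto 1_{\{\tau\le t\}}$. Dual space. For $a\in\mathcal R^0$ put $a_{-1}:=0$, $\Delta a_t:=a_t-a_{t-1}$, $\|a\|_{\mathcal A^1}:=E[\sum_{t\in\mathbb N}|\Delta a_t|]$. $\mathcal A^1:=\{a\in\mathcal R^0:\|a\|_{\mathcal A^1}<\infty\}$, $\mathcal A^1_+:=\{a\in\mathcal A^1:\Delta a_t\ge0\ \forall t\}$. $\langle X,a\rangle:=E[\sum_{t\in\mathbb N}X_t\Delta a_t]$ for $X\in\mathcal R^\infty$, $a\in\mathcal A^1$; $\sigma(\mathcal R^\infty,\mathcal A^1)$ is the coarsest topology on $\mathcal R^\infty$ making all $X\mapsto\langle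 X,a\rangle$, $a\in\mathcal A^1$, continuous. $\langle X,a\rangle_{\tau,\theta}:=E[\sum_{t\in[\tau,\theta]\cap\mathbb N}X_t\Delta a_t\mid\mathcal F_\tau]$. $\mathcal A^1_{\tau,\theta}:=\pi_{\tau,\theta}\mathcal A^1$, $(\mathcal A^1_{\tau,\theta})_+:=\pi_{\tau,\theta}\mathcal A^1_+$, $\mathcal D_{\tau,\theta}:=\{a\in(\mathcal A^1_{\tau,\theta})_+:\langle1,a\rangle_{\tau,\theta}=1\}$. Functionals. A monetary utility functional on $\mathcal R^\infty_{\tau,\theta}$ is a map $\phi:\mathcal R^\infty_{\tau,\theta}\to L^\infty(\mathcal F_\tau)$ with: (0) $\phi(1_AX)=1_A\phi(X)$ for all $X$ and $A\in\mathcal F_\tau$; (1) $\phi(X)\le\phi(Y)$ whenever $X\le Y$; (2) $\phi(X+m1_{[\tau,\infty)})=\phi(X)+m$ for all $X\in\mathcal R^\infty_{\tau,\theta}$, $m\in L^\infty(\mathcal F_\tau)$. It is concave if (3) $\phi(\lambda X+(1-\lambda)Y)\ge\lambda\phi(X)+(1-\lambda)\phi(Y)$ for all $X,Y$ and $\lambda\in L^\infty(\mathcal F_\tau)$ with $0\le\lambda\le1$. Its acceptance set is $\mathcal C_\phi:=\{X\in\mathcal R^\infty_{\tau,\theta}:\phi(X)\ge0\}$. $\phi$ is continuous for bounded decreasing sequences if $\lim_n\phi(X^n)=\phi(X)$ a.s. for every decreasing sequence $(X^n)$ in $\mathcal R^\infty_{\tau,\theta}$ and $X\in\mathcal R^\infty_{\tau,\theta}$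 with $X^n_t\to X_t$ a.s. for all $t\in\mathbb N$. For a concave monetary utility functional $\phi$ on $\mathcal R^\infty_{\tau,\theta}$ and $a\in\mathcal A^1_{\tau,\theta}$, $\phi^{\#}(a):=\operatorname{ess\,inf}_{X\in\mathcal C_\phi}\langle X,a\rangle_{\tau,\theta}$. A penalty function $\gamma$ on $\mathcal D_{\tau,\theta}$ is a map from $\mathcal D_{\tau,\theta}$ to the measurable functions $(\Omega,\mathcal F_\tau)\to[-\infty,0]$ with $\operatorname{ess\,sup}_{a\in\mathcal D_{\tau,\theta}}\gamma(a)=0$. It is special if $\gamma(1_Aa+1_{A^c}b)=1_A\gamma(a)+1_{A^c}\gamma(b)$ for all $a,b\in\mathcal D_{\tau,\theta}$, $A\in\mathcal F_\tau$ (with $0\cdot(-\infty)=0$). *)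

(* Defs.v *)
From HB Require Import structures.
From mathcomp Require Import all_boot all_order all_algebra.
From mathcomp Require Import all_classical all_reals all_analysis.
From mathcomp Require Import measurable_realfun.
Set Implicit Arguments.
Unset Strict Implicit.
Unset Printing Implicit Defensive.
Import Order.TTheory GRing.Theory Num.Theory.
Import numFieldNormedType.Exports.
Local Open Scope classical_set_scope.
Local Open Scope ring_scope.

(* Random variables and processes are identified when they are almost surely
   equal.  Classes are handled through representatives: a space of classes is a
   set of measurable functions (or sequences of such) that is stable under
   almost sure equality, and a map between spaces of classes is a map on
   representatives compatible with almost sure equality. *)

(* Times with values in {0, 1, ...} \cup {oo}; None is oo. *)
Definition time_le (s t : option nat) : bool :=
  match s, t with
  | _, None => true
  | None, Some _ => false
  | Some m, Some n => (m <= n)%N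
  end.

Definition time_min (t : nat) (s : option nat) : nat :=
  if s is Some n then minn t n else t.

Definition filtration d (T : measurableType d) (F : nat -> set (set T)) : Prop :=
  [/\ forall t, sigma_algebra setT (F t),
      forall t, F t `<=` measurable
    & forall s t, (s <= t)%N -> F s `<=` F t].

Definition stopping_time d (T : measurableType d) (F : nat -> set (set T))
    (tau : T -> option nat) : Prop :=
  forall t, F t [set w | time_le (tau w) (Some t)].

Definition stopped_sigma d (T : measurableType d) (F : nat -> set (set T))
    (tau : T -> option nat) : set (set T) :=
  [set A | measurable A /\
    forall t, F t (A `&` [set w | time_le (tau w) (Some t)])].

(* Strict measurability with respect to a sub-sigma-algebra G. *)
Definition sub_measurable d d' (T : measurableType d) (U : measurableType d')
    (G : set (set T)) (f : T -> U) : Prop :=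
  measurable_fun [set: g_sigma_algebraType G] (f : g_sigma_algebraType G -> U).

Section random_variables.
Context d (T : measurableType d) (R : realType) (P : probability T R).

Definition as_measurable d' (U : measurableType d') (G : set (set T))
    (f : T -> U) : Prop :=
  measurable_fun setT f /\
  exists2 g : T -> U, sub_measurable G g & \forall w \ae P, f w = g w.

Definition Linfty (G : set (set T)) : set (T -> R) :=
  [set f : T -> R | as_measurable G f /\
    exists m : R, \forall w \ae P, `|f w| <= m].

Definition is_condexp (G : set (set T)) (Y Z : T -> R) : Prop :=
  [/\ sub_measurable G Z,
      P.-integrable setT (fun w => (Z w)%:E)
    & forall A, G A ->
        (\int[P]_(w in A) (Z w)%:E = \int[P]_(w in A) (Y w)%:E)%E].

(* A version of E[Y | G]; meaningful for integrable Y. *)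
Definition condexp (G : set (set T)) (Y : T -> R) : T -> R :=
  xget (fun=> 0) [set Z | is_condexp G Y Z].

(* Essential infimum and supremum of a family S of random variables. *)
Definition is_essinf (S : set (T -> \bar R)) (f : T -> \bar R) : Prop :=
  [/\ measurable_fun setT f,
      forall g, S g -> \forall w \ae P, (f w <= g w)%E
    & forall h, measurable_fun setT h ->
        (forall g, S g -> \forall w \ae P, (h w <= g w)%E) ->
        \forall w \ae P, (h w <= f w)%E].

Definition essinf (S : set (T -> \bar R)) : T -> \bar R :=
  xget (fun=> +oo%E) [set f | is_essinf S f].

Definition is_esssup (S : set (T -> \bar R)) (f : T -> \bar R) : Prop :=
  [/\ measurable_fun setT f,
      forall g, S g -> \forall w \ae P, (g w <= f w)%E
    & forall h, measurable_fun setT h ->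
        (forall g, S g -> \forall w \ae P, (g w <= h w)%E) ->
        \forall w \ae P, (f w <= h w)%E].

Definition esssup (S : set (T -> \bar R)) : T -> \bar R :=
  xget (fun=> -oo%E) [set f | is_esssup S f].

End random_variables.

Section processes.
Context d (T : measurableType d) (R : realType) (P : probability T R).
Variable F : nat -> set (set T).

Local Notation process := (nat -> T -> R).

Definition R0 : set process :=
  [set X | forall t, as_measurable P (F t) (X t)].

Definition Rinfty : set process :=
  [set X | R0 X /\ exists m : R, \forall w \ae P, forall t, `|X t w| <= m].

(* The convention a_{-1} = 0 makes the increment at time 0 equal to a_0. *)
Definition incr (a : process) (t : nat) (w : T) : R :=
  if t is s.+1 then a t w - a s w else a 0%N w.

Definition A1norm (a : process) : \bar R :=
  (\int[P]_w \sum_(0 <= t <oo) `|incr a t w|%:E)%E.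

Definition A1 : set process := [set a | R0 a /\ (A1norm a < +oo)%E].

Definition A1pos : set process :=
  [set a | A1 a /\ \forall w \ae P, forall t, 0 <= incr a t w].

Definition pairing (X a : process) : R :=
  \int[P]_w limn (series (fun t => X t w * incr a t w)).

(* sigma(Rinfty, A1): the supremum over a in A1 of the initial topologies of
   the maps X |-> <X, a>, hence the coarsest one making all of them continuous. *)
Definition weak_Rinfty : topologicalType :=
  sup_topology (fun a : A1 =>
    Topological.class
      (initial_topology (fun X : Rinfty => pairing (val X) (val a)))).

Definition weakly_closed (C : set process) : Prop :=
  closed ([set X : Rinfty | C (val X)] : set weak_Rinfty).

Variables tau theta : T -> option nat.

Definition stopped_proj (X : process) : process := fun t w =>
  if time_le (tau w) (Some t) then X (time_min t (theta w)) w else 0.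

(* The image of a set of classes of processes under the projection. *)
Definition proj_image (S : set process) : set process :=
  [set X | (forall t, measurable_fun setT (X t)) /\
    exists2 Y, S Y & \forall w \ae P, forall t, X t w = stopped_proj Y t w].

Definition Rinfty_tt : set process := proj_image Rinfty.

Definition A1pos_tt : set process := proj_image A1pos.

Definition Ftau : set (set T) := stopped_sigma F tau.

Definition cond_pairing (X a : process) : T -> R :=
  condexp P Ftau (fun w => limn (series (fun t =>
    if time_le (tau w) (Some t) && time_le (Some t) (theta w)
    then X t w * incr a t w else 0))).

Definition Dset : set process :=
  [set a | A1pos_tt a /\
    \forall w \ae P, cond_pairing (fun _ _ => 1) a w = 1].

Definition add_from_tau (X : process) (m : T -> R) : process := fun t w =>
  X t w + m w * (time_le (tau w) (Some t))%:R.

(* Functionals may a priori take extended real values, so that representability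
   by an essential infimum does not presuppose finiteness. *)
Record monetary_utility (phi : process -> T -> \bar R) : Prop := {
  muf_Linfty : forall X, Rinfty_tt X ->
    exists2 g, Linfty P Ftau g & \forall w \ae P, phi X w = (g w)%:E;
  muf_local : forall X A, Rinfty_tt X -> Ftau A ->
    \forall w \ae P,
      phi (fun t w => \1_A w * X t w) w = ((\1_A w)%:E * phi X w)%E;
  muf_mono : forall X Y, Rinfty_tt X -> Rinfty_tt Y ->
    (\forall w \ae P, forall t, X t w <= Y t w) ->
    \forall w \ae P, (phi X w <= phi Y w)%E;
  muf_translation : forall X m, Rinfty_tt X -> Linfty P Ftau m ->
    \forall w \ae P, phi (add_from_tau X m) w = (phi X w + (m w)%:E)%E }.

Record concave_monetary_utility (phi : process -> T -> \bar R) : Prop := {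
  cmuf_monetary : monetary_utility phi;
  cmuf_concave : forall X Y l, Rinfty_tt X -> Rinfty_tt Y -> Linfty P Ftau l ->
    (\forall w \ae P, 0 <= l w <= 1) ->
    \forall w \ae P,
      ((l w)%:E * phi X w + (1 - l w)%:E * phi Y w
        <= phi (fun t w => l w * X t w + (1 - l w) * Y t w)%R w)%E }.

Definition acceptance (phi : process -> T -> \bar R) : set process :=
  [set X | Rinfty_tt X /\ \forall w \ae P, (0 <= phi X w)%E].

Definition continuous_decreasing (phi : process -> T -> \bar R) : Prop :=
  forall (Xs : nat -> process) (X : process),
    (forall n, Rinfty_tt (Xs n)) -> Rinfty_tt X ->
    (forall n, \forall w \ae P, forall t, Xs n.+1 t w <= Xs n t w) ->
    (forall t, \forall w \ae P, (fun n => Xs n t w) @ \oo --> X t w) ->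
    \forall w \ae P, (fun n => phi (Xs n) w) @ \oo --> phi X w.

Definition conjugate (phi : process -> T -> \bar R) (a : process) :
    T -> \bar R :=
  essinf P [set (fun w => (cond_pairing X a w)%:E) | X in acceptance phi].

Record penalty (gamma : process -> T -> \bar R) : Prop := {
  penalty_meas : forall a, Dset a -> as_measurable P Ftau (gamma a);
  penalty_le0 : forall a, Dset a -> \forall w \ae P, (gamma a w <= 0)%E;
  penalty_ext : forall a b, Dset a -> Dset b ->
    (\forall w \ae P, forall t, a t w = b t w) ->
    \forall w \ae P, gamma a w = gamma b w;
  penalty_sup : \forall w \ae P, esssup P [set gamma a | a in Dset] w = 0%E }.

(* In \bar R the product 0 * -oo is 0. *)
Definition special (gamma : process -> T -> \bar R) : Prop :=
  forall a b A, Dset a -> Dset b -> Ftau A ->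
    \forall w \ae P,
      gamma (fun t w => \1_A w * a t w + \1_(~` A) w * b t w) w =
      ((\1_A w)%:E * gamma a w + (\1_(~` A) w)%:E * gamma b w)%E.

Definition representation (phi gamma : process -> T -> \bar R) : Prop :=
  forall X, Rinfty_tt X ->
    \forall w \ae P, phi X w =
      essinf P
        [set (fun w => ((cond_pairing X a w)%:E - gamma a w)%E) | a in Dset] w.

End processes.

(* Main.v *)
From HB Require Import structures.
Require Import Defs.
From mathcomp Require Import all_boot all_order all_algebra.
From mathcomp Require Import all_classical all_reals all_analysis.
From mathcomp Require Import ring lra measurable_realfun.
Set Implicit Arguments.
Unset Strict Implicit.
Unset Printing Implicit Defensive.
Import Order.TTheory GRing.Theory Num.Theory.
Import numFieldNormedType.Exports.
Local Open Scope classical_set_scope.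
Local Open Scope ring_scope.

(** A functional represented by a penalty function gamma inherits from the maps
    X |-> <X, a> - gamma(a) every property of a concave monetary utility
    functional, essential infima being local (rep_concave_utility). Its
    acceptance set is weakly closed: if <X, a> < gamma(a) on an event B known at
    tau, then Y |-> E[1_B <Y, a>] is a weakly continuous functional that
    separates X from the acceptance set (rep_closed). From closedness to
    continuity from above: when X_n decreases to X and phi(X_n) to L, the
    processes X_n - L are accepted and converge weakly to X - L by dominated
    convergence, so phi(X) >= L (closed_continuous).

    The substance is the way back, from continuity from above to the
    representation by the conjugate phi#. The inequality phi(X) <= <X, a> -
    phi#(a) holds since X - phi(X) is accepted (conj_rep_le). If the infimum
    over a were larger than phi(X), localization and translation would give a
    process X0 rejected on a non-null event, and it is enough to find a in D
    with <X0, a> < phi#(a) somewhere (dual_witness, conj_representation).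

    To that end X0 is separated from the convex set of accepted processes.
    Continuity from above says that this set is closed under bounded almost sure
    limits, since the suprema of the tails of a convergent sequence decrease to
    its limit (accept_bounded_lim). This is closedness on bounded sets for
    convergence in mean, and the construction of Krein and Smulian turns it into
    a separation by an element of the predual A1. It is carried out for a
    positive functional on bounded functions (krein_smulian_separation):
    separation from a ball of radius r comes from nearly minimizing the mean of
    the square of the excess over [-r, r], whose derivative is again an excess,
    and countably many of these separating functionals are combined by a minimal
    norm argument in l2 (convex_sequences_separation). The outcome is a process
    a with E<X0, a> + 1 <= E<Y, a> for all accepted Y (separating_increments).
    Its increments are nonnegative because acceptance is monotone
    (increments_ge0). Because accepted processes can be pasted along events
    known at tau, the inequality passes from means to the essential infimum
    phi#(a) (conj_gap), and division by <1, a> leads into D (gap_positive_mass,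
    normalise).

    Once phi is represented by phi#, the normalization esssup phi# = 0 expresses
    phi(0) = 0 (conj_penalty); pasting makes phi# special (conj_special), and
    any other penalty function gamma is below phi# since 0 <= phi(X) <= <X, a> -
    gamma(a) for accepted X (penalty_le_conj). *)

(** * Soft thresholding *)

Section excess.
Context {R : realType}.
Implicit Types r x y c h : R.

(** The signed distance from x to the interval [-r, r]. Its square is a smooth
    convex penalty for the constraint |x| <= r. *)
Definition excess r x : R := x - Num.max (- r) (Num.min r x).

Variant excess_spec r x : R -> Type :=
  | ExcessLow of x <= - r : excess_spec r x (x + r)
  | ExcessMid of - r <= x & x <= r : excess_spec r x 0
  | ExcessHigh of r <= x : excess_spec r x (x - r).

Lemma excessP r x : 0 <= r -> excess_spec r x (excess r x).
Proof.
move=> r0; rewrite /excess; case: (leP r x) => h1.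
  by case: (leP (- r) r) => h2; [exact: ExcessHigh|lra].
case: (leP (- r) x) => h2; last by rewrite opprK; apply: ExcessLow; exact: ltW.
by rewrite subrr; apply: ExcessMid => //; exact: ltW.
Qed.

Lemma excess_clip r x : 0 <= r -> `|x - excess r x| <= r.
Proof.
by move=> r0; case: excessP => // *; rewrite ler_norml; apply/andP; split; lra.
Qed.

Lemma excess_eq0 r x : `|x| <= r -> excess r x = 0.
Proof.
move=> /[dup]/(le_trans (normr_ge0 _)) r0; rewrite ler_norml => /andP[h1 h2].
by case: excessP => // h3; lra.
Qed.

(** x - excess r x is the point of [-r, r] that is nearest to x. *)
Lemma excess_min r x c : `|c| <= r -> excess r x ^+ 2 <= (x - c) ^+ 2.
Proof.
move=> /[dup]/(le_trans (normr_ge0 _)) r0; rewrite ler_norml => /andP[h1 h2].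
rewrite -subr_ge0; case: excessP => // [h|_ _|h].
- have -> : (x - c) ^+ 2 - (x + r) ^+ 2 = (c + r) * (c - x - x - r) by ring.
  by apply: mulr_ge0; lra.
- by rewrite expr0n subr0 sqr_ge0.
- have -> : (x - c) ^+ 2 - (x - r) ^+ 2 = (r - c) * (x + x - c - r) by ring.
  by apply: mulr_ge0; lra.
Qed.

Lemma excess_mul r x : 0 <= r ->
  excess r x * x = excess r x ^+ 2 + r * `|excess r x|.
Proof.
move=> r0; case: excessP => // *.
- by rewrite ler0_norm; [ring|lra].
- by rewrite normr0; ring.
- by rewrite ger0_norm; [ring|lra].
Qed.

Lemma excess_le r x : 0 <= r -> `|excess r x| <= `|x|.
Proof.
move=> r0; rewrite -ler_sqr ?nnegrE// !real_normK ?num_real//.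
by have := @excess_min r x 0; rewrite subr0 normr0; apply.
Qed.

(** The derivative of the squared excess is twice the excess, and its second
    derivative is at most 2. *)
Lemma excess_step r x h : 0 <= r ->
  excess r (x + h) ^+ 2 <= excess r x ^+ 2 + 2 * (excess r x * h) + h ^+ 2.
Proof.
move=> r0; apply: (le_trans (excess_min (x + h) (excess_clip x r0))).
by rewrite le_eqVlt; apply/orP; left; apply/eqP; ring.
Qed.

Lemma excess_mid r x y : 0 <= r ->
  excess r ((x + y) / 2) ^+ 2 <= (excess r x ^+ 2 + excess r y ^+ 2) / 2.
Proof.
move=> r0; set a := excess r x; set b := excess r y.
have ha := excess_clip x r0; have hb := excess_clip y r0.
have /(excess_min ((x + y) / 2)) : `|((x - a) + (y - b)) / 2| <= r.
  move: ha hb; rewrite -/a -/b !ler_norml => /andP[? ?] /andP[? ?].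
  by apply/andP; split; lra.
move=> h; apply: le_trans h _; rewrite -subr_ge0.
have -> : (a ^+ 2 + b ^+ 2) / 2 - ((x + y) / 2 - (x - a + (y - b)) / 2) ^+ 2
    = ((a - b) / 2) ^+ 2 by field.
exact: sqr_ge0.
Qed.

End excess.

(** * Positive functionals *)

(** An abstract integral, with two instances: the sum of geometrically bounded
    sequences, and a weighted mean of bounded processes. *)
Record positive_functional {R : realType} {S : Type} (V : set (S -> R))
    (I : (S -> R) -> R) : Prop := {
  pf_memD : forall f g, V f -> V g -> V (fun s => f s + g s);
  pf_memZ : forall c f, V f -> V (fun s => c * f s);
  pf_memM : forall f g, V f -> V g -> V (fun s => f s * g s);
  pf_memN : forall f, V f -> V (fun s => `|f s|);
  pf_D : forall f g, V f -> V g -> I (fun s => f s + g s) = I f + I g;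
  pf_Z : forall c f, V f -> I (fun s => c * f s) = c * I f;
  pf_ge0 : forall f, V f -> (forall s, 0 <= f s) -> 0 <= I f }.

Section functional.
Context {R : realType} {S : Type} {V : set (S -> R)} {I : (S -> R) -> R}.
Hypothesis HI : positive_functional V I.
Implicit Types f g : S -> R.

Let VD := pf_memD HI. Let VZ := pf_memZ HI. Let VM := pf_memM HI.
Let VN := pf_memN HI.

Lemma pf_memB f g : V f -> V g -> V (fun s => f s - g s).
Proof.
move=> Vf Vg; have := VD Vf (VZ (-1) Vg).
by under eq_fun do rewrite mulN1r.
Qed.

Lemma pf_memX2 f : V f -> V (fun s => f s ^+ 2).
Proof. by move=> Vf; under eq_fun do rewrite expr2; exact: VM. Qed.

Lemma pf_B f g : V f -> V g -> I (fun s => f s - g s) = I f - I g.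
Proof.
move=> Vf Vg; have := pf_D HI Vf (VZ (-1) Vg).
rewrite (pf_Z HI)// mulN1r => <-; congr I; apply/funext => s; by rewrite mulN1r.
Qed.

Lemma pf_le f g : V f -> V g -> (forall s, f s <= g s) -> I f <= I g.
Proof.
move=> Vf Vg fg; rewrite -subr_ge0 -pf_B//; apply: (pf_ge0 HI).
  exact: pf_memB.
by move=> s; rewrite subr_ge0.
Qed.

Lemma pf_norm_le f g m : V f -> V g -> (forall s, `|f s| <= m) ->
  `|I (fun s => f s * g s)| <= m * I (fun s => `|g s|).
Proof.
move=> Vf Vg fm; have Vg' := VN Vg.
have le1 s : `|f s * g s| <= m * `|g s| by rewrite normrM ler_wpM2r.
rewrite ler_norml -mulNr -!(pf_Z HI)//; apply/andP; split; apply: pf_le.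
- exact: VZ.
- exact: VM.
- by move=> s; have := le1 s; rewrite ler_norml mulNr => /andP[].
- exact: VM.
- exact: VZ.
- by move=> s; have := le1 s; rewrite ler_norml => /andP[].
Qed.

Lemma pf_quad f h t : V f -> V h ->
  I (fun s => (f s + t * h s) ^+ 2) =
  I (fun s => f s ^+ 2) + 2 * t * I (fun s => f s * h s)
  + t ^+ 2 * I (fun s => h s ^+ 2).
Proof.
move=> Vf Vh.
transitivity (I (fun s => (f s ^+ 2 + (2 * t) * (f s * h s)) + t ^+ 2 * h s ^+ 2)).
  by congr I; apply/funext => s; ring.
have ? := pf_memX2 Vf; have ? := pf_memX2 Vh; have ? := VM Vf Vh.
have ? := VZ (2 * t) (VM Vf Vh).
by rewrite (pf_D HI) ?(pf_D HI) ?(pf_Z HI)//; [exact: VD|exact: VZ].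
Qed.

Lemma pf_parallelogram f g : V f -> V g ->
  I (fun s => (f s - g s) ^+ 2) =
  2 * I (fun s => f s ^+ 2) + 2 * I (fun s => g s ^+ 2)
  - 4 * I (fun s => ((f s + g s) / 2) ^+ 2).
Proof.
move=> Vf Vg.
have -> : (fun s => (f s - g s) ^+ 2) = (fun s => (f s + (-1) * g s) ^+ 2).
  by apply/funext => s; ring.
have -> : (fun s => ((f s + g s) / 2) ^+ 2) =
          (fun s => (4^-1) * (f s + 1 * g s) ^+ 2).
  by apply/funext => s; field.
rewrite (pf_Z HI); last by apply: pf_memX2; apply: VD => //; exact: VZ.
by rewrite !pf_quad//; field.
Qed.

End functional.

(** * Separation of convex sets of sequences *)

Section real_sequences.
Context {R : realType}.
Implicit Types (u v b : nat -> R) (A : set R).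

Lemma approx_inf A c : A !=set0 -> (forall x, A x -> c <= x) ->
  exists m : R, [/\ c <= m, forall x, A x -> m <= x
    & forall e : R, 0 < e -> exists2 x, A x & x < m + e].
Proof.
move=> A0 cA; have lA : has_inf A by split => //; exists c.
exists (inf A); split.
- exact: lb_le_inf.
- by move=> x Ax; apply: ge_inf => //; exists c.
- by move=> e e0; have [x Ax xe] := inf_adherent e0 lA; exists x.
Qed.

Lemma cauchy_modulus u e : e @ \oo --> (0 : R) ->
  (forall k l, (k <= l)%N -> `|u k - u l| <= e k) ->
  exists l : R, forall k, `|u k - l| <= e k.
Proof.
move=> e0 ue; have cu : cvgn u.
  apply/cauchy_cvgP/cauchy_exP => d d0; near \oo => k.
  exists (u k); exists k => //= l kl; rewrite -ball_normE/=.
  apply: (le_lt_trans (ue _ _ kl)); near: k.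
  move/cvgr_lt : e0; exact.
exists (limn u) => k.
have cuk : (fun l => `|u k - u l|) @ \oo --> `|u k - limn u|.
  by apply: cvg_norm; apply: cvgB => //; exact: cvg_cst.
rewrite -(cvg_lim _ cuk)//; apply: limr_le; first by apply/cvg_ex; eexists; exact: cuk.
by exists k => // l kl; exact: ue.
Unshelve. all: by end_near. Qed.

Definition ssum b : R := limn (series b).

Definition abs_summable b : Prop := cvgn (series (fun n => `|b n|)).

Lemma abs_summable_cvg b : abs_summable b -> cvgn (series b).
Proof. exact: normed_cvg. Qed.

Lemma abs_summableW b c : (forall n, `|c n| <= b n) -> cvgn (series b) ->
  abs_summable c.
Proof.
move=> cb; apply: series_le_cvg => // n; exact: le_trans (cb n).
Qed.

Lemma abs_summableZ t b : abs_summable b -> abs_summable (fun n => t * b n).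
Proof.
move=> sb; apply: (@abs_summableW (fun n => `|t| * `|b n|)) => [n|].
  by rewrite normrM.
have := @is_cvg_seriesZ R (fun n => `|b n|) `|t| sb; exact.
Qed.

Lemma abs_summableD b c : abs_summable b -> abs_summable c ->
  abs_summable (fun n => b n + c n).
Proof.
move=> sb sc; apply: (@abs_summableW (fun n => `|b n| + `|c n|)) => [n|].
  exact: ler_normD.
have := is_cvg_seriesD sb sc; exact.
Qed.

Lemma abs_summable_norm b : abs_summable b -> abs_summable (fun n => `|b n|).
Proof. by move=> sb; apply: abs_summableW sb => n; rewrite normr_id. Qed.

Lemma ssumZ t b : abs_summable b -> ssum (fun n => t * b n) = t * ssum b.
Proof.
by move=> /abs_summable_cvg sb; have := @lim_seriesZ R b t sb; exact.
Qed.

Lemma ssumD b c : abs_summable b -> abs_summable c ->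
  ssum (fun n => b n + c n) = ssum b + ssum c.
Proof.
by move=> /abs_summable_cvg sb /abs_summable_cvg sc; exact: lim_seriesD.
Qed.

Lemma ssumB b c : abs_summable b -> abs_summable c ->
  ssum (fun n => b n - c n) = ssum b - ssum c.
Proof.
by move=> /abs_summable_cvg sb /abs_summable_cvg sc; exact: lim_seriesB.
Qed.

Lemma ssum_le b c : abs_summable b -> abs_summable c ->
  (forall n, b n <= c n) -> ssum b <= ssum c.
Proof.
by move=> /abs_summable_cvg sb /abs_summable_cvg sc; exact: lim_series_le.
Qed.

Lemma ssum_ge0 b : abs_summable b -> (forall n, 0 <= b n) -> 0 <= ssum b.
Proof.
move=> /abs_summable_cvg sb b0; apply: limr_ge => //; apply: nearW => n.
by rewrite /series/= sumr_ge0.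
Qed.

Lemma ssum_norm b : abs_summable b -> `|ssum b| <= ssum (fun n => `|b n|).
Proof. exact: lim_series_norm. Qed.

Lemma ssum_ge_term b n : abs_summable b -> (forall n, 0 <= b n) -> b n <= ssum b.
Proof.
move=> /abs_summable_cvg sb b0; apply: limr_ge => //.
exists n.+1 => // k nk; rewrite /series/= (bigD1_seq n)//= ?iota_uniq//.
  by rewrite lerDl sumr_ge0.
by rewrite mem_index_iota.
Qed.

Definition geom_bounded : set (nat -> R) :=
  [set b | exists M : R, forall n, `|b n| <= M * 2^-1 ^+ n].

Lemma geom_bounded_summable b : geom_bounded b -> abs_summable b.
Proof.
move=> [M hM]; apply: (abs_summableW hM).
by apply: is_cvg_geometric_series; rewrite ger0_norm//; lra.
Qed.

Lemma pf_ssum : positive_functional geom_bounded ssum.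
Proof.
split.
- move=> f g [M hM] [N hN]; exists (M + N) => n.
  by rewrite mulrDl (le_trans (ler_normD _ _))// lerD.
- move=> c f [M hM]; exists (`|c| * M) => n.
  by rewrite normrM -mulrA ler_wpM2l.
- move=> f g [M hM] [N hN]; exists (M * N) => n; rewrite normrM.
  have N0 : 0 <= N by have := hN 0%N; rewrite expr0 mulr1; exact: le_trans.
  rewrite -mulrA; apply: le_trans (ler_pM _ _ (hM n) (hN n)) _ => //.
  have M0 : 0 <= M by have := hM 0%N; rewrite expr0 mulr1; exact: le_trans.
  have e1 : (2^-1 : R) ^+ n <= 1 by rewrite exprn_ile1//; lra.
  have e0 : 0 <= (2^-1 : R) ^+ n by rewrite exprn_ge0//; lra.
  rewrite -mulrA ler_wpM2l// mulrCA; by rewrite ler_wpM2l// ler_piMr.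
- by move=> f [M hM]; exists M => n; rewrite normr_id.
- by move=> f g /geom_bounded_summable ? /geom_bounded_summable ?; exact: ssumD.
- by move=> c f /geom_bounded_summable ?; exact: ssumZ.
- by move=> f /geom_bounded_summable ?; exact: ssum_ge0.
Qed.

(** Let f be the point of least norm in the l2-closure of B. Then
    <f, b> >= |f| ^ 2 for b in B, and |f| >= 1 since every element of B has a
    coordinate that is at least 1. The point f is found as the coordinatewise limit
    of a minimizing sequence. *)
Lemma convex_sequences_separation (B : set (nat -> R)) :
  B `<=` geom_bounded ->
  (forall b c (t : R), B b -> B c -> 0 <= t <= 1 -> B (fun n => b n + t * (c n - b n))) ->
  (forall b, B b -> exists n, 1 <= b n) ->
  exists f, (exists C : R, forall n, `|f n| <= C) /\
    (forall b, B b -> 1 <= ssum (fun n => f n * b n)).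
Proof.
move=> Bg Bc B1; have [B0|] := pselect (B !=set0); last first.
  move=> B0; exists (fun=> 0); split; first by exists 0 => n; rewrite normr0.
  by move=> b Bb; exfalso; apply: B0; exists b.
pose q b := ssum (fun n => b n ^+ 2).
have V2 b : B b -> geom_bounded b by exact: Bg.
have PF := pf_ssum.
have q1 b : B b -> 1 <= q b.
  move=> Bb; have [n bn] := B1 _ Bb.
  have sb2 := geom_bounded_summable (pf_memX2 PF (V2 _ Bb)).
  apply: le_trans (ssum_ge_term n sb2 _); last by move=> k; exact: sqr_ge0.
  by rewrite expr_ge1// (le_trans ler01).
have [m [m1 qm qe]] : exists m : R, [/\ 1 <= m, forall x, [set q b | b in B] x -> m <= x
    & forall e : R, 0 < e -> exists2 x, [set q b | b in B] x & x < m + e].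
  apply: approx_inf; first by case: B0 => b Bb; exists (q b), b.
  by move=> _ [b Bb <-]; exact: q1.
pose eta k : R := 2^-1 ^+ k.
have eta0 k : 0 < eta k by rewrite exprn_gt0//; lra.
have eta1 k : eta k <= 1 by rewrite exprn_ile1//; lra.
have /choice[x Hx] k : exists b, B b /\ q b <= m + eta k.
  by have [_ [b Bb <-] /ltW ?] := qe _ (eta0 k); exists b.
have Bx k : B (x k) by case: (Hx k).
have qx k : q (x k) <= m + eta k by case: (Hx k).
have Cau k l : q (fun n => x k n - x l n) <= 2 * eta k + 2 * eta l.
  rewrite /q (pf_parallelogram PF)//; [|exact: V2|exact: V2].
  have : m <= q (fun n => (x k n + x l n) / 2).
    apply: qm; eexists; [|reflexivity].
    have -> : (fun n => (x k n + x l n) / 2) =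
              (fun n => x k n + 2^-1 * (x l n - x k n)).
      by apply/funext => n; field.
    by apply: Bc => //; lra.
  have := qx k; have := qx l; rewrite /q; lra.
have etak k l : (k <= l)%N -> eta l <= eta k.
  by move=> kl; rewrite /eta ler_wiXn2l//; lra.
pose e k := Num.sqrt (4 * eta k).
have e0 : e @ \oo --> (0 : R).
  rewrite /e -(@sqrtr0 R).
  apply: (@cvg_comp _ _ _ (fun k => 4 * eta k) Num.sqrt _ (nbhs (0 : R))).
    by apply: cvg_geometric; rewrite ger0_norm//; lra.
  exact: sqrt_continuous.
have Cn n k l : (k <= l)%N -> `|x k n - x l n| <= e k.
  move=> kl; rewrite -(@ler_pXn2r _ 2)// ?nnegrE ?sqrtr_ge0//.
  rewrite real_normK ?num_real// sqr_sqrtr; last by rewrite mulr_ge0// ltW.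
  have V2' : geom_bounded (fun n => x k n - x l n).
    by apply: (pf_memB PF); exact: V2.
  have sb2 := geom_bounded_summable (pf_memX2 PF V2').
  have := ssum_ge_term n sb2 (fun=> sqr_ge0 _).
  have := Cau k l; have := etak _ _ kl; rewrite /q; lra.
have /choice[f fx] n : exists l : R, forall k, `|x k n - l| <= e k.
  by apply: cauchy_modulus e0 _ => k l; exact: Cn.
have fb : exists C : R, forall n, `|f n| <= C.
  have [M hM] := V2 _ (Bx 0%N); exists (`|M| + e 0%N) => n.
  rewrite -(subKr (x 0%N n) (f n)) (le_trans (ler_normB _ _))// lerD//.
  apply: le_trans (hM n) _; apply: le_trans (ler_norm _) _.
  rewrite normrM ler_piMr// normrX exprn_ile1// ger0_norm; lra.
exists f; split => // b Bb; have [C fC] := fb.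
have sb := geom_bounded_summable (V2 _ Bb).
have sfb : abs_summable (fun n => f n * b n).
  apply: (@abs_summableW (fun n => C * `|b n|)) => [n|].
    by rewrite normrM ler_wpM2r.
  have := @is_cvg_seriesZ R (fun n => `|b n|) C sb; exact.
apply/ler_addgt0Pr => d d0.
pose W := 2 * q b + 2 * (m + 1); pose Nb := ssum (fun n => `|b n|).
have qb1 := q1 _ Bb.
have W0 : 0 < W by rewrite /W; lra.
have Nb0 : 0 <= Nb by apply: ssum_ge0 => //; exact: abs_summable_norm.
pose t := Num.min 1 (d / W).
have t01 : 0 < t <= 1 by rewrite /t lt_min ltr01 divr_gt0//= ge_min lexx.
have tW : t * W <= d by rewrite -ler_pdivlMr// /t ge_min lexx orbT.
have [k [ke1 ke2]] : exists k, eta k <= t * d / 2 /\ e k * Nb <= d / 4.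
  have h1 : \forall k \near \oo, eta k < t * d / 2.
    have : eta @ \oo --> 0 by apply: cvg_expr; rewrite ger0_norm; lra.
    move/cvgr_lt; apply; case/andP: t01 => t00 _; have := mulr_gt0 t00 d0; lra.
  have h2 : \forall k \near \oo, e k * Nb < d / 4.
    have : (fun k => e k * Nb) @ \oo --> 0.
      by rewrite -(mul0r Nb); apply: cvgMl.
    by move/cvgr_lt; apply; lra.
  near \oo => k; exists k; split; apply/ltW; near: k; [exact: h1|exact: h2].
have V2k := V2 _ (Bx k); have V2b := V2 _ Bb.
have Vd := pf_memB PF V2b V2k.
(* first order condition at an almost minimal x k, in the direction of b *)
have fo : m - d * (3 / 4) <= ssum (fun n => x k n * b n).
  have : m <= q (fun n => x k n + t * (b n - x k n)).
    apply: qm; eexists; [|reflexivity]; apply: Bc => //.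
    by case/andP: t01 => /ltW -> ->.
  rewrite /q (pf_quad PF)//.
  have : ssum (fun n => (b n - x k n) ^+ 2) <= W.
    rewrite (pf_parallelogram PF)//.
    have : 0 <= ssum (fun n => ((b n + x k n) / 2) ^+ 2).
      apply: (pf_ge0 PF); last by move=> ?; exact: sqr_ge0.
      apply: (pf_memX2 PF); have := pf_memZ PF 2^-1 (pf_memD PF V2b V2k).
      by under eq_fun do rewrite mulrC.
    have := qx k; have := eta1 k; rewrite /W /q; lra.
  have -> : (fun n => x k n * (b n - x k n)) =
            (fun n => x k n * b n - x k n ^+ 2).
    by apply/funext => n; ring.
  rewrite (pf_B PF)//; [|exact: (pf_memM PF)|exact: (pf_memX2 PF)].
  have := qx k; have : m <= q (x k) by apply: qm; exists (x k).
  rewrite /q; set s := ssum (fun n => x k n * b n).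
  set qk := ssum _; set w := ssum _ => qk1 qk2 wW H.
  case/andP: t01 => t0 t1.
  have H1 : - eta k <= t * (2 * (s - qk) + t * w) by lra.
  have H2 : t * w <= d.
    by apply: le_trans tW; rewrite ler_pM2l.
  have : t * (- d / 2) <= t * (2 * (s - qk) + t * w) by lra.
  by rewrite ler_pM2l//; lra.
have : `|ssum (fun n => x k n * b n) - ssum (fun n => f n * b n)| <= d / 4.
  have sxb : abs_summable (fun n => x k n * b n).
    by apply: geom_bounded_summable; exact: (pf_memM PF).
  rewrite -ssumB//; apply: le_trans ke2.
  have sd : abs_summable (fun n => x k n * b n - f n * b n).
    apply: (@abs_summableW (fun n => e k * `|b n|)) => [n|].
      by rewrite -mulrBl normrM ler_wpM2r.
    have := @is_cvg_seriesZ R (fun n => `|b n|) (e k) sb; exact.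
  apply: le_trans (ssum_norm sd) _.
  rewrite /Nb -ssumZ; last exact: abs_summable_norm.
  apply: ssum_le => //; first exact: abs_summable_norm.
    by apply: abs_summableZ; exact: abs_summable_norm.
  by move=> n; rewrite -mulrBl normrM ler_wpM2r.
by rewrite ler_norml => /andP[h1 h2]; lra.
Unshelve. all: by end_near. Qed.

End real_sequences.

(** * Separation from balls *)

Section separation.
Context {R : realType} {S : Type} {V : set (S -> R)} {I : (S -> R) -> R}.
Hypothesis PF : positive_functional V I.
Hypothesis V1 : V (fun=> 1).
Hypothesis Vbounded : forall f, V f -> exists m : R, forall s, `|f s| <= m.
Hypothesis Vexcess : forall r f, 0 <= r -> V f -> V (fun s => excess r (f s)).

Definition convex_functions (E : set (S -> R)) : Prop :=
  forall X Y (t : R), E X -> E Y -> 0 <= t <= 1 ->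
    E (fun s => X s + t * (Y s - X s)).

Let J r X := I (fun s => excess r (X s) ^+ 2).

Lemma excess_sqr_mem r X : 0 <= r -> V X -> V (fun s => excess r (X s) ^+ 2).
Proof. by move=> r0 VX; apply: (pf_memX2 PF); exact: Vexcess. Qed.

Lemma J_mid r X Y a : 0 <= r -> V X -> V Y -> J r X <= a -> J r Y <= a ->
  J r (fun s => X s + 2^-1 * (Y s - X s)) <= a.
Proof.
move=> r0 VX VY JX JY.
have VXY : V (fun s => X s + 2^-1 * (Y s - X s)).
  by apply: (pf_memD PF) => //; apply: (pf_memZ PF); exact: (pf_memB PF).
have VeX := excess_sqr_mem r0 VX; have VeY := excess_sqr_mem r0 VY.
have : J r (fun s => X s + 2^-1 * (Y s - X s)) <=
    I (fun s => 2^-1 * (excess r (X s) ^+ 2 + excess r (Y s) ^+ 2)).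
  apply: (pf_le PF); first exact: excess_sqr_mem.
    by apply: (pf_memZ PF); exact: (pf_memD PF).
  move=> s; have -> : X s + 2^-1 * (Y s - X s) = (X s + Y s) / 2 by field.
  by rewrite [leRHS]mulrC; exact: excess_mid.
rewrite (pf_Z PF) ?(pf_D PF)//; last exact: (pf_memD PF).
by move: JX JY; rewrite /J; lra.
Qed.

(** Let m k be the least square norm in E under the constraint J r <= 2 ^ - k.
    These values increase to a limit; by the parallelogram identity almost
    minimal elements far along the sequence are close to each other. *)
Lemma minimal_norm_sequence (E : set (S -> R)) (r r' : R) : 0 <= r ->
  E `<=` V -> convex_functions E -> (forall X s, E X -> `|X s| <= r') ->
  (forall e, 0 < e -> exists2 X, E X & J r X <= e) ->
  exists X_ : nat -> S -> R, [/\ forall k, E (X_ k),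
    forall k, I (fun s => (X_ k.+1 s - X_ k s) ^+ 2) <= 4^-1 ^+ k
    & forall k, J r (X_ k) <= 2^-1 ^+ k].
Proof.
move=> r0 EV Ec Er' EJ.
pose h k : R := 2^-1 ^+ k.
have h0 k : 0 < h k by rewrite exprn_gt0//; lra.
have hle k l : (k <= l)%N -> h l <= h k by move=> kl; rewrite /h ler_wiXn2l//; lra.
pose F k := [set X | E X /\ J r X <= h k].
pose N2 X := I (fun s => X s ^+ 2).
have V2 X : E X -> V (fun s => X s ^+ 2) by move=> /EV; exact: (pf_memX2 PF).
have N2ge0 X : E X -> 0 <= N2 X.
  by move=> EX; apply: (pf_ge0 PF) => [|s]; [exact: V2|exact: sqr_ge0].
have N2le X : E X -> N2 X <= r' ^+ 2 * I (fun=> 1).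
  move=> EX; rewrite -(pf_Z PF)//; apply: (pf_le PF); first exact: V2.
    exact: (pf_memZ PF).
  move=> s; rewrite mulr1 -real_normK ?num_real// lerXn2r ?nnegrE//.
    exact: le_trans (Er' _ s EX).
  exact: Er'.
have /choice[m Hm] k : exists m : R, [/\ 0 <= m, forall x, [set N2 X | X in F k] x -> m <= x
    & forall e, 0 < e -> exists2 x, [set N2 X | X in F k] x & x < m + e].
  apply: approx_inf; first by have [X EX JX] := EJ _ (h0 k); exists (N2 X), X.
  by move=> _ [X [EX _] <-]; exact: N2ge0.
have mle k X : E X -> J r X <= h k -> m k <= N2 X.
  by move=> EX JX; have [_ + _] := Hm k; apply; exists X.
have mndecr : nondecreasing_seq m.
  move=> k l kl; apply/ler_addgt0Pr => e e0.
  have [_ _ /(_ _ e0)[_ [X [EX JX] <-] /ltW]] := Hm l.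
  by apply: le_trans; apply: mle => //; exact: le_trans (hle _ _ kl).
have mcvg : cvgn m.
  apply: nondecreasing_is_cvgn => //; exists (r' ^+ 2 * I (fun=> 1)) => _ [k _ <-].
  have [X EX JX] := EJ _ (h0 k).
  by apply: le_trans (N2le _ EX); exact: mle.
pose q := limn m.
have mq k : m k <= q by exact: nondecreasing_cvgn_le.
pose s k : R := 4^-1 ^+ k / 8.
have s0 k : 0 < s k by rewrite divr_gt0// exprn_gt0//; lra.
have sle k : s k.+1 <= s k.
  by rewrite /s ler_pM2r ?exprS ?ler_piMl ?exprn_ge0//; lra.
have /choice[Xn HX] k : exists Xn : (S -> R) * nat,
    [/\ E Xn.1, J r Xn.1 <= h Xn.2, (k <= Xn.2)%N, q - s k <= m Xn.2 &
       N2 Xn.1 <= q + s k].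
  have : \forall n \near \oo, q - s k < m n.
    by move/cvgr_gt : mcvg; apply; rewrite ltrBlDr ltrDl.
  case=> n0 _ Hn0; pose n := maxn k n0.
  have [_ _ /(_ _ (s0 k))[_ [X [EX JX] <-] /ltW XN]] := Hm n.
  exists (X, n); split => //=; first by rewrite leq_maxl.
    by apply/ltW/Hn0; exact: leq_maxr.
  by apply: le_trans XN _; rewrite lerD2r.
exists (fun k => (Xn k).1); split => [k|k|k]; last 1 first.
- by have [_ JX kX _ _] := HX k; apply: le_trans JX _; exact: hle.
- by have [] := HX k.
have [E1 J1 _ m1 N1] := HX k; have [E2 J2 _ m2 N2'] := HX k.+1.
rewrite (pf_parallelogram PF); [|exact: EV|exact: EV].
pose mid s := (Xn k).1 s + 2^-1 * ((Xn k.+1).1 s - (Xn k).1 s).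
have Emid : E mid by apply: Ec => //; lra.
have -> : (fun s => (((Xn k.+1).1 s + (Xn k).1 s) / 2) ^+ 2) = (fun s => mid s ^+ 2).
  by apply/funext => x; rewrite /mid; congr (_ ^+ 2); field.
have sk := sle k.
have : q - s k <= N2 mid.
  case: (leqP (Xn k).2 (Xn k.+1).2) => [l12|/ltnW l21].
    apply: (le_trans m1); apply: mle => //; apply: J_mid => //; try exact: EV.
    exact: le_trans J2 (hle _ _ l12).
  apply: (@le_trans _ _ (m (Xn k.+1).2)); first by lra.
  apply: mle => //; apply: J_mid => //; try exact: EV.
  exact: le_trans J1 (hle _ _ l21).
have : 4^-1 ^+ k = 8 * s k by rewrite /s; field.
by move=> ->; move: N1 N2'; rewrite /N2; lra.
Qed.

(** When E contains no element bounded by r, even in the limit, the penalty J r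
    has a positive infimum on E. By the first order condition at an almost
    minimal X0, integration against excess r (X0) is larger on E than on the ball
    of radius r, where it is at most r I |excess r (X0)|. *)
Lemma separation_step (E : set (S -> R)) (r r' : R) : 0 < r ->
  E `<=` V -> convex_functions E -> (forall X s, E X -> `|X s| <= r') ->
  (forall X_ : nat -> S -> R, (forall k, E (X_ k)) ->
    (forall k, I (fun s => (X_ k.+1 s - X_ k s) ^+ 2) <= 4^-1 ^+ k) ->
    (forall k, J r (X_ k) <= 2^-1 ^+ k) -> False) ->
  E !=set0 ->
  exists X0, [/\ E X0, 0 < I (fun s => `|excess r (X0 s)|) &
    forall X, E X ->
      r * I (fun s => `|excess r (X0 s)|) < I (fun s => X s * excess r (X0 s))].
Proof.
move=> r0 EV Ec Er' Ecl [Y0 EY0].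
have [d d0 dJ] : exists2 d, 0 < d & forall X, E X -> d <= J r X.
  apply: contrapT => H.
  have [|X_ [? ? ?]] := minimal_norm_sequence (ltW r0) EV Ec Er'.
    move=> e e0; apply: contrapT => He; apply: H; exists e => // X EX.
    by rewrite leNgt; apply/negP => /ltW ?; apply: He; exists X.
  exact: (Ecl X_).
have [m [dm mJ mE]] : exists m : R, [/\ d <= m, forall x, [set J r X | X in E] x -> m <= x
    & forall e, 0 < e -> exists2 x, [set J r X | X in E] x & x < m + e].
  by apply: approx_inf; [exists (J r Y0), Y0|move=> _ [X EX <-]; exact: dJ].
have m0 : 0 < m by exact: lt_le_trans dm.
have r'0 : 0 <= r'.
  apply: contrapT => /negP; rewrite -ltNge => r'0.
  suff : 0 <= - m by lra.
  have := mJ (J r Y0); have : J r Y0 <= 0.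
    have -> : 0 = I (fun=> 0 * 1) by rewrite (pf_Z PF)// mul0r.
    apply: (pf_le PF); first by apply: excess_sqr_mem; [exact: ltW|exact: EV].
      exact: (pf_memZ PF).
    by move=> s; have := Er' _ s EY0; have := normr_ge0 (Y0 s); lra.
  by move=> ? /(_ (imageP _ EY0)); lra.
have I1 : 0 <= I (fun=> 1) by apply: (pf_ge0 PF).
pose B := 4 * r' ^+ 2 * I (fun=> 1) + 1.
have B0 : 0 < B by rewrite ltr_wpDl// mulr_ge0// mulr_ge0// sqr_ge0.
pose t := Num.min 1 (m / (2 * B)).
have t0 : 0 < t by rewrite /t lt_min ltr01 divr_gt0// mulr_gt0.
have t1 : t <= 1 by rewrite /t ge_min lexx.
have tB : t * B <= m / 2.
  have : t <= m / (2 * B) by rewrite /t ge_min lexx orbT.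
  rewrite ler_pdivlMr; last by rewrite mulr_gt0.
  lra.
have tm0 : 0 < t * m / 4 by rewrite divr_gt0// mulr_gt0.
have [_ [X0 EX0 <-] J0] := mE _ tm0.
have VX0 := EV _ EX0; have Ve0 := Vexcess (ltW r0) VX0.
have Ve02 := pf_memX2 PF Ve0.
have JX0 : m <= J r X0 by apply: mJ; exists X0.
exists X0; split => //.
  have [b hb] := Vbounded Ve0.
  have b0 : 0 < b + 1.
    have [s0|Ns] := pselect (exists s : S, True).
      by case: s0 => s _; have := hb s; have := normr_ge0 (excess r (X0 s)); lra.
    exfalso; suff : J r X0 = 0 by lra.
    have -> : 0 = I (fun=> 0 * 1) by rewrite (pf_Z PF)// mul0r.
    by congr I; apply/funext => s; case: Ns; exists s.
  have : J r X0 <= (b + 1) * I (fun s => `|excess r (X0 s)|).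
    rewrite -(pf_Z PF); last exact: (pf_memN PF).
    apply: (pf_le PF) => //; first by apply: (pf_memZ PF); exact: (pf_memN PF).
    move=> s; rewrite -real_normK ?num_real// expr2 ler_wpM2r//.
    by have := hb s; lra.
  by move=> H; rewrite -(pmulr_rgt0 _ b0); lra.
move=> X EX; have VX := EV _ EX; have Vd := pf_memB PF VX VX0.
have VM1 := pf_memM PF Ve0 Vd; have VM2 := pf_memX2 PF Vd.
have H1 : m <= J r X0 + 2 * t * I (fun s => excess r (X0 s) * (X s - X0 s))
             + t ^+ 2 * I (fun s => (X s - X0 s) ^+ 2).
  apply: (@le_trans _ _ (J r (fun s => X0 s + t * (X s - X0 s)))).
    by apply: mJ; eexists; [|reflexivity]; apply: Ec => //; rewrite t1 ltW.
  rewrite /J -(pf_quad PF)//; apply: (pf_le PF).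
  - apply: excess_sqr_mem; first exact: ltW.
    by apply: (pf_memD PF) => //; exact: (pf_memZ PF).
  - by apply: (pf_memX2 PF); apply: (pf_memD PF) => //; exact: (pf_memZ PF).
  - move=> s; apply: le_trans (excess_step _ _ (ltW r0)) _.
    by rewrite le_eqVlt; apply/orP; left; apply/eqP; ring.
have H2 : I (fun s => (X s - X0 s) ^+ 2) <= B.
  apply: (@le_trans _ _ (4 * r' ^+ 2 * I (fun=> 1))); last by rewrite /B; lra.
  rewrite -(pf_Z PF)//; apply: (pf_le PF) => //; first exact: (pf_memZ PF).
  move=> s; have := Er' _ s EX; have := Er' _ s EX0.
  rewrite !ler_norml mulr1 => /andP[a1 a2] /andP[a3 a4].
  rewrite -subr_ge0.
  have -> : 4 * r' ^+ 2 - (X s - X0 s) ^+ 2 =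
    (2 * r' - (X s - X0 s)) * (2 * r' + (X s - X0 s)) by ring.
  by apply: mulr_ge0; lra.
have H3 : I (fun s => X s * excess r (X0 s)) =
    I (fun s => excess r (X0 s) * (X s - X0 s)) + (J r X0 + r * I (fun s => `|excess r (X0 s)|)).
  have VN := pf_memN PF Ve0; have VrN := pf_memZ PF r VN.
  rewrite /J -(pf_Z PF)// -(pf_D PF)// -(pf_D PF)//; last exact: (pf_memD PF).
  congr I; apply/funext => s; rewrite -excess_mul; [ring|exact: ltW].
rewrite H3; move: H1 H2 J0 JX0.
set a := I (fun s => _ * (_ - _)); set b := I _; set c := J r X0 => H1 H2 J0 JX0.
have H4 : t ^+ 2 * b <= t * (m / 2).
  rewrite expr2 -mulrA ler_pM2l//; apply: le_trans tB.
  by rewrite ler_pM2l.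
have : t * (- (m * (3 / 4))) <= t * (2 * a) by lra.
by rewrite ler_pM2l//; lra.
Qed.

(** The construction of Krein and Smulian, resting on closedness of K on bounded
    sets. Functionals w_0, w_1, ... are chosen one after the other, w_i of
    norm at most 1 / (r0 2 ^ i), such that no X in K bounded by r0 2 ^ n satisfies
    I (X w_i) <= 1 for all i < n: the elements of K bounded by r0 2 ^ (n + 1) with
    I (X w_i) <= 1 for i < n are separated from the ball of radius r0 2 ^ n by
    separation_step. Each X in K is bounded, hence I (X w_n) >= 1 for some n, and
    the sequences (I (X w_n))_n are separated from 0 in turn. Every functional
    is integration against an excess of an element of K, which keeps the result
    inside the predual. *)
Theorem krein_smulian_separation (K : set (S -> R)) (r0 : R) : 0 < r0 ->
  K `<=` V -> K !=set0 -> convex_functions K ->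
  (forall (r r' : R) (X_ : nat -> S -> R), 0 < r ->
    (forall k, K (X_ k)) -> (forall k s, `|X_ k s| <= r') ->
    (forall k, I (fun s => (X_ k.+1 s - X_ k s) ^+ 2) <= 4^-1 ^+ k) ->
    (forall k, I (fun s => excess r (X_ k s) ^+ 2) <= 2^-1 ^+ k) ->
    exists X, [/\ K X, forall s, `|X s| <= r &
      (fun k => I (fun s => `|X_ k s - X s|)) @ \oo --> (0 : R)]) ->
  (forall X, K X -> ~ (forall s, `|X s| <= r0)) ->
  exists (Z : nat -> S -> R) (C : nat -> R),
    [/\ forall n, exists r X, [/\ 0 <= r, K X & Z n = (fun s => excess r (X s))],
      exists B : R, forall n, `|C n| * I (fun s => `|Z n s|) <= B * 2^-1 ^+ n &
      forall X, K X -> 1 <= ssum (fun n => C n * I (fun s => X s * Z n s))].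
Proof.
move=> r00 KV [Y0 KY0] Kc Kcl Kr0.
pose rn n : R := r0 * 2 ^+ n.
have rn0 n : 0 < rn n by rewrite mulr_gt0// exprn_gt0.
pose good n (w : S -> R) := exists c r X, [/\ 0 <= r, K X,
  w = (fun s => c * excess r (X s)) & I (fun s => `|w s|) <= (rn n)^-1].
have goodV n w : good n w -> V w.
  move=> [c [r [X [r_ge0 KX -> _]]]]; apply: (pf_memZ PF).
  by apply: Vexcess => //; exact: KV.
pose feas (l : seq (S -> R)) n := [set X | [/\ K X, forall s, `|X s| <= rn n &
  forall i, (i < size l)%N -> I (fun s => X s * nth (fun=> 0) l i s) <= 1]].
(* invariant of the construction, with l the list of functionals chosen so far *)
pose P l := (forall X, ~ feas l (size l) X) /\
  forall i, (i < size l)%N -> good i (nth (fun=> 0) l i).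
have step l : exists w, P l -> P (rcons l w).
  have [[Pl gl]|NP] := pselect (P l); last by exists (fun=> 0).
  pose n := size l.
  suff [w gw wE] : exists2 w, good n w &
      forall X, feas l n.+1 X -> 1 < I (fun s => X s * w s).
    exists w => _; split.
      move=> X []; rewrite size_rcons => KX Xr Xl.
      have : feas l n.+1 X.
        split => // i il; have := Xl i; rewrite nth_rcons il; apply.
        exact: ltnW.
      move/wE; have := Xl n (ltnSn _); rewrite nth_rcons ltnn eqxx.
      by move=> /le_lt_trans /[apply]; rewrite ltxx.
    move=> i; rewrite size_rcons ltnS leq_eqVlt => /orP[/eqP ->|il].
      by rewrite nth_rcons ltnn eqxx.
    by rewrite nth_rcons il; exact: gl.
  have [E0|] := pselect (feas l n.+1 !=set0); last first.
    move=> NE; exists (fun s => 0 * excess 0 (Y0 s)).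
      exists 0, 0, Y0; split => //.
      under eq_fun do rewrite mul0r normr0 -(mul0r 1).
      by rewrite (pf_Z PF)// mul0r invr_ge0 ltW.
    by move=> X EX; exfalso; apply: NE; exists X.
  have [||||||X0 [EX0 I0 EX]] := @separation_step (feas l n.+1) (rn n) (rn n.+1).
  - exact: rn0.
  - by move=> X [/KV].
  - move=> X Y t [KX Xr Xl] [KY Yr Yl] /andP[t0 t1]; split.
    + by apply: Kc => //; rewrite t0.
    + move=> s; have := Xr s; have := Yr s; rewrite !ler_norml.
      by move=> /andP[? ?] /andP[? ?]; apply/andP; split; nra.
    + move=> i il; have Vz := goodV _ _ (gl _ il).
      have VX := KV _ KX; have VY := KV _ KY.
      have -> : (fun s => (X s + t * (Y s - X s)) * nth (fun=> 0) l i s) =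
          (fun s => (1 - t) * (X s * nth (fun=> 0) l i s)
                    + t * (Y s * nth (fun=> 0) l i s)).
        by apply/funext => s; ring.
      rewrite (pf_D PF) ?(pf_Z PF); [|try exact: (pf_memM PF)..].
      * by have := Xl i il; have := Yl i il; nra.
      * by apply: (pf_memZ PF); exact: (pf_memM PF).
      * by apply: (pf_memZ PF); exact: (pf_memM PF).
  - by move=> X s [_ + _]; exact.
  - move=> X_ EX_ Xc Xe.
    have [||||X [KX Xr XX]] := Kcl (rn n) (rn n.+1) X_ (rn0 n); rewrite //.
    + by move=> k; case: (EX_ k).
    + by move=> k s; case: (EX_ k).
    apply: (Pl X); split => // i il; have Vz := goodV _ _ (gl _ il).
    have [b hb] := Vbounded Vz.
    have VX := KV _ KX.
    apply/ler_addgt0Pr => e e0.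
    have [k ke] : exists k, b * I (fun s => `|X_ k s - X s|) <= e.
      have : (fun k => b * I (fun s => `|X_ k s - X s|)) @ \oo --> (0 : R).
        by rewrite -(mulr0 b); exact: cvgMr.
      by move/cvgr_lt => /(_ _ e0) [k _ /(_ k (leqnn k))/= /ltW]; exists k.
    have [KXk _ /(_ i il)] := EX_ k; have VXk := KV _ KXk.
    have := @pf_norm_le _ _ _ _ PF (nth (fun=> 0) l i) (fun s => X_ k s - X s) b Vz (pf_memB PF VXk VX) hb.
    have -> : (fun s => nth (fun=> 0) l i s * (X_ k s - X s)) =
       (fun s => X_ k s * nth (fun=> 0) l i s - X s * nth (fun=> 0) l i s).
      by apply/funext => s; ring.
    rewrite (pf_B PF); [|exact: (pf_memM PF)|exact: (pf_memM PF)].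
    by rewrite ler_norml => /andP[? ?] ?; lra.
  - exact: E0.
  have VX0 : V X0 by case: EX0 => /KV.
  have Ve := Vexcess (ltW (rn0 n)) VX0.
  pose c := (rn n * I (fun s => `|excess (rn n) (X0 s)|))^-1.
  have c0 : 0 < c by rewrite invr_gt0 mulr_gt0.
  exists (fun s => c * excess (rn n) (X0 s)).
    exists c, (rn n), X0; split => //; [exact: ltW|by case: EX0|].
    under eq_fun do rewrite normrM (gtr0_norm c0).
    rewrite (pf_Z PF); last exact: (pf_memN PF).
    by rewrite /c invfM mulrAC -mulrA mulfV ?mulr1// gt_eqF.
  move=> X /[dup] [[/KV VX _ _]] /EX.
  have -> : (fun s => X s * (c * excess (rn n) (X0 s))) =
      (fun s => c * (X s * excess (rn n) (X0 s))) by apply/funext => s; ring.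
  rewrite (pf_Z PF); last exact: (pf_memM PF).
  by rewrite /c [X in _ -> _ < X]mulrC ltr_pdivlMr ?mul1r// mulr_gt0.
have {}step := choice step; case: step => step Hstep.
pose ln n := iter n (fun l => rcons l (step l)) [::].
have Pln n : P (ln n).
  elim: n => [|n /Hstep//]; split => //= X [KX Xr _]; apply: (Kr0 _ KX) => s.
  by have := Xr s; rewrite /rn expr0 mulr1.
pose z n := step (ln n).
have lnE n : ln n = mkseq z n.
  elim: n => //= n IH; rewrite -[in RHS]addn1 /mkseq iotaD map_cat -cats1/=.
  by rewrite add0n; congr (_ ++ _).
have gz n : good n (z n).
  have [_ /(_ n)] := Pln n.+1; rewrite lnE size_mkseq ltnSn nth_mkseq//.
  exact.
have zE X : K X -> exists n, 1 <= I (fun s => X s * z n s).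
  move=> KX; have [M XM] := Vbounded (KV _ KX).
  have [n Mn] : exists n, M <= rn n.
    exists (Num.bound (`|M| / r0)).
    rewrite /rn -ler_pdivrMl//; apply: le_trans (ler_norm _) _.
    rewrite normrM mulrC [X in _ * X]gtr0_norm ?invr_gt0//.
    apply: le_trans (ltW (archi_boundP _)) _; first by rewrite divr_ge0// ltW.
    by rewrite -natrX ler_nat ltnW// ltn_expl.
  have [/(_ X) NP _] := Pln n; apply: contrapT => H; apply: NP.
  rewrite lnE size_mkseq; split => // [s|i].
    exact: le_trans Mn.
  rewrite size_mkseq => i_n; rewrite nth_mkseq// leNgt; apply/negP => /ltW ?.
  by apply: H; exists i.
pose Bset := [set b | exists2 X, K X & b = (fun n => I (fun s => X s * z n s))].
have [||| f [[C fC] Bf]] := @convex_sequences_separation R Bset.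
- move=> _ [X KX ->]; have [M XM] := Vbounded (KV _ KX).
  exists (`|M| / r0) => n; have Vz := goodV _ _ (gz n).
  apply: le_trans (pf_norm_le PF (KV _ KX) Vz XM) _.
  have [_ [_ [_ [_ _ _]]]] := gz n; rewrite /rn invfM -exprVn => zb.
  apply: (@le_trans _ _ (`|M| * I (fun s => `|z n s|))).
    rewrite ler_wpM2r ?ler_norm//; apply: (pf_ge0 PF) => //; exact: (pf_memN PF).
  by rewrite -mulrA ler_wpM2l.
- move=> _ _ t [X KX ->] [Y KY ->] t01.
  exists (fun s => X s + t * (Y s - X s)); first exact: Kc.
  have VX := KV _ KX; have VY := KV _ KY.
  apply/funext => n; have Vz := goodV _ _ (gz n).
  have VXz := pf_memM PF VX Vz; have VYz := pf_memM PF VY Vz.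
  have VB := pf_memB PF VYz VXz.
  have -> : (fun s => (X s + t * (Y s - X s)) * z n s) =
      (fun s => X s * z n s + t * (Y s * z n s - X s * z n s)).
    by apply/funext => s; ring.
  have VtB := pf_memZ PF t VB.
  by rewrite (pf_D PF)// (pf_Z PF)// (pf_B PF).
- by move=> _ [X KX ->]; exact: zE.
have /choice[c Hc] := gz; have /choice[rr Hrr] := Hc; have /choice[Xz HXz] := Hrr.
exists (fun n s => excess (rr n) (Xz n s)), (fun n => f n * c n); split.
- by move=> n; exists (rr n), (Xz n); have [] := HXz n.
- exists (`|C| / r0) => n; have [rr0 KXz zn] := HXz n.
  have Ve := Vexcess rr0 (KV _ KXz).
  rewrite {1}zn; under eq_fun do rewrite normrM.
  rewrite (pf_Z PF); last exact: (pf_memN PF).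
  rewrite /rn invfM -exprVn => zb; rewrite normrM -!mulrA.
  rewrite ler_pM//; last by apply: le_trans (fC n) (ler_norm _).
  by rewrite mulr_ge0//; apply: (pf_ge0 PF) => //; exact: (pf_memN PF).
- move=> X KX.
  suff -> : (fun n => f n * c n * I (fun s => X s * excess (rr n) (Xz n s))) =
      (fun n => f n * I (fun s => X s * z n s)) by apply: Bf; exists X.
  apply/funext => n; have [rr0 KXz zn _] := HXz n.
  rewrite -mulrA; congr (_ * _).
  have Ve := Vexcess rr0 (KV _ KXz).
  rewrite -(pf_Z PF); last by apply: (pf_memM PF) => //; exact: KV.
  by rewrite zn; congr I; apply/funext => s; ring.
Qed.

End separation.

(** * Limits of measurable functions and means *)

Lemma continuous_excess (R : realType) (r : R) : continuous (excess r : R -> R).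
Proof.
move=> x; rewrite /continuous_at /excess; apply: cvgB; first exact: cvg_id.
apply: (@continuous_max _ R (fun=> - r) (fun x => Num.min r x)); first exact: cst_continuous.
apply: (@continuous_min _ R (fun=> r) idfun); first exact: cst_continuous.
exact: cvg_id.
Qed.

Section measurable_limits.
Context d (T : measurableType d) (R : realType).

Lemma measurable_true (b : T -> bool) : measurable_fun setT b ->
  measurable [set w | b w].
Proof.
move=> mb; have := mb measurableT [set true] Logic.I.
by rewrite setTI; congr measurable; apply/seteqP; split.
Qed.

Lemma measurable_cvgn (u : nat -> T -> R) :
  (forall n, measurable_fun setT (u n)) -> measurable [set w | cvgn (u ^~ w)].
Proof.
move=> mu.
suff -> : [set w | cvgn (u ^~ w)] = \bigcap_k \bigcup_N \bigcap_n
    [set w | `|u (N + n)%N w - u N w| <= k.+1%:R^-1].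
  apply: bigcapT_measurable => k; apply: bigcupT_measurable => N.
  apply: bigcapT_measurable => n; apply: measurable_true.
  apply: measurable_fun_ler => //; apply: measurableT_comp => //.
  exact: measurable_funB.
apply/seteqP; split => [w /= cu k _|w H].
  move/cauchy_cvgP/cauchyP : (cu) => /(_ k.+1%:R^-1).
  have k0 : 0 < k.+1%:R^-1 :> R by rewrite invr_gt0.
  have : \forall n \near \oo, `|limn (u ^~ w) - u n w| < k.+1%:R^-1 / 2.
    by move/cvgrPdist_lt : (cu : u ^~ w @ \oo --> limn (u ^~ w)); apply; rewrite divr_gt0.
  case=> N _ HN _; exists N => // n _ /=.
  have h1 := HN _ (leqnn N); have h2 := HN _ (leq_addr n N).
  move: h1 h2; rewrite /=; set x := k.+1%:R^-1; rewrite !ltr_norml => /andP[? ?] /andP[? ?].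
  by rewrite ler_norml; apply/andP; split; lra.
apply/cauchy_cvgP/cauchy_exP => e e0.
have [k ke] : exists k : nat, k.+1%:R^-1 < e.
  exists (Num.bound e^-1); rewrite invf_plt ?posrE//.
  apply: lt_le_trans (archi_boundP _) _; first by rewrite invr_ge0 ltW.
  by rewrite ler_nat.
have [N _ HN] := H k Logic.I; exists (u N w); exists N => //= n Nn.
rewrite -ball_normE/= distrC; apply: le_lt_trans ke.
by have := HN (n - N)%N Logic.I; rewrite /= subnKC.
Qed.

(** Off the measurable set of convergence, limn takes a default value. *)
Lemma measurable_limn (u : nat -> T -> R) :
  (forall n, measurable_fun setT (u n)) ->
  measurable_fun setT (fun w => limn (u ^~ w)).
Proof.
move=> mu; have mC := measurable_cvgn mu.
apply: (@measurable_fun_cvg _ _ _ setT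
  (fun n w => if w \in [set w | cvgn (u ^~ w)] then u n w else point)).
  move=> n; apply: measurable_fun_ifT => //.
    by apply: (measurable_fun_bool true); rewrite setTI (_ : _ @^-1` _ = [set w | cvgn (u ^~ w)])//;
      apply/seteqP; split => w /=; [move/set_mem|move/mem_set].
move=> w _; case: (boolP (w \in [set w | cvgn (u ^~ w)])) => [/set_mem//|/negP H].
rewrite /= dvgP; first exact: cvg_cst.
by move=> ?; apply: H; exact: mem_set.
Qed.

Lemma measurable_series (u : nat -> T -> R) n :
  (forall n, measurable_fun setT (u n)) ->
  measurable_fun setT (fun w => series (u ^~ w) n).
Proof. by move=> mu; apply: measurable_sum => k; exact: mu. Qed.

Lemma measurable_ssum (u : nat -> T -> R) :
  (forall n, measurable_fun setT (u n)) ->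
  measurable_fun setT (fun w => ssum (u ^~ w)).
Proof.
move=> mu; rewrite /ssum; apply: (@measurable_limn (fun n w => series (u ^~ w) n)).
by move=> n; exact: measurable_series.
Qed.

End measurable_limits.

Section expectation.
Context d (T : measurableType d) (R : realType) (P : probability T R).
Implicit Types f g h : T -> R.

Definition L1 f : Prop := P.-integrable setT (EFin \o f).

Definition mean f : R := \int[P]_w f w.

Lemma L1_measurable f : L1 f -> measurable_fun setT f.
Proof. by move=> /(measurable_int P) /measurable_EFinP. Qed.

Lemma L1_mean f : L1 f -> (mean f)%:E = (\int[P]_w (f w)%:E)%E.
Proof.
by move=> Lf; rewrite /mean /Rintegral fineK//; exact: integrable_fin_num.
Qed.

Lemma L1_le f g : measurable_fun setT f -> (\forall w \ae P, `|f w| <= g w) ->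
  L1 g -> L1 f.
Proof.
move=> mf fg Lg; have mg := L1_measurable Lg; apply/integrableP; split.
  exact/measurable_EFinP.
move/integrableP : Lg => [_]; apply: le_lt_trans.
apply: ae_ge0_le_integral => //.
- by apply: measurableT_comp => //; exact/measurable_EFinP.
- by apply: measurableT_comp => //; exact/measurable_EFinP.
- apply: filterS fg => w fgw _ /=; rewrite lee_fin; exact: le_trans (ler_norm _).
Qed.

Lemma L1_cst (c : R) : L1 (fun=> c).
Proof. exact: finite_measure_integrable_cst. Qed.

Lemma L1_bounded f (m : R) : measurable_fun setT f ->
  (\forall w \ae P, `|f w| <= m) -> L1 f.
Proof. by move=> mf fm; apply: (L1_le mf fm); exact: L1_cst. Qed.

Lemma L1D f g : L1 f -> L1 g -> L1 (fun w => f w + g w).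
Proof. by move=> Lf Lg; have := integrableD measurableT Lf Lg. Qed.

Lemma L1B f g : L1 f -> L1 g -> L1 (fun w => f w - g w).
Proof. by move=> Lf Lg; have := integrableB measurableT Lf Lg. Qed.

Lemma L1Z (c : R) f : L1 f -> L1 (fun w => c * f w).
Proof. by move=> Lf; have := integrableZl measurableT c Lf. Qed.

Lemma L1_norm f : L1 f -> L1 (fun w => `|f w|).
Proof. by move=> Lf; have := integrable_norm Lf. Qed.

Lemma L1M (m : T -> R) f (c : R) : measurable_fun setT m ->
  (\forall w \ae P, `|m w| <= c) -> L1 f -> L1 (fun w => m w * f w).
Proof.
move=> mm mc Lf; apply: (@L1_le _ (fun w => `|c| * `|f w|)).
- by apply: measurable_funM => //; exact: L1_measurable.
- apply: filterS mc => w mcw; rewrite normrM ler_wpM2r//.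
  exact: le_trans (ler_norm _).
- by apply: L1Z; exact: L1_norm.
Qed.

Lemma L1_indic A f : measurable A -> L1 f -> L1 (fun w => \1_A w * f w).
Proof.
move=> mA; apply: (@L1M _ _ 1); first exact: measurable_indic.
apply: aeW => w; rewrite indicE; case: (_ \in _); rewrite ?normr1 ?normr0//.
Qed.

Lemma meanD f g : L1 f -> L1 g -> mean (fun w => f w + g w) = mean f + mean g.
Proof. by move=> Lf Lg; exact: RintegralD. Qed.

Lemma meanB f g : L1 f -> L1 g -> mean (fun w => f w - g w) = mean f - mean g.
Proof. by move=> Lf Lg; exact: RintegralB. Qed.

Lemma meanZ (c : R) f : L1 f -> mean (fun w => c * f w) = c * mean f.
Proof. by move=> Lf; exact: RintegralZl. Qed.

Lemma mean_cst (c : R) : mean (fun=> c) = c.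
Proof.
apply: EFin_inj; rewrite L1_mean; last exact: L1_cst.
rewrite integral_cst//.
transitivity (c%:E * 1)%E; last by rewrite mule1.
by congr (_ * _)%E; exact: (@probability_setT _ _ _ P).
Qed.

Lemma mean_ae_eq f g : measurable_fun setT f -> measurable_fun setT g ->
  (\forall w \ae P, f w = g w) -> mean f = mean g.
Proof.
move=> mf mg fg; rewrite /mean /Rintegral; congr fine.
apply: ae_eq_integral => //; [exact/measurable_EFinP|exact/measurable_EFinP|].
by apply: filterS fg => w -> _.
Qed.

Lemma mean_ge0 f : L1 f -> (\forall w \ae P, 0 <= f w) -> 0 <= mean f.
Proof.
move=> Lf f0; rewrite (@mean_ae_eq f (fun w => `|f w|)).
- by apply: Rintegral_ge0 => w _.
- exact: L1_measurable.
- exact: L1_measurable (L1_norm Lf).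
- by apply: filterS f0 => w f0; rewrite ger0_norm.
Qed.

Lemma mean_le f g : L1 f -> L1 g -> (\forall w \ae P, f w <= g w) ->
  mean f <= mean g.
Proof.
move=> Lf Lg fg; rewrite -subr_ge0 -meanB//; apply: mean_ge0; first exact: L1B.
by apply: filterS fg => w; rewrite subr_ge0.
Qed.

Lemma mean_norm_le f : L1 f -> `|mean f| <= mean (fun w => `|f w|).
Proof. by move=> Lf; exact: le_normr_Rintegral. Qed.

Lemma mean_eq0 f : L1 f -> (\forall w \ae P, 0 <= f w) -> mean f <= 0 ->
  \forall w \ae P, f w = 0.
Proof.
move=> Lf f0 mf0; have mf := L1_measurable Lf.
have /ae_eq_integral_abs : (\int[P]_w `|(f w)%:E| = 0)%E.
  have := L1_mean (L1_norm Lf); rewrite /= => <-.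
  suff -> : mean (fun w => `|f w|) = 0 by [].
  apply/eqP; rewrite eq_le; apply/andP; split; last first.
    by apply: Rintegral_ge0.
  apply: le_trans mf0; apply: mean_le => //; first exact: L1_norm.
  by apply: filterS f0 => w f0; rewrite ger0_norm.
move=> /(_ measurableT); have /measurable_EFinP mf' := mf; move=> /(_ mf').
by apply: filterS => w /(_ Logic.I)/= [].
Qed.

Lemma mean_dct (u : nat -> T -> R) f g : (forall n, measurable_fun setT (u n)) ->
  measurable_fun setT f -> L1 g -> (forall n, \forall w \ae P, `|u n w| <= g w) ->
  (\forall w \ae P, u ^~ w @ \oo --> f w) ->
  [/\ L1 f, (fun n => mean (fun w => `|u n w - f w|)) @ \oo --> (0 : R)
    & (fun n => mean (u n)) @ \oo --> mean f].
Proof.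
move=> mu mf Lg ug uf.
have [|||||Lf H _] := @dominated_convergence _ _ _ P setT measurableT
  (fun n w => (u n w)%:E) (EFin \o f) (EFin \o g).
- by move=> n; apply/measurable_EFinP.
- exact/measurable_EFinP.
- by apply: filterS uf => w uf _; apply/cvg_EFin => //; exact: nearW.
- exact: Lg.
- have /ae_foralln := ug; apply: filterS => w H n _ /=; rewrite lee_fin; exact: H.
have Lu n : L1 (u n) by exact: L1_le (ug n) Lg.
have Ld n : L1 (fun w => `|u n w - f w|) by apply: L1_norm; exact: L1B.
have H0 : (fun n => mean (fun w => `|u n w - f w|)) @ \oo --> (0 : R).
  exact: (fine_cvg H).
split => //; apply/cvgrPdist_le => e e0.
move/cvgr_lt : H0 => /(_ _ e0); apply: filterS => n /ltW; apply: le_trans.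
by rewrite distrC -meanB//; apply: mean_norm_le; exact: L1B.
Qed.

End expectation.

(** * Summable sequences of random variables *)

Lemma partial_sum_le (R : realType) (b : nat -> R) n : (forall t, 0 <= b t) ->
  cvgn (series b) -> \sum_(0 <= t < n) b t <= ssum b.
Proof.
move=> b0 cb; have := @nondecreasing_cvgn_le R (series b) _ cb n; apply.
by apply: nondecreasing_series => t _ _.
Qed.

Section summable_processes.
Context d (T : measurableType d) (R : realType) (P : probability T R).
Implicit Types f g : nat -> T -> R.

(** Integrability with respect to the product of P and the counting measure. *)
Definition psummable f : Prop := (forall t, measurable_fun setT (f t)) /\
  (\int[P]_w \sum_(0 <= t <oo) `|f t w|%:E < +oo)%E.

Definition psum f : T -> R := fun w => ssum (f ^~ w).

Lemma measurable_norm_series f : (forall t, measurable_fun setT (f t)) ->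
  measurable_fun setT (fun w => (\sum_(0 <= t <oo) `|f t w|%:E)%E).
Proof.
move=> mf; apply: (@ge0_emeasurable_sum _ _ _ setT (fun t w => (`|f t w|%:E)%E) xpredT) => // t _.
by apply/measurable_EFinP; exact: measurableT_comp.
Qed.

Lemma measurable_psum f : (forall t, measurable_fun setT (f t)) ->
  measurable_fun setT (psum f).
Proof. exact: measurable_ssum. Qed.

Lemma psummable_L1 f t : psummable f -> L1 P (f t).
Proof.
move=> [mf fy]; apply/integrableP; split; first exact/measurable_EFinP.
apply: le_lt_trans fy; apply: ge0_le_integral => //.
- by apply: measurableT_comp => //; exact/measurable_EFinP.
- exact: measurable_norm_series.
- move=> w _; have := @nneseries_lim_ge R (fun t => `|f t w|%:E)%E xpredT 0%N t.+1.
  move=> H; apply: le_trans (H _) => //.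
  rewrite big_nat_recr//= leeDr// sume_ge0// => i _.
Qed.

Lemma psummable_cvg f : psummable f -> \forall w \ae P, abs_summable (f ^~ w).
Proof.
move=> [mf fy]; have mS := measurable_norm_series mf.
have /(integrable_ae measurableT) : P.-integrable setT
    (fun w => (\sum_(0 <= t <oo) `|f t w|%:E)%E).
  apply/integrableP; split => //; under eq_integral do rewrite gee0_abs ?nneseries_ge0//.
  exact: fy.
apply: filterS => w /(_ Logic.I) wfin; apply: nnseries_is_cvg => //.
by move: wfin => /fin_numPlt/andP[].
Qed.

Lemma eseries_ssum (b : nat -> R) : abs_summable b ->
  (\sum_(0 <= t <oo) `|b t|%:E)%E = (ssum (fun t => `|b t|))%:E.
Proof.
move=> sb; rewrite /ssum -EFin_lim//; congr (lim (_ @ \oo)).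
by apply/funext => n; rewrite /= /series/= sumEFin.
Qed.

Lemma psummable_normL1 f : psummable f -> L1 P (fun w => ssum (fun t => `|f t w|)).
Proof.
move=> sf; have [mf fy] := sf; apply/integrableP; split.
  apply/measurable_EFinP; apply: (@measurable_ssum _ _ _ (fun t w => `|f t w|)).
  by move=> t; exact: measurableT_comp.
apply: le_lt_trans fy; apply: ae_ge0_le_integral => //.
- apply: measurableT_comp => //; apply/measurable_EFinP.
  apply: (@measurable_ssum _ _ _ (fun t w => `|f t w|)).
  by move=> t; exact: measurableT_comp.
- by move=> w _; apply: nneseries_ge0.
- exact: measurable_norm_series.
- have := psummable_cvg sf; apply: filterS => w sw _.
  rewrite eseries_ssum//= ger0_norm//; apply: ssum_ge0 => //.
  exact: abs_summable_norm.
Qed.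

Lemma psum_norm_le f : psummable f ->
  \forall w \ae P, `|psum f w| <= ssum (fun t => `|f t w|).
Proof. by move=> /psummable_cvg; apply: filterS => w; exact: ssum_norm. Qed.

Lemma L1_psum f : psummable f -> L1 P (psum f).
Proof.
move=> sf; apply: (L1_le _ (psum_norm_le sf) (psummable_normL1 sf)).
by apply: measurable_psum; case: sf.
Qed.

Lemma psummable_le f g : (forall t, measurable_fun setT (g t)) ->
  (forall t, \forall w \ae P, `|g t w| <= `|f t w|) -> psummable f -> psummable g.
Proof.
move=> mg gf [mf fy]; split => //; apply: le_lt_trans fy.
apply: ae_ge0_le_integral => //.
- by move=> w _; apply: nneseries_ge0.
- exact: measurable_norm_series.
- by move=> w _; apply: nneseries_ge0.
- exact: measurable_norm_series.
- have := ae_foralln gf; apply: filterS => w gfw _.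
  by apply: lee_nneseries => // t _; rewrite lee_fin.
Qed.

Lemma psummableP f : (forall t, L1 P (f t)) ->
  (exists B : R, forall n, \sum_(0 <= t < n) mean P (fun w => `|f t w|) <= B) ->
  psummable f.
Proof.
move=> Lf [B fB]; have mf t := L1_measurable (Lf t); split => //.
rewrite integral_nneseries//; last first.
  by move=> t; apply/measurable_EFinP; exact: measurableT_comp.
apply: (@le_lt_trans _ _ B%:E); last exact: ltry.
apply: lime_le.
  by apply: is_cvg_nneseries => t _ _; apply: integral_ge0 => w _; rewrite lee_fin.
apply: nearW => n; under eq_bigr do rewrite -(L1_mean (L1_norm (Lf _))).
by rewrite sumEFin lee_fin.
Qed.

Lemma psummable_mean f : psummable f ->
  abs_summable (fun t => mean P (fun w => `|f t w|)).
Proof.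
move=> sf; have [mf fy] := sf; apply: nnseries_is_cvg => //.
move: fy; rewrite integral_nneseries//; last first.
  by move=> t; apply/measurable_EFinP; exact: measurableT_comp.
congr (_ < _)%E; congr (lim (_ @ \oo)); apply/funext => n; apply: eq_bigr => t _.
rewrite ger0_norm; last by apply: Rintegral_ge0.
by rewrite L1_mean//; apply: L1_norm; exact: psummable_L1.
Qed.

Lemma psummableZ (c : R) f : psummable f -> psummable (fun t w => c * f t w).
Proof.
move=> sf; have Lf t := psummable_L1 t sf.
apply: psummableP => [t|]; first exact: L1Z.
exists (`|c| * ssum (fun t => mean P (fun w => `|f t w|))) => n.
under eq_bigr => t _.
  under eq_fun do rewrite normrM.
  rewrite meanZ; last exact: L1_norm.
  over.
have /abs_summable_cvg cm := psummable_mean sf.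
rewrite -mulr_sumr ler_wpM2l//; apply: partial_sum_le => // t.
exact: Rintegral_ge0.
Qed.

Lemma psummableM (m : nat -> T -> R) (c : R) f :
  (forall t, measurable_fun setT (m t)) ->
  (forall t, \forall w \ae P, `|m t w| <= c) -> psummable f ->
  psummable (fun t w => m t w * f t w).
Proof.
move=> mm mc sf; apply: (psummable_le _ _ (psummableZ c sf)) => [t|t].
  by apply: measurable_funM => //; case: sf.
apply: filterS (mc t) => w mcw; rewrite !normrM ler_wpM2r//.
exact: le_trans (ler_norm _).
Qed.

Lemma psummableD f g : psummable f -> psummable g ->
  psummable (fun t w => f t w + g t w).
Proof.
move=> sf sg; have Lf t := psummable_L1 t sf; have Lg t := psummable_L1 t sg.
apply: psummableP => [t|]; first exact: L1D.
exists (ssum (fun t => mean P (fun w => `|f t w|)) +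
        ssum (fun t => mean P (fun w => `|g t w|))) => n.
have bound h : psummable h -> \sum_(0 <= t < n) mean P (fun w => `|h t w|) <=
    ssum (fun t => mean P (fun w => `|h t w|)).
  move=> sh; have /abs_summable_cvg cm := psummable_mean sh.
  by apply: partial_sum_le => // t; exact: Rintegral_ge0.
apply: le_trans (lerD (bound _ sf) (bound _ sg)).
rewrite -big_split/=; apply: ler_sum => t _.
rewrite -meanD; [|exact: L1_norm|exact: L1_norm].
apply: mean_le; [by apply: L1_norm; exact: L1D|by apply: L1D; exact: L1_norm|].
by apply: aeW => w; exact: ler_normD.
Qed.

Lemma psumD f g : psummable f -> psummable g ->
  \forall w \ae P, psum (fun t w => f t w + g t w) w = psum f w + psum g w.
Proof.
move=> /psummable_cvg sf /psummable_cvg sg.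
by apply: filterS2 sf sg => w; exact: ssumD.
Qed.

Lemma psumM (m : T -> R) f : psummable f ->
  \forall w \ae P, psum (fun t w => m w * f t w) w = m w * psum f w.
Proof. by move=> /psummable_cvg; apply: filterS => w; exact: ssumZ. Qed.

Lemma psum_le f g : psummable f -> psummable g ->
  (forall t, \forall w \ae P, f t w <= g t w) ->
  \forall w \ae P, psum f w <= psum g w.
Proof.
move=> /psummable_cvg sf /psummable_cvg sg /ae_foralln.
by apply: filterS3 sf sg => w; exact: ssum_le.
Qed.

Lemma psum_eq f g : (forall t, \forall w \ae P, f t w = g t w) ->
  \forall w \ae P, psum f w = psum g w.
Proof.
by move=> /ae_foralln; apply: filterS => w H; congr ssum; apply/funext.
Qed.

Lemma mean_psum f : psummable f -> mean P (psum f) = ssum (fun t => mean P (f t)).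
Proof.
move=> sf; have [mf fy] := sf; have Lf t := psummable_L1 t sf.
have [|||||_ _ H] := @mean_dct _ _ _ P (fun n w => series (f ^~ w) n) (psum f)
   (fun w => ssum (fun t => `|f t w|)).
- by move=> n; exact: measurable_series.
- exact: measurable_psum.
- exact: psummable_normL1.
- move=> n; have := psummable_cvg sf; apply: filterS => w sw.
  by apply: le_trans (ler_norm_sum _ _ _) _; exact: partial_sum_le.
- by have := psummable_cvg sf; apply: filterS => w /abs_summable_cvg.
have mE n : mean P (fun w => series (f ^~ w) n) = series (fun t => mean P (f t)) n.
  have Ls k : L1 P (fun w => series (f ^~ w) k).
    elim: k => [|k IH]; first by rewrite /series/=; under eq_fun do rewrite big_geq//; exact: L1_cst.
    by under eq_fun do rewrite seriesSr; exact: L1D.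
  elim: n => [|n IH].
    by rewrite /series/= big_geq//; under eq_fun do rewrite big_geq//; exact: mean_cst.
  rewrite seriesSr -IH -meanD//; congr mean; apply/funext => w; exact: seriesSr.
rewrite /ssum (_ : series _ = fun n => mean P (fun w => series (f ^~ w) n)).
  by apply/esym/cvg_lim.
by apply/funext => n; rewrite mE.
Qed.

(** Dominated convergence for series (Tannery). *)
Lemma ssum_dct (u : nat -> nat -> R) (v b : nat -> R) :
  (forall n t, `|u n t| <= b t) -> (forall t, u ^~ t @ \oo --> v t) ->
  cvgn (series b) -> (fun n => ssum (u n)) @ \oo --> ssum v.
Proof.
move=> ub uv sb.
have b0 t : 0 <= b t by exact: le_trans (ub 0%N t).
have vb t : `|v t| <= b t.
  rewrite -(cvg_lim _ (cvg_norm (uv t)))//; apply: limr_le.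
    by apply/cvg_ex; eexists; exact: cvg_norm.
  by apply: nearW => n; exact: ub.
have su n : abs_summable (u n) by exact: abs_summableW sb.
have sv : abs_summable v by exact: abs_summableW sb.
apply/cvgrPdist_le => e e0.
have : \forall N \near \oo, `|limn (series b) - series b N| <= e / 4.
  by move/cvgrPdist_le : sb; apply; rewrite divr_gt0.
case=> N _ /(_ _ (leqnn N)) HN.
have H : (fun n => \sum_(0 <= t < N) `|v t - u n t|) @ \oo --> (0 : R).
  rewrite [X in _ --> X](_ : 0 = \sum_(0 <= t < N) (`|v t - v t| : R)); last first.
    by rewrite big1// => t _; rewrite subrr normr0.
  elim: N {HN} => [|N IH].
    by rewrite big_geq//; under eq_fun do rewrite big_geq//; exact: cvg_cst.
  rewrite big_nat_recr//=; under eq_fun do rewrite big_nat_recr//=.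
  by apply: cvgD => //; apply: cvg_norm; apply: cvgB => //; exact: cvg_cst.
have e2 : 0 < e / 2 by rewrite divr_gt0.
move/cvgr_le : H => /(_ _ e2); apply: filterS => n Hn.
rewrite -ssumB//.
have sd : abs_summable (fun t => v t - u n t).
  have := abs_summableD sv (@abs_summableZ _ (-1) _ (su n)).
  by under eq_fun do rewrite mulN1r.
apply: le_trans (ssum_norm sd) _; apply: limr_le => //.
exists N => // k /= Nk; rewrite /series/= (big_cat_nat (n := N))//=.
have -> : e = e / 2 + e / 2 by rewrite -splitr.
apply: lerD => //.
apply: (@le_trans _ _ (2 * \sum_(N <= t < k) b t)).
  rewrite mulr_sumr; apply: ler_sum => t _.
  apply: le_trans (ler_normB _ _) _; have := vb t; have := ub n t; lra.
have : \sum_(N <= t < k) b t <= limn (series b) - series b N.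
  rewrite -sub_series_geq// lerB//; apply: nondecreasing_cvgn_le => //.
  by apply: nondecreasing_series => t _ _.
by move: HN; rewrite /= ler_norml => /andP[_]; lra.
Qed.

Lemma psum_dct (u : nat -> nat -> T -> R) f b :
  (forall n t, measurable_fun setT (u n t)) -> (forall t, measurable_fun setT (f t)) ->
  psummable b -> (forall n t, \forall w \ae P, `|u n t w| <= `|b t w|) ->
  (forall t, \forall w \ae P, (fun n => u n t w) @ \oo --> f t w) ->
  (\forall w \ae P, (fun n => psum (u n) w) @ \oo --> psum f w) /\
  (fun n => mean P (psum (u n))) @ \oo --> mean P (psum f).
Proof.
move=> mu mf sb ub uf.
have ubf : \forall w \ae P, forall n t, `|u n t w| <= `|b t w|.
  by apply: ae_foralln => n; apply: ae_foralln => t; exact: ub.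
have cvw : \forall w \ae P, (fun n => psum (u n) w) @ \oo --> psum f w.
  have := ae_foralln uf; apply: filterS3 (psummable_cvg sb) ubf => w sbw ubw ufw.
  exact: (ssum_dct ubw ufw sbw).
split => //.
have [|||||_ _ //] := @mean_dct _ _ _ P (fun n => psum (u n)) (psum f)
   (fun w => ssum (fun t => `|b t w|)).
- by move=> n; exact: measurable_psum.
- exact: measurable_psum.
- exact: psummable_normL1.
- move=> n; apply: filterS2 (psummable_cvg sb) ubf => w sbw ubw.
  have sun : abs_summable (u n ^~ w) by exact: abs_summableW (ubw n) sbw.
  apply: le_trans (ssum_norm sun) _; apply: ssum_le => //.
    exact: abs_summable_norm.
  exact: abs_summable_norm.
- exact: cvw.
Qed.

End summable_processes.

(** * Conditional expectations *)

Section restriction.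
Context d (T : measurableType d) (R : realType) (P : probability T R).
Variables (G : set (set T)) (GM : G `<=` measurable).

Lemma sigma_sub_measurable : <<s G >> `<=` (measurable : set (set T)).
Proof.
apply: smallest_sub => //; split => [||A mA].
- exact: measurable0.
- by move=> A mA; rewrite setTD; exact: measurableC.
- exact: bigcupT_measurable.
Qed.

(** P as a measure on the coarser measurable space generated by G; the inclusion
    GM is mentioned so that the measure structure may depend on it. *)
Definition restr_measure : set (g_sigma_algebraType G) -> \bar R :=
  let _ := GM in P.

Let restr0 : restr_measure set0 = 0%E. Proof. exact: measure0. Qed.

Let restr_ge0 A : (0 <= restr_measure A)%E. Proof. exact: measure_ge0. Qed.

Let restr_sigma_additive : semi_sigma_additive restr_measure.
Proof.
move=> A mA tA mUA; apply: (@measure_semi_sigma_additive _ T R P) => //.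
- by move=> n; apply: sigma_sub_measurable; exact: mA.
- by apply: sigma_sub_measurable; exact: mUA.
Qed.

HB.instance Definition _ := isMeasure.Build _ _ _ restr_measure
  restr0 restr_ge0 restr_sigma_additive.

Let restrT : restr_measure setT = 1%E. Proof. exact: (@probability_setT _ _ _ P). Qed.

HB.instance Definition _ := Measure_isProbability.Build _ _ _ restr_measure restrT.

Let idG : T -> g_sigma_algebraType G := id.

Let midG : measurable_fun setT idG.
Proof. by move=> _ A mA; rewrite setTI; exact: sigma_sub_measurable. Qed.

Lemma sub_measurable_fun d' (U : measurableType d') (f : T -> U) :
  sub_measurable G f -> measurable_fun setT f.
Proof.
move=> mf _ A mA; rewrite setTI; apply: sigma_sub_measurable.
by rewrite -[X in _ X]setTI; exact: mf.
Qed.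

Lemma restr_integrable (f : g_sigma_algebraType G -> \bar R) :
  restr_measure.-integrable setT f -> P.-integrable setT (f : T -> \bar R).
Proof.
move=> /integrableP[mf fy]; apply/integrableP; split.
  exact: sub_measurable_fun.
have := @ge0_integral_pushforward _ _ T (g_sigma_algebraType G) R idG midG P setT (abse \o f).
rewrite /=; move=> <-//.
by apply: measurableT_comp.
Qed.

Lemma restr_integral (f : g_sigma_algebraType G -> \bar R) A :
  restr_measure.-integrable setT f -> <<s G >> A ->
  (\int[restr_measure]_(x in A) f x = \int[P]_(x in A) f x)%E.
Proof.
move=> intf GA; have mf := measurable_int _ intf.
have := @integral_pushforward _ _ T (g_sigma_algebraType G) R idG midG P A f mf.
apply => //; apply: (@integrableS _ _ _ _ setT) => //.
  exact: sigma_sub_measurable.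
exact: restr_integrable.
Qed.

Definition restr_charge (Y : T -> R) (LY : L1 P Y) : set (g_sigma_algebraType G) -> \bar R :=
  let _ := GM in induced_charge LY.

Section charge.
Variables (Y : T -> R) (LY : L1 P Y).

Let ch0 : restr_charge LY set0 = 0%E. Proof. exact: charge0. Qed.

Let chfin A : measurable A -> restr_charge LY A \is a fin_num.
Proof. by move=> mA; apply: fin_num_measure; exact: sigma_sub_measurable. Qed.

Let chadd : semi_sigma_additive (restr_charge LY).
Proof.
move=> A mA tA mUA.
apply: (@charge_semi_sigma_additive _ T R (induced_charge (LY : P.-integrable setT (EFin \o Y))) A) => //.
- by move=> n; apply: sigma_sub_measurable; exact: mA.
- by apply: sigma_sub_measurable; exact: mUA.
Qed.

HB.instance Definition _ := isCharge.Build _ _ _ (restr_charge LY) ch0 chfin chadd.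

(** The Radon-Nikodym derivative, on the coarser space, of A |-> E[Y 1_A]. *)
Lemma condexp_exists : is_condexp P G Y (condexp P G Y).
Proof.
rewrite /condexp; case: xgetP => [Z -> //|noZ]; exfalso.
have dom : restr_charge LY `<< restr_measure.
  apply/null_content_dominatesP => A mA PA; rewrite /restr_charge/=.
  have mA' : d.-measurable (A : set T) by exact: sigma_sub_measurable.
  apply: null_set_integral => //.
  by apply: measurable_funTS; exact: measurable_int LY.
have fint := Radon_Nikodym_integrable dom.
have ffin x := Radon_Nikodym_fin_num x dom.
have fE A := Radon_Nikodym_integral dom (A := A).
set f := Radon_Nikodym _ _ in fint ffin fE.
apply: (noZ (fun w => fine (f w))); split.
- have mf := measurable_int _ fint.
  have : measurable_fun [set: g_sigma_algebraType G] (fine \o f).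
    apply: measurableT_comp => //.
  exact.
- have := restr_integrable fint; apply: eq_integrable => // w _ /=.
  by rewrite fineK.
- move=> A GA; have sA : <<s G >> A by exact: sub_sigma_algebra.
  transitivity (restr_charge LY A); last by [].
  rewrite fE// restr_integral//; apply: eq_integral => w _.
  by rewrite fineK.
Qed.

End charge.

End restriction.

(** * Measurability up to null sets *)

Lemma measurable_excess (R : realType) (r : R) : measurable_fun setT (excess r : R -> R).
Proof.
apply: measurable_funB => //; apply: measurable_maxr; first exact: measurable_cst.
by apply: measurable_minr => //; exact: measurable_cst.
Qed.

Section as_measurable_theory.
Context d (T : measurableType d) (R : realType) (P : probability T R).
Variables (G : set (set T)) (GM : G `<=` measurable).

Section general.
Context d' (U : measurableType d').
Implicit Types f g : T -> U.

Lemma asm_measurable f : as_measurable P G f -> measurable_fun setT f.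
Proof. by case. Qed.

Lemma asm_sub f : sub_measurable G f -> as_measurable P G f.
Proof.
move=> mf; split; first exact: (sub_measurable_fun GM).
by exists f => //; exact: aeW.
Qed.

Lemma asm_ae f g : as_measurable P G f -> measurable_fun setT g ->
  (\forall w \ae P, f w = g w) -> as_measurable P G g.
Proof.
move=> [mf [h mh fh]] mg fg; split => //; exists h => //.
by apply: filterS2 fh fg => w <- <-.
Qed.

Lemma asm_comp d2 (V : measurableType d2) (h : U -> V) f :
  measurable_fun setT h -> as_measurable P G f ->
  as_measurable P G (fun w => h (f w)).
Proof.
move=> mh [mf [g mg fg]]; split; first exact: measurableT_comp.
exists (fun w => h (g w)); first exact: (measurableT_comp mh mg).
by apply: filterS fg => w ->.
Qed.

Lemma asm_set (sG : sigma_algebra setT G) f B : as_measurable P G f ->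
  measurable B -> exists2 A, G A & \forall w \ae P, A w <-> B (f w).
Proof.
move=> [mf [g mg fg]] mB; exists (g @^-1` B).
  by have := mg measurableT B mB; rewrite setTI /measurable/= sigma_algebra_id.
by apply: filterS fg => w ->.
Qed.

End general.

Implicit Types f g : T -> R.

Lemma asm_cst (c : R) : as_measurable P G (fun=> c).
Proof. by apply: asm_sub; exact: measurable_cst. Qed.

Lemma asm_indic A : G A -> as_measurable P G (\1_A : T -> R).
Proof.
move=> GA; apply: asm_sub.
apply: (@measurable_indic _ (g_sigma_algebraType G)).
exact: sub_sigma_algebra.
Qed.

Lemma asmD f g : as_measurable P G f -> as_measurable P G g ->
  as_measurable P G (fun w => f w + g w).
Proof.
move=> [mf [f' mf' ff']] [mg [g' mg' gg']]; split; first exact: measurable_funD.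
exists (fun w => f' w + g' w); first exact: (measurable_funD mf' mg').
by apply: filterS2 ff' gg' => w -> ->.
Qed.

Lemma asmM f g : as_measurable P G f -> as_measurable P G g ->
  as_measurable P G (fun w => f w * g w).
Proof.
move=> [mf [f' mf' ff']] [mg [g' mg' gg']]; split; first exact: measurable_funM.
exists (fun w => f' w * g' w); first exact: (measurable_funM mf' mg').
by apply: filterS2 ff' gg' => w -> ->.
Qed.

Lemma asmZ (c : R) f : as_measurable P G f -> as_measurable P G (fun w => c * f w).
Proof. by apply: asmM; exact: asm_cst. Qed.

Lemma asmB f g : as_measurable P G f -> as_measurable P G g ->
  as_measurable P G (fun w => f w - g w).
Proof.
move=> asf /(asmZ (-1)) asg; have := asmD asf asg.
by under eq_fun do rewrite mulN1r.
Qed.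

Lemma asm_excess r f : as_measurable P G f ->
  as_measurable P G (fun w => excess r (f w)).
Proof. exact: asm_comp (measurable_excess r). Qed.

Lemma asm_lim (u : nat -> T -> R) f : (forall n, as_measurable P G (u n)) ->
  measurable_fun setT f -> (\forall w \ae P, u ^~ w @ \oo --> f w) ->
  as_measurable P G f.
Proof.
move=> mu mf uf; split => //.
have /choice[v Hv] n : exists v, sub_measurable G v /\ \forall w \ae P, u n w = v w.
  by have [_ [v ? ?]] := mu n; exists v.
exists (fun w => limn (v ^~ w)).
  apply: (@measurable_limn _ (g_sigma_algebraType G) R v) => n.
  by case: (Hv n).
have : \forall w \ae P, forall n, u n w = v n w.
  by apply: ae_foralln => n; case: (Hv n).
apply: filterS2 uf => w uf uv; apply/esym/cvg_lim => //.
by rewrite (_ : v ^~ w = u ^~ w)//; apply/funext => n.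
Qed.

Lemma asm_ssum (u : nat -> T -> R) : (forall n, as_measurable P G (u n)) ->
  as_measurable P G (fun w => ssum (u ^~ w)).
Proof.
move=> mu; split; first by apply: measurable_ssum => n; case: (mu n).
have /choice[v Hv] n : exists v, sub_measurable G v /\ \forall w \ae P, u n w = v w.
  by have [_ [v ? ?]] := mu n; exists v.
exists (fun w => ssum (v ^~ w)).
  apply: (@measurable_ssum _ (g_sigma_algebraType G) R v) => n.
  by case: (Hv n).
have : \forall w \ae P, forall n, u n w = v n w.
  by apply: ae_foralln => n; case: (Hv n).
by apply: filterS => w uv; congr ssum; apply/funext.
Qed.

Lemma asm_sum (u : nat -> T -> R) n : (forall k, as_measurable P G (u k)) ->
  as_measurable P G (fun w => \sum_(0 <= k < n) u k w).
Proof.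
move=> mu; elim: n => [|n IH].
  by under eq_fun do rewrite big_geq//; exact: asm_cst.
by under eq_fun do rewrite big_nat_recr//=; exact: asmD.
Qed.

Lemma Linfty_cst (c : R) : Linfty P G (fun=> c).
Proof. by split; [exact: asm_cst|exists `|c|; exact: aeW]. Qed.

Lemma Linfty_indic A : G A -> Linfty P G (\1_A : T -> R).
Proof.
move=> GA; split; first exact: asm_indic.
by exists 1; apply: aeW => w; rewrite indicE; case: (_ \in _); rewrite ?normr1 ?normr0.
Qed.

Lemma LinftyD f g : Linfty P G f -> Linfty P G g -> Linfty P G (fun w => f w + g w).
Proof.
move=> [mf [m fm]] [mg [n gn]]; split; first exact: asmD.
exists (m + n); apply: filterS2 fm gn => w fm gn.
by apply: le_trans (ler_normD _ _) _; exact: lerD.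
Qed.

Lemma LinftyM f g : Linfty P G f -> Linfty P G g -> Linfty P G (fun w => f w * g w).
Proof.
move=> [mf [m fm]] [mg [n gn]]; split; first exact: asmM.
exists (m * n); apply: filterS2 fm gn => w fm gn.
by rewrite normrM; exact: ler_pM.
Qed.

Lemma LinftyB f g : Linfty P G f -> Linfty P G g -> Linfty P G (fun w => f w - g w).
Proof.
move=> lf lg; have := LinftyD lf (LinftyM (Linfty_cst (-1)) lg).
by under eq_fun do rewrite mulN1r.
Qed.

Lemma Linfty_L1 f g : Linfty P G f -> L1 P g -> L1 P (fun w => f w * g w).
Proof. by move=> [[mf _] [c fc]]; exact: (L1M mf fc). Qed.

(** The event {f > g} belongs to G up to a null set, and may be used as a test. *)
Lemma asm_compare (sG : sigma_algebra setT G) f g : L1 P f -> L1 P g ->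
  as_measurable P G f -> as_measurable P G g ->
  (forall A, G A -> mean P (fun w => \1_A w * f w) <= mean P (fun w => \1_A w * g w)) ->
  \forall w \ae P, f w <= g w.
Proof.
move=> Lf Lg af ag H.
have [A GA AE] := asm_set sG (asmB af ag) (measurable_itv `]0, +oo[).
have mA := GM GA.
have : \forall w \ae P, \1_A w * (f w - g w) = 0.
  apply: (@mean_eq0 _ _ _ P (fun w => \1_A w * (f w - g w))).
  - by apply: L1_indic => //; exact: L1B.
  - apply: filterS AE => w; rewrite /= in_itv/= andbT indicE => AE.
    case: (boolP (w \in A)) => [/set_mem/AE /ltW|_]; by rewrite ?mul1r ?mul0r.
  - have -> : (fun w => \1_A w * (f w - g w)) = (fun w => \1_A w * f w - \1_A w * g w).
      by apply/funext => w; rewrite mulrBr.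
    rewrite meanB; [|exact: L1_indic|exact: L1_indic].
    by rewrite subr_le0; exact: H.
apply: filterS2 AE => w; rewrite /= in_itv/= andbT indicE => AE.
rewrite leNgt => /eqP H0; apply/negP; rewrite -subr_gt0 => fg.
have /mem_set wA := AE.2 fg.
by move: H0; rewrite wA mul1r gt_eqF.
Qed.

End as_measurable_theory.

Lemma asm_mono d (T : measurableType d) (R : realType) (P : probability T R)
    d' (U : measurableType d') (G H : set (set T)) (f : T -> U) :
  G `<=` H -> as_measurable P G f -> as_measurable P H f.
Proof.
move=> GH [mf [g mg fg]]; split => //; exists g => // _ B mB.
have := mg measurableT B mB; rewrite /measurable/= !setTI.
by apply: sub_sigma_algebra2.
Qed.

(** * Properties of conditional expectations *)

Import HBNNSimple.

Section condexp_theory.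
Context d (T : measurableType d) (R : realType) (P : probability T R).
Variables (G : set (set T)) (GM : G `<=` measurable).
Hypothesis sG : sigma_algebra setT G.
Implicit Types Y Z : T -> R.

Lemma condexp_asm Y : as_measurable P G (condexp P G Y).
Proof.
apply: (asm_sub P GM); rewrite /condexp; case: xgetP => [Z -> []//|_].
exact: measurable_cst.
Qed.

Lemma condexp_L1 Y : L1 P (condexp P G Y).
Proof.
rewrite /condexp; case: xgetP => [Z -> []//|_]; exact: L1_cst.
Qed.

Lemma condexp_mean Y A : L1 P Y -> G A ->
  mean P (fun w => \1_A w * condexp P G Y w) = mean P (fun w => \1_A w * Y w).
Proof.
move=> LY GA; have [_ _ /(_ A GA) H] := condexp_exists GM LY.
have mA := GM GA.
have key Z : L1 P Z -> (mean P (fun w => \1_A w * Z w))%:E = (\int[P]_(w in A) (Z w)%:E)%E.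
  move=> LZ; rewrite L1_mean; last exact: L1_indic.
  rewrite [RHS]integral_mkcond; apply: eq_integral => w _.
  by rewrite patchE indicE; case: (_ \in _); rewrite ?mul1r ?mul0r.
by apply: EFin_inj; rewrite !key//; exact: condexp_L1.
Qed.

Lemma mean_sum_seq (I : eqType) (s : seq I) (f : I -> T -> R) :
  (forall i, L1 P (f i)) ->
  L1 P (fun w => \sum_(i <- s) f i w) /\
  mean P (fun w => \sum_(i <- s) f i w) = \sum_(i <- s) mean P (f i).
Proof.
move=> Lf; elim: s => [|i s [Ls IH]].
  under eq_fun do rewrite big_nil.
  by rewrite big_nil; split; [exact: L1_cst|exact: mean_cst].
under eq_fun do rewrite big_cons.
by rewrite big_cons -IH; split; [exact: L1D|exact: meanD].
Qed.

(** Up to an additive constant, a bounded variable known in G is an increasing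
    limit of simple ones, for which this is the defining property. *)
Lemma condexp_pull m Y : L1 P Y -> Linfty P G m ->
  mean P (fun w => m w * condexp P G Y w) = mean P (fun w => m w * Y w).
Proof.
move=> LY lm; have LZ := condexp_L1 Y.
set Z := condexp P G Y in LZ *.
pose D w := Z w - Y w; have LD : L1 P D by exact: L1B.
suff H n : Linfty P G n -> mean P (fun w => n w * D w) = 0.
  apply/eqP; rewrite -subr_eq0 -meanB; [|exact: Linfty_L1 lm _..].
  by rewrite -[eqbRHS](H m lm); apply/eqP; congr mean; apply/funext => w; rewrite mulrBr.
move=> {m lm}; move=> [[mn [m mm nm]] [c0' nc0]].
have [c c0 nc] : exists2 c : R, 0 <= c & \forall w \ae P, `|n w| <= c.
  exists `|c0'| => //; apply: filterS nc0 => w; move/le_trans; apply.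
  exact: ler_norm.
(* a bounded nonnegative G-measurable version, up to a constant *)
pose q w := Num.max 0 (Num.min (m w + c) (2 * c)).
have mq : measurable_fun [set: g_sigma_algebraType G] q.
  apply: measurable_maxr; first exact: measurable_cst.
  apply: measurable_minr; last exact: measurable_cst.
  by apply: measurable_funD; [exact: mm|exact: measurable_cst].
have meanD0 A : G A -> mean P (fun w => \1_A w * D w) = 0.
  move=> GA; have -> : (fun w => \1_A w * D w) = (fun w => \1_A w * Z w - \1_A w * Y w).
    by apply/funext => w; rewrite mulrBr.
  have mA := GM GA.
  rewrite meanB; [|exact: L1_indic|exact: L1_indic].
  by rewrite condexp_mean// subrr.
have q0 w : 0 <= q w by rewrite /q le_max lexx.
have q2c w : q w <= 2 * c by rewrite /q ge_max mulr_ge0//= ge_min lexx orbT.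
have /(_ (EFin \o q)) := @approximation _ (g_sigma_algebraType G) R setT measurableT.
have mq' : measurable_fun [set: g_sigma_algebraType G] (EFin \o q) by exact/measurable_EFinP.
move=> /(_ mq' (fun w _ => q0 w))[g [gnd gq]].
have gq' w : (fun n => g n w) @ \oo --> q w.
  by have := gq w Logic.I => /fine_cvg.
have gle k w : g k w <= q w.
  rewrite -(cvg_lim _ (gq' w))//; apply: nondecreasing_cvgn_le.
    by move=> i j ij; have /lefP := gnd _ _ ij; exact.
  by apply/cvg_ex; exists (q w).
have mg k : measurable_fun setT (g k : T -> R).
  apply: (sub_measurable_fun GM); exact: measurable_funP.
have mqT : measurable_fun setT q by exact: (sub_measurable_fun GM mq).
have mD : measurable_fun setT D by exact: L1_measurable LD.
have gD k : mean P (fun w => g k w * D w) = 0.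
  pose s : seq R := finmap.enum_fset (fset_set (range (g k))).
  have -> : (fun w => g k w * D w) =
      (fun w => \sum_(y <- s) (y * (\1_(g k @^-1` [set y]) w * D w))).
    apply/funext => w; rewrite (fimfunE (g k)) fsbig_finite//= mulr_suml.
    by apply: eq_bigr => y _; rewrite mulrA.
  have GA y : G (g k @^-1` [set y]).
    have := @measurable_funP _ _ _ _ setT (g k) measurableT [set y] (measurable_set1 y).
    by rewrite setTI /measurable/= sigma_algebra_id.
  have LA y : L1 P (fun w => \1_(g k @^-1` [set y]) w * D w).
    by apply: L1_indic => //; exact: GM.
  have [_ ->] := @mean_sum_seq _ s (fun y w => y * (\1_(g k @^-1` [set y]) w * D w)) (fun y => L1Z y (LA y)).
  by rewrite big1_seq// => y _; rewrite meanZ// meanD0// mulr0.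
have [|||||_ _ H] := @mean_dct _ _ _ P (fun n w => g n w * D w) (fun w => q w * D w)
    (fun w => 2 * c * `|D w|).
- by move=> k; exact: measurable_funM.
- exact: measurable_funM.
- by apply: L1Z; exact: L1_norm.
- move=> k; apply: aeW => w; rewrite normrM ler_wpM2r// ger0_norm//.
  by apply: le_trans (gle k w) _.
- by apply: aeW => w; apply: cvgM; [exact: gq'|exact: cvg_cst].
have qD0 : mean P (fun w => q w * D w) = 0.
  rewrite -(cvg_lim _ H)//; under eq_fun do rewrite gD.
  by apply: cvg_lim => //; exact: cvg_cst.
have lq : L1 P (fun w => q w * D w).
  apply: (@L1M _ _ _ P q D (2 * c)) => //; apply: aeW => w; rewrite ger0_norm//.
have E : \forall w \ae P, n w * D w = q w * D w - c * D w.
  apply: filterS2 nm nc => w nmw; rewrite ler_norml => /andP[n1 n2].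
  rewrite -mulrBl; congr (_ * _); rewrite /q -nmw.
  rewrite (min_idPl _); last lra.
  by rewrite (max_idPr _); lra.
rewrite (@mean_ae_eq _ _ _ P _ (fun w => q w * D w - c * D w)).
- rewrite meanB//; last exact: L1Z.
  rewrite qD0 meanZ//; have : mean P (fun w => \1_setT w * D w) = 0.
    apply: meanD0; case: sG => G0 GC _; rewrite -[setT]setD0; exact: GC.
  under eq_fun do rewrite indicT mul1r.
  by move=> ->; rewrite mulr0 subrr.
- exact: measurable_funM.
- by apply: measurable_funB; apply: measurable_funM.
- exact: E.
Qed.

End condexp_theory.

Section condexp_algebra.
Context d (T : measurableType d) (R : realType) (P : probability T R).
Variables (G : set (set T)) (GM : G `<=` measurable).
Hypothesis sG : sigma_algebra setT G.
Implicit Types Y Z : T -> R.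

Lemma asm_unique Y Z : L1 P Y -> L1 P Z ->
  as_measurable P G Y -> as_measurable P G Z ->
  (forall A, G A -> mean P (fun w => \1_A w * Y w) = mean P (fun w => \1_A w * Z w)) ->
  \forall w \ae P, Y w = Z w.
Proof.
move=> LY LZ aY aZ H.
have H1 : \forall w \ae P, Y w <= Z w.
  by apply: (asm_compare GM sG LY LZ aY aZ) => A GA; rewrite H.
have H2 : \forall w \ae P, Z w <= Y w.
  by apply: (asm_compare GM sG LZ LY aZ aY) => A GA; rewrite H.
by apply: filterS2 H1 H2 => w ? ?; apply/eqP; rewrite eq_le; apply/andP.
Qed.

Lemma condexp_unique Y Z : L1 P Y -> L1 P Z -> as_measurable P G Z ->
  (forall A, G A -> mean P (fun w => \1_A w * Z w) = mean P (fun w => \1_A w * Y w)) ->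
  \forall w \ae P, condexp P G Y w = Z w.
Proof.
move=> LY LZ aZ H; apply: asm_unique => //; first exact: condexp_L1.
  exact: condexp_asm.
by move=> A GA; rewrite H// condexp_mean.
Qed.

Lemma condexp_linear (u v : T -> R) Y Z : Linfty P G u -> Linfty P G v ->
  L1 P Y -> L1 P Z ->
  \forall w \ae P, condexp P G (fun w => u w * Y w + v w * Z w) w =
    u w * condexp P G Y w + v w * condexp P G Z w.
Proof.
move=> lu lv LY LZ; have LcY := condexp_L1 P G Y; have LcZ := condexp_L1 P G Z.
have L f g : Linfty P G f -> L1 P g -> L1 P (fun w => f w * g w) by exact: Linfty_L1.
have au := lu.1; have av := lv.1.
apply: condexp_unique; [by apply: L1D; exact: L|by apply: L1D; exact: L| |].
  by apply: asmD; apply: asmM => //; exact: condexp_asm.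
move=> A GA; have lA := Linfty_indic P GM GA.
have E f g : (fun w => \1_A w * (u w * f w + v w * g w)) =
    (fun w => (\1_A w * u w) * f w + (\1_A w * v w) * g w).
  by apply/funext => w; rewrite mulrDr !mulrA.
have lAu : Linfty P G (fun w => \1_A w * u w) by exact: LinftyM.
have lAv : Linfty P G (fun w => \1_A w * v w) by exact: LinftyM.
by rewrite !E !meanD; [|exact: L..]; rewrite !condexp_pull.
Qed.

Lemma condexp_le Y Z : L1 P Y -> L1 P Z -> (\forall w \ae P, Y w <= Z w) ->
  \forall w \ae P, condexp P G Y w <= condexp P G Z w.
Proof.
move=> LY LZ YZ.
apply: (asm_compare GM sG (condexp_L1 P G Y) (condexp_L1 P G Z) (condexp_asm P GM Y) (condexp_asm P GM Z)) => A GA.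
rewrite !condexp_mean//; have mA := GM GA.
apply: mean_le; [exact: L1_indic|exact: L1_indic|].
apply: filterS YZ => w YZ; rewrite ler_wpM2l// indicE; by case: (_ \in _).
Qed.

Lemma condexp_ae_eq Y Z : L1 P Y -> L1 P Z -> (\forall w \ae P, Y w = Z w) ->
  \forall w \ae P, condexp P G Y w = condexp P G Z w.
Proof.
move=> LY LZ YZ.
have H1 : \forall w \ae P, condexp P G Y w <= condexp P G Z w.
  by apply: condexp_le => //; apply: filterS YZ => w ->.
have H2 : \forall w \ae P, condexp P G Z w <= condexp P G Y w.
  by apply: condexp_le => //; apply: filterS YZ => w ->.
by apply: filterS2 H1 H2 => w ? ?; apply/eqP; rewrite eq_le; apply/andP.
Qed.

Lemma condexp_id Y : L1 P Y -> as_measurable P G Y ->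
  \forall w \ae P, condexp P G Y w = Y w.
Proof. by move=> LY aY; exact: condexp_unique. Qed.

End condexp_algebra.

(** * Essential infima *)

Section essential_infimum.
Context d (T : measurableType d) (R : realType) (P : probability T R).
Implicit Types (f h : T -> \bar R) (S : set (T -> \bar R)).

Lemma measurable_contract f : measurable_fun setT f ->
  measurable_fun setT (fun w => contract (f w)).
Proof.
move=> mf; apply: (measurability _ (RGenCInfty.measurableE R)) => _ [_ [c ->] <-].
have [c1|c1] := leP c (-1).
  rewrite (_ : _ `&` _ = setT)//; apply/seteqP; split => // w _; split => //=.
  rewrite in_itv/= andbT; have := contract_le1 (f w); rewrite ler_norml => /andP[+ _].
  exact: le_trans.
have [c2|c2] := ltP 1 c.
  rewrite (_ : _ `&` _ = set0)//; apply/seteqP; split => // w [_ /=].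
  rewrite in_itv/= andbT => cf; have := contract_le1 (f w).
  rewrite ler_norml => /andP[_ f1]; have := lt_le_trans c2 (le_trans cf f1).
  by rewrite ltxx.
rewrite (_ : _ `&` _ = setT `&` [set w | expand c <= f w]%E).
  exact: emeasurable_fun_c_infty.
apply/seteqP; split => w [_] /=; rewrite in_itv/= andbT => cf; split => //=.
  by rewrite -le_contract expandK// inE ler_norml c2 ltW.
by rewrite -[c]expandK ?inE ?ler_norml ?c2 ?(ltW c1)// le_contract.
Qed.

Definition einf (u : nat -> \bar R) : \bar R := einfs u 0%N.

Lemma einf_le u n : (einf u <= u n)%E.
Proof. by apply: ereal_inf_lbound; exists n. Qed.

Lemma le_einf u x : (forall n, (x <= u n)%E) -> (x <= einf u)%E.
Proof. by move=> H; apply: le_ereal_inf_tmp => _ [n _ <-]. Qed.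

Lemma measurable_einf (u : nat -> T -> \bar R) :
  (forall n, measurable_fun setT (u n)) ->
  measurable_fun setT (fun w => einf (u ^~ w)).
Proof. by move=> mu; exact: measurable_fun_einfs. Qed.

Lemma L1_contract f : measurable_fun setT f -> L1 P (fun w => contract (f w)).
Proof.
move=> mf; apply: (@L1_bounded _ _ _ P _ 1); first exact: measurable_contract.
by apply: aeW => w; exact: contract_le1.
Qed.

(** Among countable infima of members of S, take one that minimizes the mean of
    its image under the bounded increasing injection contract. Including one more
    member cannot lower that mean, hence does not change the infimum. *)
Lemma essinf_countable S : S !=set0 -> (forall f, S f -> measurable_fun setT f) ->
  exists g : nat -> T -> \bar R, (forall n, S (g n)) /\
    is_essinf P S (fun w => einf (g ^~ w)).
Proof.
move=> [f0 Sf0] mS.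
pose val (g : nat -> T -> \bar R) := mean P (fun w => contract (einf (g ^~ w))).
pose A := [set val g | g in [set g | forall n, S (g n)]].
have Lg g : (forall n, S (g n)) -> L1 P (fun w => contract (einf (g ^~ w))).
  by move=> Sg; apply: L1_contract; apply: measurable_einf => n; apply: mS.
have [m [_ mA mE]] : exists m : R, [/\ -1 <= m, forall x, A x -> m <= x
    & forall e, 0 < e -> exists2 x, A x & x < m + e].
  apply: approx_inf; first by exists (val (fun=> f0)), (fun=> f0).
  move=> _ [g Sg <-]; rewrite -(mean_cst P (-1)); apply: mean_le.
  - exact: L1_cst.
  - exact: Lg.
  - by apply: aeW => w; have := contract_le1 (einf (g ^~ w)); rewrite ler_norml => /andP[].
have /choice[G HG] k : exists g : nat -> T -> \bar R, (forall n, S (g n)) /\ val g <= m + k.+1%:R^-1.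
  have [|_ [g Sg <-] /ltW H] := mE k.+1%:R^-1; first by rewrite invr_gt0.
  by exists g.
pose g n := if unpickle n is Some (i, j) then G i j else f0.
have Sg n : S (g n).
  by rewrite /g; case: unpickle => // -[i j]; exact: (HG i).1.
exists g; split => //.
have gG k w : (einf (g ^~ w) <= einf (G k ^~ w))%E.
  apply: le_einf => n; apply: le_trans (einf_le _ (pickle (k, n))) _.
  by rewrite /g pickleK.
have valg : val g <= m.
  apply/ler_addgt0Pr => e e0.
  have [k ke] : exists k : nat, k.+1%:R^-1 <= e.
    exists (Num.bound e^-1); rewrite invf_ple ?posrE//.
    apply: le_trans (ltW (archi_boundP _)) _; first by rewrite invr_ge0 ltW.
    by rewrite ler_nat.
  apply: (@le_trans _ _ (m + k.+1%:R^-1)); last by rewrite lerD2l.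
  apply: le_trans (HG k).2; apply: mean_le; [exact: Lg|exact: Lg (HG k).1|].
  by apply: aeW => w; rewrite le_contract.
split => [|f Sf|h mh hS].
- by apply: measurable_einf => n; exact: mS.
- pose g' n := if n is n'.+1 then g n' else f.
  have Sg' n : S (g' n) by case: n.
  have g'g w : (einf (g' ^~ w) <= einf (g ^~ w))%E.
    by apply: le_einf => n; exact: (einf_le (g' ^~ w) n.+1).
  have H : \forall w \ae P, contract (einf (g ^~ w)) - contract (einf (g' ^~ w)) = 0.
    apply: (@mean_eq0 _ _ _ P (fun w => contract (einf (g ^~ w)) - contract (einf (g' ^~ w)))).
    + by apply: L1B; exact: Lg.
    + by apply: aeW => w; rewrite subr_ge0 le_contract.
    + rewrite meanB; [|exact: Lg..]; rewrite subr_le0.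
      by apply: (le_trans valg); apply: mA; exists g'.
  apply: filterS H => w /eqP; rewrite subr_eq0 => /eqP H.
  have : einf (g ^~ w) = einf (g' ^~ w) by rewrite -[LHS]contractK H contractK.
  by move=> ->; exact: (einf_le (g' ^~ w) 0%N).
- have : \forall w \ae P, forall n, (h w <= g n w)%E.
    by apply: ae_foralln => n; exact: hS.
  by apply: filterS => w; exact: le_einf.
Qed.

Lemma essinfP S : S !=set0 -> (forall f, S f -> measurable_fun setT f) ->
  is_essinf P S (essinf P S).
Proof.
move=> S0 mS; rewrite /essinf; case: xgetP => [//|H].
by have [g [_ /H]] := essinf_countable S0 mS.
Qed.

Lemma is_essinf_unique S f h : is_essinf P S f -> is_essinf P S h ->
  \forall w \ae P, f w = h w.
Proof.
move=> [mf fS Hf] [mh hS Hh]; have := Hf _ mh hS; have := Hh _ mf fS.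
by apply: filterS2 => w ? ?; apply/eqP; rewrite eq_le; apply/andP.
Qed.

Lemma essinf_asm (G : set (set T)) S : S !=set0 -> (forall f, S f -> as_measurable P G f) ->
  as_measurable P G (essinf P S).
Proof.
move=> S0 aS; have mS f : S f -> measurable_fun setT f by move=> /aS[].
have [g [Sg gS]] := essinf_countable S0 mS.
have eS := essinfP S0 mS.
have /choice[v Hv] n : exists v, sub_measurable G v /\ \forall w \ae P, g n w = v w.
  by have [_ [v ? ?]] := aS _ (Sg n); exists v.
split; first by case: eS.
exists (fun w => einf (v ^~ w)).
  apply: (@measurable_fun_einfs _ (g_sigma_algebraType G) R setT v) => n.
  by case: (Hv n).
have : \forall w \ae P, forall n, g n w = v n w.
  by apply: ae_foralln => n; case: (Hv n).
apply: filterS2 (is_essinf_unique eS gS) => w -> gv.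
by rewrite (_ : v ^~ w = g ^~ w)//; apply/funext.
Qed.

Section indexed.
Context (I : Type) (D : set I).
Hypothesis D0 : D !=set0.
Implicit Types F H : I -> T -> \bar R.

Let image0 F : F @` D !=set0.
Proof. by have [i Di] := D0; exists (F i), i. Qed.

Let essP F : (forall i, D i -> measurable_fun setT (F i)) ->
  is_essinf P (F @` D) (essinf P (F @` D)).
Proof. by move=> mF; apply: essinfP => // _ [i Di <-]; exact: mF. Qed.

Lemma essinf_measurable F : (forall i, D i -> measurable_fun setT (F i)) ->
  measurable_fun setT (essinf P (F @` D)).
Proof. by move=> /essP[]. Qed.

Lemma essinf_lb F i : (forall i, D i -> measurable_fun setT (F i)) -> D i ->
  \forall w \ae P, (essinf P (F @` D) w <= F i w)%E.
Proof. by move=> /essP[_ + _] Di; apply; exists i. Qed.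

(** A bound on B becomes a bound everywhere when replaced by -oo off B. *)
Lemma essinf_glb_on (B : set T) h F : measurable B ->
  (forall i, D i -> measurable_fun setT (F i)) -> measurable_fun setT h ->
  (forall i, D i -> \forall w \ae P, B w -> (h w <= F i w)%E) ->
  \forall w \ae P, B w -> (h w <= essinf P (F @` D) w)%E.
Proof.
move=> mB /essP[_ _ H] mh hF.
pose h' w := if w \in B then h w else -oo%E.
have : \forall w \ae P, (h' w <= essinf P (F @` D) w)%E.
  apply: H.
    apply: measurable_fun_ifT => //.
    by apply: (measurable_fun_bool true); rewrite setTI (_ : _ @^-1` _ = B)//;
      apply/seteqP; split => w /=; [move/set_mem|move/mem_set].
  move=> _ [i Di <-]; apply: filterS (hF _ Di) => w; rewrite /h'.
  by case: ifPn => [/set_mem Bw /(_ Bw)//|_ _]; exact: leNye.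
by apply: filterS => w + Bw; rewrite /h' mem_set.
Qed.

Lemma essinf_glb h F :
  (forall i, D i -> measurable_fun setT (F i)) -> measurable_fun setT h ->
  (forall i, D i -> \forall w \ae P, (h w <= F i w)%E) ->
  \forall w \ae P, (h w <= essinf P (F @` D) w)%E.
Proof.
move=> mF mh hF; have : \forall w \ae P, [set: T] w -> (h w <= essinf P (F @` D) w)%E.
  by apply: essinf_glb_on => // i Di; apply: filterS (hF _ Di).
by apply: filterS => w; exact.
Qed.

Lemma essinf_le_on (B : set T) F H : measurable B ->
  (forall i, D i -> measurable_fun setT (F i)) ->
  (forall i, D i -> measurable_fun setT (H i)) ->
  (forall i, D i -> \forall w \ae P, B w -> (F i w <= H i w)%E) ->
  \forall w \ae P, B w -> (essinf P (F @` D) w <= essinf P (H @` D) w)%E.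
Proof.
move=> mB mF mH FH; apply: essinf_glb_on => //; first exact: essinf_measurable.
move=> i Di; apply: filterS2 (FH _ Di) (essinf_lb mF Di) => w FHw lb Bw.
exact: le_trans lb (FHw Bw).
Qed.

Lemma essinf_eq_on (B : set T) F H : measurable B ->
  (forall i, D i -> measurable_fun setT (F i)) ->
  (forall i, D i -> measurable_fun setT (H i)) ->
  (forall i, D i -> \forall w \ae P, B w -> F i w = H i w) ->
  \forall w \ae P, B w -> essinf P (F @` D) w = essinf P (H @` D) w.
Proof.
move=> mB mF mH FH.
have h1 : \forall w \ae P, B w -> (essinf P (F @` D) w <= essinf P (H @` D) w)%E.
  by apply: essinf_le_on => // i /FH; apply: filterS => w e /e ->.
have h2 : \forall w \ae P, B w -> (essinf P (H @` D) w <= essinf P (F @` D) w)%E.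
  by apply: essinf_le_on => // i /FH; apply: filterS => w e /e ->.
apply: filterS2 h1 h2 => w h1 h2 Bw; apply/eqP; rewrite eq_le.
by apply/andP; split; [exact: h1|exact: h2].
Qed.

Lemma esssupP F : (forall i, D i -> measurable_fun setT (F i)) ->
  is_esssup P (F @` D) (esssup P (F @` D)).
Proof.
move=> mF; rewrite /esssup; case: xgetP => [//|noS]; exfalso.
have mN i : D i -> measurable_fun setT (fun w => (- F i w)%E).
  by move=> Di; apply: measurableT_comp => //; exact: mF.
have [me elb eglb] := essP mN.
apply: (noS (fun w => - essinf P ((fun i w => - F i w) @` D) w)%E); split.
- exact: measurableT_comp.
- move=> _ [i Di <-]; have := elb _ (imageP (fun i w => - F i w)%E Di).
  by apply: filterS => w; rewrite leeNr.
- move=> h mh hF; have : \forall w \ae P, (- h w <= essinf P ((fun i w => - F i w) @` D) w)%E.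
    apply: eglb; first exact: measurableT_comp.
    move=> _ [i Di <-]; have := hF _ (imageP F Di).
    by apply: filterS => w; rewrite leeN2.
  by apply: filterS => w; rewrite leeNl.
Qed.

End indexed.

End essential_infimum.

(** * Sequences of summable increments *)

Section L1_limits.
Context d (T : measurableType d) (R : realType) (P : probability T R).

Lemma L1_cauchy_cvg (u : nat -> T -> R) : (forall n, L1 P (u n)) ->
  (exists B : R, forall n, \sum_(0 <= k < n) mean P (fun w => `|u k.+1 w - u k w|) <= B) ->
  exists h : T -> R, [/\ L1 P h, \forall w \ae P, u ^~ w @ \oo --> h w
    & (fun n => mean P (u n)) @ \oo --> mean P h].
Proof.
move=> Lu HB; pose g k w := u k.+1 w - u k w.
have sg : psummable P g by apply: psummableP => // k; exact: L1B.
have uE n w : u n w = u 0%N w + series (g ^~ w) n.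
  exact: (eq_sum_telescope (u ^~ w) n).
pose h w := u 0%N w + psum g w.
have uh : \forall w \ae P, u ^~ w @ \oo --> h w.
  apply: filterS (psummable_cvg sg) => w /abs_summable_cvg sgw.
  rewrite (_ : u ^~ w = fun n => u 0%N w + series (g ^~ w) n); last first.
    by apply/funext => n; exact: uE.
  by apply: cvgD => //; exact: cvg_cst.
have Lh : L1 P h by apply: L1D => //; exact: L1_psum.
have [|||||_ _ H] := @mean_dct _ _ _ P u h
    (fun w => `|u 0%N w| + ssum (fun k => `|g k w|)).
- by move=> n; exact: L1_measurable (Lu n).
- exact: L1_measurable Lh.
- by apply: L1D; [exact: L1_norm|exact: psummable_normL1].
- move=> n; apply: filterS (psummable_cvg sg) => w sgw; rewrite uE.
  apply: le_trans (ler_normD _ _) _; rewrite lerD2l.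
  by apply: le_trans (ler_norm_sum _ _ _) _; exact: partial_sum_le.
- exact: uh.
by exists h.
Qed.

End L1_limits.

(** * The weak topology *)

Section weak_topology.
Context d (T : measurableType d) (R : realType) (P : probability T R).
Variable F : nat -> set (set T).
Let W := weak_Rinfty P F.

Lemma pairing_continuous (a : A1 P F) :
  continuous ((fun X : Rinfty P F => pairing P (val X) (val a)) : W -> R).
Proof.
apply/continuousP => B oB; rewrite openE => x Bx /=.
have := @cvg_sup _ _ (fun a : A1 P F =>
    Topological.class
      (initial_topology (fun X : Rinfty P F => pairing P (val X) (val a)))) (nbhs (x : W)) x _.
move=> [+ _] => /(_ (fun A h => h) a); apply; rewrite nbhsE.
by eexists; [split; [exists B|exact: Bx]|].
Qed.

Lemma weak_cvg (Xs : nat -> Rinfty P F) (X : Rinfty P F) :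
  (forall a : A1 P F, (fun n => pairing P (val (Xs n)) (val a)) @ \oo --> pairing P (val X) (val a)) ->
  (Xs : nat -> W) @ \oo --> (X : W).
Proof.
move=> H; apply/cvg_sup => a A.
rewrite nbhsE => -[_ [[B oB <-] BX] BA].
have := H a B; rewrite nbhsE.
move=> /(_ _)[|N _ HN]; first by exists B.
by exists N => // n /HN; exact: BA.
Qed.

(** One test process at a time suffices: the sub-basic neighbourhoods. *)
Lemma weak_closure_approx (C : set (nat -> T -> R)) (X : Rinfty P F) a (e : R) :
  closure ([set Y : Rinfty P F | C (val Y)] : set W) X -> A1 P F a -> 0 < e ->
  exists Y : Rinfty P F, C (val Y) /\ `|pairing P (val X) a - pairing P (val Y) a| < e.
Proof.
move=> cX Aa e0; pose a' : A1 P F := SigSub (mem_set Aa).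
have := @pairing_continuous a' X => /cvgrPdist_lt /(_ e e0) H.
by have [Y [CY HY]] := cX _ H; exists Y.
Qed.

End weak_topology.

(** * Extended real inequalities *)

Section ereal_as_measurable.
Context d (T : measurableType d) (R : realType) (P : probability T R).
Variables (G : set (set T)).

Lemma easmB (f g : T -> \bar R) : as_measurable P G f -> as_measurable P G g ->
  as_measurable P G (fun w => f w - g w)%E.
Proof.
move=> [mf [f' mf' ff']] [mg [g' mg' gg']]; split; first exact: emeasurable_funB.
exists (fun w => f' w - g' w)%E; first exact: (emeasurable_funB mf' mg').
by apply: filterS2 ff' gg' => w -> ->.
Qed.

End ereal_as_measurable.

Section ereal_shift.
Context {R : realType}.
Implicit Types (e g : \bar R) (x y l m n : R).

Lemma ereal_shift_le e g x m : (e <= x%:E - g)%E -> x <= m -> (e - m%:E <= - g)%E.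
Proof.
case: g => [r| |] h xm; last by rewrite /= leey.
  rewrite leeBlDr//; apply: le_trans h _.
  by rewrite -EFinN -!EFinD lee_fin; lra.
by move: h; rewrite /= addeNy leeNy_eq => /eqP ->.
Qed.

Lemma ereal_le_shift g x m : (g <= 0)%E -> m <= x -> (m%:E <= x%:E - g)%E.
Proof.
case: g => [r| |]; [|by rewrite leye_eq|by rewrite /= addey// leey].
by rewrite -EFinB !lee_fin => ? ?; lra.
Qed.

Lemma ereal_shiftD e g x y : (e <= x%:E - g)%E -> (e + y%:E <= (x + y)%:E - g)%E.
Proof.
case: g => [r| |] h; last by rewrite /= addey// leey.
  rewrite EFinD addeAC; apply: leeD => //.
by move: h; rewrite /= !addeNy !leeNy_eq => /eqP ->.
Qed.

Lemma ereal_convex_combination g x y l m n : 0 <= l -> l <= 1 ->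
  (m%:E <= x%:E - g)%E -> (n%:E <= y%:E - g)%E ->
  ((l * m + (1 - l) * n)%:E <= (l * x + (1 - l) * y)%:E - g)%E.
Proof.
move=> l0 l1; case: g => [r| |].
- rewrite -!EFinB !lee_fin => x1 x2.
  have y1 : l * m <= l * (x - r) by rewrite ler_wpM2l.
  have y2 : (1 - l) * n <= (1 - l) * (y - r) by rewrite ler_wpM2l// subr_ge0.
  by apply: le_trans (lerD y1 y2) _; rewrite !mulrBr !mulrBl !mul1r; lra.
- by rewrite /= addeNy leeNy_eq.
- by move=> _ _; rewrite /= addey// leey.
Qed.

Lemma ereal_between e m : ((- m)%:E <= e <= m%:E)%E -> exists2 r, e = r%:E & `|r| <= m.
Proof.
case: e => [r| |] /andP[].
- by rewrite !lee_fin => h1 h2; exists r => //; rewrite ler_norml h1 h2.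
- by rewrite leye_eq.
- by rewrite leeNy_eq.
Qed.

End ereal_shift.

(** * Processes stopped between tau and theta *)

Section stopped_processes.
Context d (T : measurableType d) (R : realType) (P : probability T R).
Variable F : nat -> set (set T).
Hypothesis hF : filtration F.
Variables tau theta : T -> option nat.
Hypothesis htau : stopping_time F tau.
Hypothesis htheta : stopping_time F theta.
Hypothesis htau_fin : \forall w \ae P, tau w <> None.
Hypothesis htau_theta : \forall w \ae P, time_le (tau w) (theta w).

Local Notation process := (nat -> T -> R).
Local Notation Ft := (Ftau F tau).
Local Notation Rtt := (Rinfty_tt P F tau theta).
Local Notation proj := (stopped_proj tau theta).
Local Notation cp := (cond_pairing P F tau theta).
Local Notation D := (Dset P F tau theta).
Local Notation C := (acceptance P F tau theta).
Local Notation started w t := (time_le (tau w) (Some t)).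
Implicit Types X Y a b : process.
Implicit Types gamma phi : process -> T -> \bar R.

Definition active_at t w : bool := time_le (tau w) (Some t) && time_le (Some t) (theta w).

Lemma filtration_sigma t : sigma_algebra setT (F t).
Proof. by case: hF. Qed.

Lemma filtration_sub t : F t `<=` measurable.
Proof. by case: hF. Qed.

Lemma filtration_le s t : (s <= t)%N -> F s `<=` F t.
Proof. by case: hF => _ _; exact. Qed.

Lemma sigma_setC (G : set (set T)) A : sigma_algebra setT G -> G A -> G (~` A).
Proof. by move=> [_ GC _] GA; rewrite -setTD; exact: GC. Qed.

Lemma sigma_setI (G : set (set T)) A B : sigma_algebra setT G -> G A -> G B -> G (A `&` B).
Proof.
move=> sG GA GB; rewrite -(setCK (A `&` B)) setCI -bigcup2E.
apply: sigma_setC => //; case: (sG) => G0 GC GU; apply: GU => n.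
by rewrite /bigcup2; case: n => [|[|n]]//=; exact: sigma_setC.
Qed.

Lemma sigma_setU (G : set (set T)) A B : sigma_algebra setT G -> G A -> G B -> G (A `|` B).
Proof.
move=> sG GA GB; rewrite -(setCK (A `|` B)) setCU; apply: sigma_setC => //.
by apply: sigma_setI => //; exact: sigma_setC.
Qed.

Lemma sigma_setT (G : set (set T)) : sigma_algebra setT G -> G setT.
Proof. by move=> sG; rewrite -setC0; apply: sigma_setC => //; case: sG. Qed.

Lemma started_set t : F t [set w | started w t].
Proof. exact: htau. Qed.

Lemma before_end_set t : F t [set w | time_le (Some t) (theta w)].
Proof.
have sF := filtration_sigma t; case: t sF => [|t] sF.
  rewrite (_ : [set w | _] = setT); first exact: sigma_setT.
  by apply/seteqP; split => // w _ /=; case: (theta w).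
rewrite (_ : [set w | _] = ~` [set w | time_le (theta w) (Some t)]).
  by apply: sigma_setC => //; apply: (filtration_le (leqnSn t)); exact: htheta.
apply/seteqP; split => w /=; case: (theta w) => [n|]//=.
  by rewrite ltnNge => /negP.
by move/negP; rewrite -ltnNge.
Qed.

Lemma active_set t : F t [set w | active_at t w].
Proof.
rewrite (_ : [set w | _] = [set w | started w t] `&` [set w | time_le (Some t) (theta w)]).
  apply: sigma_setI; [exact: filtration_sigma|exact: started_set|exact: before_end_set].
by apply/seteqP; split => w /= => [/andP[]//|[? ?]]; apply/andP.
Qed.

Lemma Ftau_sub : Ft `<=` measurable.
Proof. by move=> A []. Qed.

Lemma Ftau_sigma : sigma_algebra setT Ft.
Proof.
split => [|A [mA FA]|A FA].
- split; first exact: measurable0.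
  by move=> t; rewrite set0I; case: (filtration_sigma t).
- split; first by rewrite setTD; exact: measurableC.
  move=> t; rewrite setTD.
  rewrite (_ : _ `&` _ = [set w | started w t] `&` ~` (A `&` [set w | started w t])).
    apply: sigma_setI; [exact: filtration_sigma|exact: started_set|].
    by apply: sigma_setC; [exact: filtration_sigma|exact: FA].
  apply/seteqP; split => w /= [h1 h2]; split => //; first by case.
  by move=> ?; apply: h2; split.
- split; first by apply: bigcupT_measurable => n; case: (FA n).
  move=> t; rewrite setI_bigcupl; have [_ _ FU] := filtration_sigma t.
  by apply: FU => n; case: (FA n).
Qed.

(** On {tau <= t} the sigma-algebra of tau is contained in F t. *)
Lemma asm_started (m : T -> R) t : as_measurable P Ft m ->
  as_measurable P (F t) (fun w => m w * (started w t)%:R).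
Proof.
move=> [mm [g mg fg]]; have mS : d.-measurable [set w | started w t].
  by apply: (filtration_sub (t := t)); exact: started_set.
have stE w : (started w t)%:R = \1_[set w | started w t] w :> R.
  rewrite indicE; case: (boolP (started w t)) => h; first by rewrite mem_set.
  by rewrite memNset//; exact/negP.
split.
  by under eq_fun do rewrite stE; exact: measurable_funM.
exists (fun w => g w * (started w t)%:R); last by apply: filterS fg => w ->.
move=> _ B mB; rewrite setTI; apply: sub_sigma_algebra.
have : Ft (g @^-1` B).
  have := mg measurableT B mB; rewrite setTI /measurable/= sigma_algebra_id//.
  exact: Ftau_sigma.
move=> [mgB FgB].
have sF := filtration_sigma t.
have [B0|B0] := pselect (B 0).
  rewrite (_ : _ @^-1` B = (g @^-1` B `&` [set w | started w t]) `|` ~` [set w | started w t]).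
    by apply: sigma_setU => //; apply: sigma_setC => //; exact: started_set.
  apply/seteqP; split => w /=.
    case: (started w t); rewrite ?mulr1 ?mulr0; first by left.
    by right.
  by case: (started w t); rewrite ?mulr1 ?mulr0 => -[[]|].
rewrite (_ : _ @^-1` B = (g @^-1` B `&` [set w | started w t])); first exact: FgB.
apply/seteqP; split => w /=.
  by case: (started w t); rewrite ?mulr1 ?mulr0.
by case: (started w t); rewrite ?mulr1 ?mulr0 => -[].
Qed.

Lemma indic_bool (b : T -> bool) w : \1_[set w | b w] w = (b w)%:R :> R.
Proof.
rewrite indicE; case: (boolP (b w)) => h; first by rewrite mem_set.
by rewrite memNset//; exact/negP.
Qed.

Lemma asm_if (G : set (set T)) (b : T -> bool) (f g : T -> R) :
  G `<=` measurable -> sigma_algebra setT G -> G [set w | b w] ->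
  as_measurable P G f -> as_measurable P G g ->
  as_measurable P G (fun w => if b w then f w else g w).
Proof.
move=> GM sG Gb af ag.
rewrite (_ : (fun w => _) = fun w => \1_[set w | b w] w * f w + \1_(~` [set w | b w]) w * g w).
  apply: asmD; apply: asmM => //; apply: asm_indic => //.
  exact: sigma_setC.
apply/funext => w; rewrite !indicE in_setC.
have -> : (w \in [set w | b w]) = b w by apply/idP/idP => [/set_mem|/mem_set].
by case: (b w); rewrite /= mul1r mul0r ?addr0 ?add0r.
Qed.

Lemma asm_min_theta Y t : (forall s, as_measurable P (F s) (Y s)) ->
  as_measurable P (F t) (fun w => Y (time_min t (theta w)) w).
Proof.
move=> aY; elim: t => [|t IH].
  rewrite (_ : (fun w => _) = Y 0%N)//; apply/funext => w.
  by rewrite /time_min; case: (theta w) => // n; rewrite min0n.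
rewrite (_ : (fun w => _) = fun w => if time_le (Some t.+1) (theta w) then Y t.+1 w
    else Y (time_min t (theta w)) w).
  apply: asm_if; [exact: filtration_sub|exact: filtration_sigma|
    exact: before_end_set|exact: aY|].
  by apply: asm_mono IH; exact: filtration_le.
apply/funext => w; rewrite /time_min /=; case: (theta w) => // n.
case: (leqP t.+1 n) => // nt.
by rewrite (minn_idPr _).
Qed.

Lemma asm_stopped_proj Y t : (forall s, as_measurable P (F s) (Y s)) ->
  as_measurable P (F t) (proj Y t).
Proof.
move=> aY; apply: asm_if.
- exact: filtration_sub.
- exact: filtration_sigma.
- exact: started_set.
- exact: asm_min_theta.
- by apply: asm_cst; exact: filtration_sub.
Qed.

Definition is_stopped X : Prop := \forall w \ae P, forall t, X t w = proj X t w.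

Lemma stopped_proj_idem Y : \forall w \ae P, forall t, proj (proj Y) t w = proj Y t w.
Proof.
apply: filterS htau_theta => w tt t; rewrite /stopped_proj /time_min.
case: (theta w) tt => [n|] tt; last by case: ifP => // ->.
case: ifP => // tau_t; rewrite -minnA minnn.
suff -> : started w (minn t n) by [].
by move: tt tau_t; case: (tau w) => //= m mn mt; rewrite leq_min mt.
Qed.

(** Stopping is idempotent, so X can be tested itself in place of a preimage. *)
Lemma RttP X : Rtt X <-> Rinfty P F X /\ is_stopped X.
Proof.
split=> [[mX [Y [RY [m Ym]] XY]]|[[RX bX] sX]].
- have aP t := asm_stopped_proj t RY.
  split; last first.
    apply: filterS2 (stopped_proj_idem Y) XY => w idem XY t.
    by rewrite XY -idem /stopped_proj XY.
  split.
    move=> t; apply: (asm_ae (aP t)) => //.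
    by apply: filterS XY => w /(_ t) ->.
  exists `|m|; apply: filterS2 XY Ym => w XY Ym t; rewrite XY /stopped_proj.
  by case: ifP => _; rewrite ?normr0// (le_trans (Ym _))// ler_norm.
- split; first by move=> t; case: (RX t).
  by exists X => //; split.
Qed.

Lemma Rtt_asm X t : Rtt X -> as_measurable P (F t) (X t).
Proof. by move=> /RttP[[+ _] _]; exact. Qed.

Lemma Rtt_bounded X : Rtt X ->
  exists2 m : R, 0 <= m & \forall w \ae P, forall t, `|X t w| <= m.
Proof.
move=> /RttP[[_ [m Xm]] _]; exists `|m| => //; apply: filterS Xm => w Xm t.
by rewrite (le_trans (Xm t))// ler_norm.
Qed.

Lemma Rtt_stopped X : Rtt X -> is_stopped X.
Proof. by move=> /RttP[]. Qed.

Lemma Rtt_measurable X t : Rtt X -> measurable_fun setT (X t).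
Proof. by move=> [mX _]; exact: mX. Qed.

Lemma Rtt_ae X Y : Rtt X -> (forall t, measurable_fun setT (Y t)) ->
  (\forall w \ae P, forall t, X t w = Y t w) -> Rtt Y.
Proof.
move=> [mX [Z RZ XZ]] mY XY; split => //; exists Z => //.
by apply: filterS2 XZ XY => w XZ XY t; rewrite -XY.
Qed.

Lemma Rtt0 : Rtt (fun _ _ => 0).
Proof.
apply/RttP; split.
  split; first by move=> t; apply: asm_cst; exact: filtration_sub.
  by exists 0; apply: aeW => w t; rewrite normr0.
by apply: aeW => w t; rewrite /stopped_proj; case: ifP.
Qed.

Lemma Rtt_off X : Rtt X -> \forall w \ae P, forall t, ~~ started w t -> X t w = 0.
Proof.
move=> /Rtt_stopped; apply: filterS => w sX t nst; rewrite sX /stopped_proj.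
by rewrite (negbTE nst).
Qed.

(** The product is adapted although u is only known at tau, since X vanishes
    before tau. *)
Lemma Rtt_scale (u : T -> R) X : Linfty P Ft u -> Rtt X ->
  Rtt (fun t w => u w * X t w).
Proof.
move=> [au [c uc]] RX; have [m m0 Xm] := Rtt_bounded RX; apply/RttP; split.
  split.
    move=> t; apply: (@asm_ae _ _ _ P (F t) _ _ (fun w => (u w * (started w t)%:R) * X t w)).
    - by apply: asmM; [exact: asm_started|exact: Rtt_asm].
    - by apply: measurable_funM; [case: au|exact: Rtt_measurable].
    - apply: filterS (Rtt_off RX) => w /(_ t); case: (started w t); first by rewrite mulr1.
      by move=> ->//; rewrite !mulr0.
  exists (`|c| * m); apply: filterS2 uc Xm => w uc Xm t.
  by rewrite normrM ler_pM// (le_trans uc)// ler_norm.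
apply: filterS (Rtt_stopped RX) => w sX t; rewrite sX /stopped_proj.
by case: ifP => //; rewrite mulr0.
Qed.

Lemma Rtt_add X Y : Rtt X -> Rtt Y -> Rtt (fun t w => X t w + Y t w).
Proof.
move=> RX RY; have [m m0 Xm] := Rtt_bounded RX; have [n n0 Yn] := Rtt_bounded RY.
apply/RttP; split.
  split; first by move=> t; apply: asmD; exact: Rtt_asm.
  exists (m + n); apply: filterS2 Xm Yn => w Xm Yn t.
  by rewrite (le_trans (ler_normD _ _))// lerD.
apply: filterS2 (Rtt_stopped RX) (Rtt_stopped RY) => w sX sY t.
rewrite sX sY /stopped_proj; by case: ifP => //; rewrite addr0.
Qed.

Lemma Rtt_comb (u v : T -> R) X Y : Linfty P Ft u -> Linfty P Ft v -> Rtt X -> Rtt Y ->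
  Rtt (fun t w => u w * X t w + v w * Y t w).
Proof. by move=> lu lv RX RY; apply: Rtt_add; exact: Rtt_scale. Qed.

Lemma Linfty_cstt (c : R) : Linfty P Ft (fun=> c).
Proof. by apply: Linfty_cst; exact: Ftau_sub. Qed.

Lemma Rtt_one : Rtt (fun t w => (started w t)%:R).
Proof.
apply/RttP; split.
  split.
    move=> t; have := @asm_started (fun=> 1) t (Linfty_cstt 1).1.
    by under eq_fun do rewrite mul1r.
  by exists 1; apply: aeW => w t; case: (started w t); rewrite ?normr1 ?normr0.
apply: filterS htau_theta => w tt t; rewrite /stopped_proj.
case: ifP => //= tau_t; congr (_ %:R); rewrite /time_min.
move: tt tau_t; case: (tau w) => //= m; case: (theta w) => //= [n|] mn mt.
  by rewrite leq_min mt mn.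
by rewrite mt.
Qed.

Lemma Rtt_add_from_tau X m : Rtt X -> Linfty P Ft m -> Rtt (add_from_tau tau X m).
Proof.
move=> RX lm; have := Rtt_add RX (Rtt_scale lm Rtt_one).
exact.
Qed.

Lemma Rtt_indic X A : Ft A -> Rtt X -> Rtt (fun t w => \1_A w * X t w).
Proof.
by move=> FA; apply: Rtt_scale; apply: Linfty_indic => //; exact: Ftau_sub.
Qed.

Lemma Rtt_excess r X : 0 <= r -> Rtt X -> Rtt (fun t w => excess r (X t w)).
Proof.
move=> r0 RX; have [m m0 Xm] := Rtt_bounded RX; apply/RttP; split.
  split; first by move=> t; apply: asm_excess; exact: Rtt_asm.
  exists m; apply: filterS Xm => w Xm t.
  by apply: le_trans (excess_le _ r0) _.
apply: filterS (Rtt_stopped RX) => w sX t; rewrite sX /stopped_proj.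
by case: ifP => // _; rewrite excess_eq0// normr0.
Qed.

(** * Dual processes and conditional pairings *)

Local Notation active := active_at.

Definition cumul (z : process) : process := fun t w => \sum_(0 <= s < t.+1) z s w.

Lemma incr_cumul z t w : incr (cumul z) t w = z t w.
Proof.
case: t => [|t]; rewrite /incr /cumul; first by rewrite big_nat1.
by rewrite big_nat_recr//= addrAC subrr add0r.
Qed.

Lemma incr_cumulE z : incr (cumul z) = z.
Proof. by apply/funext => t; apply/funext => w; exact: incr_cumul. Qed.

Lemma sum_incr a n w : \sum_(0 <= t < n) incr a t w = if n is k.+1 then a k w else 0.
Proof.
elim: n => [|n IH]; first by rewrite big_geq.
rewrite big_nat_recr//= IH /incr; case: n {IH} => [|n]; first by rewrite add0r.
by rewrite addrC subrK.
Qed.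

(** What characterizes the increments of elements of (A1_(tau,theta))_+. They are
    handier than the elements, which do not vanish after theta: with them every
    pairing is a sum over all times. *)
Definition dual_increments (z : process) : Prop :=
  [/\ forall t, as_measurable P (F t) (z t), psummable P z,
      \forall w \ae P, forall t, 0 <= z t w
    & \forall w \ae P, forall t, ~~ active t w -> z t w = 0].

(** Needed because stopping does not decrease increments one by one: the
    increment at tau collects all those up to tau. *)
Lemma psummable_partial (f g : process) : (forall t, measurable_fun setT (g t)) ->
  (\forall w \ae P, forall n,
    \sum_(0 <= t < n) `|g t w| <= \sum_(0 <= t < n) `|f t w|) ->
  psummable P f -> psummable P g.
Proof.
move=> mg gf [mf fy]; split => //; apply: le_lt_trans fy.
apply: ae_ge0_le_integral => //.
- by move=> w _; apply: nneseries_ge0.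
- exact: measurable_norm_series.
- by move=> w _; apply: nneseries_ge0.
- exact: measurable_norm_series.
- apply: filterS gf => w gf _; apply: lee_lim.
  + by apply: is_cvg_nneseries.
  + by apply: is_cvg_nneseries.
  + by apply: nearW => n; rewrite !sumEFin lee_fin.
Qed.

Lemma asm_incr a t : (forall s, as_measurable P (F s) (a s)) ->
  as_measurable P (F t) (incr a t).
Proof.
move=> aa; case: t => [|t]; first exact: aa.
have FM := filtration_sub (t := t.+1).
apply: asmB => //; apply: asm_mono (aa t); exact: (filtration_le).
Qed.

Lemma A1_incr a : A1 P F a ->
  (forall t, as_measurable P (F t) (incr a t)) /\ psummable P (incr a).
Proof.
move=> [aa ay]; have ai t := asm_incr t aa; split => //; split => // t.
by case: (ai t).
Qed.

Lemma asm_cumul z t : (forall t, as_measurable P (F t) (z t)) ->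
  as_measurable P (F t) (cumul z t).
Proof.
move=> az; have FM := filtration_sub (t := t).
rewrite (_ : cumul z t = fun w => \sum_(0 <= s < t.+1) z (minn s t) w).
  apply: asm_sum => // s; apply: asm_mono (az _).
  by apply: (filtration_le); exact: geq_minr.
apply/funext => w; apply: eq_big_nat => s /andP[_ st].
by rewrite (minn_idPl _).
Qed.

Lemma A1_cumul z : (forall t, as_measurable P (F t) (z t)) -> psummable P z ->
  A1 P F (cumul z).
Proof.
move=> az sz; split; first by move=> t; exact: asm_cumul.
by rewrite /A1norm incr_cumulE; case: sz.
Qed.

Lemma A1pos_tt_increments a : A1pos_tt P F tau theta a -> dual_increments (incr a).
Proof.
move=> [ma [b [[ab b1] b0] ab_eq]].
have [aib sb] := A1_incr (conj ab b1).
have aa t : as_measurable P (F t) (a t).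
  apply: (asm_ae (asm_stopped_proj t ab)) => //.
  by apply: filterS ab_eq => w /(_ t) ->.
have aia t := asm_incr t aa.
have bmono w : (forall t, 0 <= incr b t w) -> forall s t, (s <= t)%N -> 0 <= b s w <= b t w.
  move=> b0w; have step s : b s w <= b s.+1 w by have := b0w s.+1; rewrite /incr subr_ge0.
  have bs s : 0 <= b s w.
    elim: s => [|s IH]; first exact: (b0w 0%N).
    exact: le_trans (step s).
  move=> s t st; rewrite bs/=; elim: t st => [|t IH].
    by rewrite leqn0 => /eqP ->.
  rewrite leq_eqVlt => /orP[/eqP ->//|]; rewrite ltnS => /IH /le_trans; apply.
  exact: step.
have key : \forall w \ae P, (forall t, 0 <= incr a t w) /\
    (forall t, ~~ active t w -> incr a t w = 0) /\
    forall t, a t w <= b t w.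
  apply: filterS3 ab_eq b0 htau_theta => w abw /bmono bm tt.
  have b0w s : 0 <= b s w by have /andP[] := bm s s (leqnn s).
  have bmw s t : (s <= t)%N -> b s w <= b t w by move=> st; have /andP[] := bm s t st.
  split; [|split].
  - case=> [|t]; rewrite /incr !abw /stopped_proj; first by case: ifP.
    case: ifP => t1; case: ifP => t2.
    + rewrite subr_ge0; apply: bmw; rewrite /time_min; case: (theta w) => [n|]//.
      by rewrite leq_min geq_minr (leq_trans (geq_minl _ _)).
    + by rewrite subr0.
    + by move: t1 t2; case: (tau w) => //= m h1 h2; rewrite (leq_trans h2) in h1.
    + by rewrite subrr.
  - case=> [|t]; rewrite /incr !abw /stopped_proj /active_at.
      by case: (started w 0) => //=; case: (theta w).
    case: ifP => t1 /=; case: ifP => t2.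
    + case: (theta w) => [n|]//=; rewrite -leqNgt => nt.
      by rewrite (minn_idPr nt) (minn_idPr (leqW nt)) subrr.
    + move: t1 t2 tt; case: (tau w) => //= m h1 h2; case: (theta w) => [n|]//= mn.
      by rewrite -leqNgt => nt; rewrite (leq_trans mn nt) in h2.
    + by move: t1 t2; case: (tau w) => //= m h1 h2; rewrite (leq_trans h2) in h1.
    + by rewrite subrr.
  - move=> t; rewrite abw /stopped_proj; case: ifP => // _; apply: bmw.
    by rewrite /time_min; case: (theta w) => [n|]//; exact: geq_minl.
split; first exact: aia.
- apply: (@psummable_partial (incr b)) => //; first by move=> t; case: (aia t).
  apply: filterS2 key b0 => w [a0 [_ abw]] b0w n.
  rewrite (eq_bigr (incr a ^~ w)); last by move=> t _; rewrite ger0_norm.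
  rewrite [leRHS](eq_bigr (incr b ^~ w)); last by move=> t _; rewrite ger0_norm.
  by rewrite !sum_incr; case: n.
- by apply: filterS key => w [].
- by apply: filterS key => w [_ []].
Qed.

Lemma A1pos_tt_cumul z : dual_increments z -> A1pos_tt P F tau theta (cumul z).
Proof.
move=> [az sz z0 zoff]; split.
  by move=> t; case: (asm_cumul t az).
exists (cumul z).
  split; first exact: A1_cumul.
  by rewrite incr_cumulE.
apply: filterS2 zoff htau_theta => w zoff tt t; rewrite /stopped_proj.
case: ifP => t1.
  rewrite /time_min; case thw: (theta w) => [n|]//.
  have [tn|nt] := leqP t n; first by [].
  rewrite /cumul (@big_cat_nat _ _ _ n.+1)//=; last exact: ltnW.
  rewrite [X in _ + X]big1_seq ?addr0//.
  move=> s; rewrite mem_index_iota => /andP[_ /andP[ns _]]; apply: zoff.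
  by rewrite /active_at thw /= leqNgt ns andbF.
rewrite /cumul big1_seq// => s; rewrite mem_index_iota => /andP[_ /andP[_ st]].
apply: zoff; rewrite /active_at; case: (tau w) t1 => //= m.
by move/negbT; rewrite -ltnNge => tm; rewrite leqNgt (leq_ltn_trans _ tm).
Qed.

(** A common home for R_(tau,theta) and the constant process 1 of <1, a>. *)
Definition bmeas X : Prop := (forall t, measurable_fun setT (X t)) /\
  exists m : R, \forall w \ae P, forall t, `|X t w| <= m.

Lemma Rinfty_bmeas X : Rinfty P F X -> bmeas X.
Proof. by move=> [RX bX]; split => // t; case: (RX t). Qed.

Lemma Rtt_bmeas X : Rtt X -> bmeas X.
Proof. by move=> /(RttP)[/Rinfty_bmeas]. Qed.

Lemma bmeas_cst (c : R) : bmeas (fun _ _ => c).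
Proof.
by split; [move=> t; exact: measurable_cst|exists `|c|; exact: aeW].
Qed.

Definition pairing_terms X a : process :=
  fun t w => if active t w then X t w * incr a t w else 0.

Lemma cond_pairingE X a : cp X a = condexp P Ft (psum (pairing_terms X a)).
Proof. by []. Qed.

Lemma measurable_active t : measurable_fun setT (active t : T -> bool).
Proof.
apply: (measurable_fun_bool true); rewrite setTI.
rewrite (_ : _ @^-1` _ = [set w | active t w]); last by apply/seteqP; split.
by apply: (filtration_sub (t := t)); exact: (active_set).
Qed.

Lemma psummable_terms X a : bmeas X -> psummable P (incr a) ->
  psummable P (pairing_terms X a).
Proof.
move=> [mX [m Xm]] sa; have [ma _] := sa.
apply: (@psummable_le _ _ _ P (fun t w => m * incr a t w)); last exact: psummableZ.
  move=> t; apply: measurable_fun_ifT; [exact: measurable_active| |exact: measurable_cst].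
  exact: measurable_funM.
move=> t; apply: filterS Xm => w /(_ t) Xm; rewrite /pairing_terms.
case: ifP => _; last by rewrite normr0.
by rewrite !normrM ler_wpM2r// (le_trans Xm)// ler_norm.
Qed.

Lemma L1_terms X a : bmeas X -> psummable P (incr a) -> L1 P (psum (pairing_terms X a)).
Proof. by move=> bX sa; apply: L1_psum; exact: psummable_terms. Qed.

Lemma cp_L1 X a : L1 P (cp X a).
Proof. exact: condexp_L1. Qed.

Lemma cp_asm X a : as_measurable P Ft (cp X a).
Proof. by apply: condexp_asm; exact: Ftau_sub. Qed.

Lemma cp_measurable X a : measurable_fun setT (fun w => (cp X a w)%:E).
Proof. by apply/measurable_EFinP; case: (cp_asm X a). Qed.

Lemma cp_easm X a : as_measurable P Ft (fun w => (cp X a w)%:E).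
Proof. by apply: asm_comp (cp_asm X a). Qed.

(** Linearity, localization and pasting, in either argument, are instances: the
    hypothesis only compares products X * incr a on the active window. *)
Lemma cp_comb (u v : T -> R) Z X Y c a b : Linfty P Ft u -> Linfty P Ft v ->
  bmeas Z -> bmeas X -> bmeas Y ->
  psummable P (incr c) -> psummable P (incr a) -> psummable P (incr b) ->
  (\forall w \ae P, forall t, active t w ->
    Z t w * incr c t w = u w * (X t w * incr a t w) + v w * (Y t w * incr b t w)) ->
  \forall w \ae P, cp Z c w = u w * cp X a w + v w * cp Y b w.
Proof.
move=> lu lv bZ bX bY sc sa sb H.
have sX := psummable_terms bX sa; have sY := psummable_terms bY sb.
have LX := L1_psum sX; have LY := L1_psum sY.
have uX : psummable P (fun t w => u w * pairing_terms X a t w).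
  have [[mu _] [k uk]] := lu.
  exact: (@psummableM _ _ _ P (fun _ => u) k).
have vY : psummable P (fun t w => v w * pairing_terms Y b t w).
  have [[mv _] [k vk]] := lv.
  exact: (@psummableM _ _ _ P (fun _ => v) k).
have E : \forall w \ae P, psum (pairing_terms Z c) w =
    u w * psum (pairing_terms X a) w + v w * psum (pairing_terms Y b) w.
  have E1 : \forall w \ae P, psum (pairing_terms Z c) w =
      psum (fun t w => u w * pairing_terms X a t w + v w * pairing_terms Y b t w) w.
    apply: psum_eq => t; apply: filterS H => w /(_ t).
    rewrite /pairing_terms; case: ifP => [_ /(_ isT)//|_ _].
    by rewrite !mulr0 addr0.
  have E2 := psumD uX vY.
  have E3 : \forall w \ae P, psum (fun t w => u w * pairing_terms X a t w) w +
      psum (fun t w => v w * pairing_terms Y b t w) w =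
      u w * psum (pairing_terms X a) w + v w * psum (pairing_terms Y b) w.
    by apply: filterS2 (psumM u sX) (psumM v sY) => w -> ->.
  by apply: filterS3 E1 E2 E3 => w -> ->.
have LZ := L1_terms bZ sc; have sF := Ftau_sigma.
have FM : Ft `<=` measurable by exact: Ftau_sub.
have H1 := condexp_ae_eq FM sF LZ (L1D (Linfty_L1 lu LX) (Linfty_L1 lv LY)) E.
have H2 := condexp_linear FM sF lu lv LX LY.
by apply: filterS2 H1 H2 => w; rewrite !cond_pairingE => -> ->.
Qed.

Lemma cp_scale (u : T -> R) Z X c a : Linfty P Ft u -> bmeas Z -> bmeas X ->
  psummable P (incr c) -> psummable P (incr a) ->
  (\forall w \ae P, forall t, active t w ->
    Z t w * incr c t w = u w * (X t w * incr a t w)) ->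
  \forall w \ae P, cp Z c w = u w * cp X a w.
Proof.
move=> lu bZ bX sc sa H.
have l0 : Linfty P Ft (fun=> 0) by apply: Linfty_cst; exact: Ftau_sub.
have := @cp_comb u (fun=> 0) Z X X c a a lu l0 bZ bX bX sc sa sa.
move=> /(_ _)/filterS; apply; first by move=> w ->; rewrite mul0r addr0.
by apply: filterS H => w H t /H ->; rewrite mul0r addr0.
Qed.

Lemma cp_le X Y a b : bmeas X -> bmeas Y ->
  psummable P (incr a) -> psummable P (incr b) ->
  (\forall w \ae P, forall t, active t w -> X t w * incr a t w <= Y t w * incr b t w) ->
  \forall w \ae P, cp X a w <= cp Y b w.
Proof.
move=> bX bY sa sb H; apply: condexp_le.
- exact: Ftau_sub.
- exact: (Ftau_sigma).
- exact: L1_terms.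
- exact: L1_terms.
- apply: psum_le; [exact: psummable_terms|exact: psummable_terms|].
  move=> t; apply: filterS H => w /(_ t); rewrite /pairing_terms.
  by rewrite /active_at; case: ifP => // _ /(_ isT).
Qed.

Lemma cp_eq X Y a b : bmeas X -> bmeas Y ->
  psummable P (incr a) -> psummable P (incr b) ->
  (\forall w \ae P, forall t, active t w -> X t w * incr a t w = Y t w * incr b t w) ->
  \forall w \ae P, cp X a w = cp Y b w.
Proof.
move=> bX bY sa sb H; apply: condexp_ae_eq.
- exact: Ftau_sub.
- exact: (Ftau_sigma).
- exact: L1_terms.
- exact: L1_terms.
- apply: psum_eq; move=> t; apply: filterS H => w /(_ t); rewrite /pairing_terms.
  by rewrite /active_at; case: ifP => // _ /(_ isT).
Qed.

Lemma cp_mean (u : T -> R) X a : Linfty P Ft u -> bmeas X -> psummable P (incr a) ->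
  mean P (fun w => u w * cp X a w) = mean P (fun w => u w * psum (pairing_terms X a) w).
Proof.
move=> lu bX sa; apply: condexp_pull => //; first exact: Ftau_sub.
  exact: (Ftau_sigma).
exact: L1_terms.
Qed.

Lemma mean_cp X a : bmeas X -> psummable P (incr a) ->
  mean P (cp X a) = mean P (psum (pairing_terms X a)).
Proof.
move=> bX sa; have l1 : Linfty P Ft (fun=> 1) by apply: Linfty_cst; exact: Ftau_sub.
have := cp_mean l1 bX sa.
by under eq_fun do rewrite mul1r; under [X in _ = mean _ X]eq_fun do rewrite mul1r.
Qed.

Lemma decreasing_chain (Xs : nat -> process) :
  (forall n, \forall w \ae P, forall t, Xs n.+1 t w <= Xs n t w) ->
  \forall w \ae P, forall t i j, (i <= j)%N -> Xs j t w <= Xs i t w.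
Proof.
move=> /ae_foralln; apply: filterS => w H t i; elim=> [|j IH].
  by rewrite leqn0 => /eqP ->.
rewrite leq_eqVlt => /orP[/eqP ->//|]; rewrite ltnS => /IH; apply: le_trans.
exact: H.
Qed.

Lemma decreasing_lower (Xs : nat -> process) X :
  (forall n, \forall w \ae P, forall t, Xs n.+1 t w <= Xs n t w) ->
  (forall t, \forall w \ae P, (fun n => Xs n t w) @ \oo --> X t w) ->
  \forall w \ae P, forall t n, X t w <= Xs n t w.
Proof.
move=> /decreasing_chain dec /ae_foralln; apply: filterS2 dec => w dec H t n.
rewrite -(cvg_lim _ (H t))//; apply: limr_le; first by apply/cvg_ex; exists (X t w).
by exists n => // j /= nj; exact: dec.
Qed.

Lemma dual_terms X a : dual_increments (incr a) ->
  \forall w \ae P, forall t, pairing_terms X a t w = X t w * incr a t w.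
Proof.
move=> [_ _ _ aoff]; apply: filterS aoff => w aoff t; rewrite /pairing_terms.
by case: ifPn => // /aoff ->; rewrite mulr0.
Qed.

Lemma pairing_mean X a : pairing P X a = mean P (psum (fun t w => X t w * incr a t w)).
Proof. by []. Qed.

Lemma pairing_cond (u : T -> R) X a : Linfty P Ft u -> bmeas X ->
  dual_increments (incr a) ->
  pairing P X (cumul (fun t w => u w * incr a t w)) = mean P (fun w => u w * cp X a w).
Proof.
move=> lu bX da; have [aa sa a0 aoff] := da; have [[mu _] [k uk]] := lu.
have [mX _] := bX; have [ma _] := sa.
rewrite cp_mean// pairing_mean incr_cumulE; apply: mean_ae_eq.
- apply: measurable_psum => t; apply: measurable_funM => //; exact: measurable_funM.
- apply: measurable_funM => //; apply: measurable_psum => t.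
  by case: (psummable_terms bX sa).
have E : \forall w \ae P, psum (fun t w => X t w * (u w * incr a t w)) w =
    psum (fun t w => u w * pairing_terms X a t w) w.
  apply: psum_eq => t; apply: filterS (dual_terms X da) => w ->.
  by rewrite mulrCA.
by apply: filterS2 E (psumM u (psummable_terms bX sa)) => w -> ->.
Qed.

Lemma Dset_cumul z : dual_increments z ->
  (\forall w \ae P, cp (fun _ _ => 1) (cumul z) w = 1) -> Dset P F tau theta (cumul z).
Proof. by move=> dz cz; split => //; exact: A1pos_tt_cumul. Qed.

(** The element of D with all its mass at tau. *)
Definition unit_at_tau : process := fun t w => (started w t)%:R.

Lemma Dset_unit : Dset P F tau theta unit_at_tau.
Proof.
have mst t : measurable_fun setT (unit_at_tau t).
  have R1 : Rtt unit_at_tau by exact: Rtt_one.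
  exact: Rtt_measurable R1.
have Apos : A1pos_tt P F tau theta unit_at_tau.
  split => //; exists (fun _ _ => 1); last first.
    by apply: aeW => w t; rewrite /unit_at_tau /stopped_proj; case: ifP.
  split; last by apply: aeW => w [|t]; rewrite /incr ?subrr.
  have aI t : as_measurable P (F t) (incr (fun _ _ => 1 : R) t).
    by apply: asm_incr => s; apply: asm_cst; exact: (filtration_sub).
  split; first by move=> t; apply: asm_cst; exact: (filtration_sub).
  suff [] : psummable P (incr (fun _ _ => 1 : R)) by [].
  apply: psummableP.
    move=> t; apply: (@L1_bounded _ _ _ P _ 1); first by case: (aI t).
    by apply: aeW => w; case: t => [|t]; rewrite /incr ?subrr ?normr0 ?normr1.
  exists 1 => -[|n]; first by rewrite big_geq.
  rewrite big_nat_recl//= big1 ?addr0.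
    by under eq_fun do rewrite /incr normr1; rewrite mean_cst.
  by move=> t _; under eq_fun do rewrite /incr subrr normr0; rewrite mean_cst.
split => //; have [aa sa a0 aoff] := A1pos_tt_increments Apos.
have E : \forall w \ae P, psum (pairing_terms (fun _ _ => 1) unit_at_tau) w = 1.
  apply: filterS2 htau_fin (dual_terms (fun _ _ => 1) (A1pos_tt_increments Apos)).
  move=> w tf dt; case E: (tau w) tf => [n|]// _.
  apply: cvg_lim => //; apply: cvg_near_cst; exists n.+1 => // -[//|k] /= nk.
  rewrite /series/= (eq_bigr (incr unit_at_tau ^~ w)); last by move=> t _; rewrite dt mul1r.
  by rewrite sum_incr /unit_at_tau E /= -ltnS nk.
have FM : Ft `<=` measurable by exact: Ftau_sub.
have sF := Ftau_sigma.
have c1 := @condexp_ae_eq _ _ _ P Ft FM sF _ _ (L1_terms (bmeas_cst 1) sa) (L1_cst P 1) E.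
have c2 := @condexp_id _ _ _ P Ft FM sF _ (L1_cst P 1) (asm_cst P FM 1).
by apply: filterS2 c1 c2 => w; rewrite cond_pairingE => -> ->.
Qed.

(** * Functionals represented by a penalty function *)

Let FM : Ft `<=` measurable. Proof. exact: Ftau_sub. Qed.
Let sF : sigma_algebra setT Ft. Proof. exact: Ftau_sigma. Qed.
Let Lc (c : R) : Linfty P Ft (fun=> c). Proof. exact: Linfty_cst. Qed.

Lemma Dset_nonempty : D !=set0.
Proof. by exists (unit_at_tau); exact: Dset_unit. Qed.

Lemma Dset_dual a : D a -> dual_increments (incr a).
Proof. by move=> [Da _]; exact: A1pos_tt_increments. Qed.

Lemma Dset_sum a : D a -> psummable P (incr a).
Proof. by move=> /Dset_dual[]. Qed.

Lemma Dset_one a : D a -> \forall w \ae P, cp (fun _ _ => 1) a w = 1.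
Proof. by move=> []. Qed.

Lemma Rtt_bm X : Rtt X -> bmeas X.
Proof. exact: Rtt_bmeas. Qed.

(** A variable m known at tau comes out unchanged because <1, a> = 1. *)
Lemma cp_affine (u m : T -> R) Z X a : D a -> Linfty P Ft u -> Linfty P Ft m ->
  bmeas Z -> bmeas X ->
  (\forall w \ae P, forall t, active t w -> Z t w = u w * X t w + m w) ->
  \forall w \ae P, cp Z a w = u w * cp X a w + m w.
Proof.
move=> Da lu lm bZ bX H; have sa := Dset_sum Da.
have b1 := bmeas_cst 1.
have H1 : \forall w \ae P, cp Z a w = u w * cp X a w + m w * cp (fun _ _ => 1) a w.
  apply: cp_comb => //; apply: filterS H => w H t /H ->.
  by rewrite mul1r mulrDl mulrA.
by apply: filterS2 H1 (Dset_one Da) => w -> ->; rewrite mulr1.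
Qed.

Lemma cp_mono X Y a : D a -> bmeas X -> bmeas Y ->
  (\forall w \ae P, forall t, active t w -> X t w <= Y t w) ->
  \forall w \ae P, cp X a w <= cp Y a w.
Proof.
move=> Da bX bY XY; have [_ sa a0 _] := Dset_dual Da.
apply: cp_le => //; apply: filterS2 XY a0 => w XY a0 t /XY.
by move=> h; rewrite ler_wpM2r.
Qed.

Lemma cp_bounds X a (m : R) : D a -> bmeas X ->
  (\forall w \ae P, forall t, `|X t w| <= m) -> \forall w \ae P, `|cp X a w| <= m.
Proof.
move=> Da bX Xm; have cst (c : R) : \forall w \ae P, cp (fun _ _ => c) a w = c.
  have := @cp_affine (fun=> 0) (fun=> c) (fun _ _ => c) (fun _ _ => 0) a Da (Lc 0) (Lc c) (bmeas_cst c) (bmeas_cst 0).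
  move=> /(_ _)/filterS; apply; first by move=> w ->; rewrite mul0r add0r.
  by apply: aeW => w t _; rewrite mul0r add0r.
have h1 : \forall w \ae P, cp (fun _ _ => - m) a w <= cp X a w.
  apply: cp_mono => //; first exact: bmeas_cst.
  by apply: filterS Xm => w Xm t _; have := Xm t; rewrite ler_norml => /andP[].
have h2 : \forall w \ae P, cp X a w <= cp (fun _ _ => m) a w.
  apply: cp_mono => //; first exact: bmeas_cst.
  by apply: filterS Xm => w Xm t _; have := Xm t; rewrite ler_norml => /andP[].
apply: filterS2 (filterI h1 h2) (filterI (cst (- m)) (cst m)) => w [k1 k2] [e1 e2].
by move: k1 k2; rewrite e1 e2 ler_norml => -> ->.
Qed.

Section from_penalty.
Variables (gamma phi : process -> T -> \bar R).
Hypothesis pg : penalty P F tau theta gamma.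
Hypothesis rep : representation P F tau theta phi gamma.

Definition penalized X a : T -> \bar R := fun w => ((cp X a w)%:E - gamma a w)%E.

Lemma penalized_asm X a : D a -> as_measurable P Ft (penalized X a).
Proof.
move=> Da; apply: easmB; last exact: (penalty_meas pg).
exact: cp_easm.
Qed.

Lemma penalized_measurable X a : D a -> measurable_fun setT (penalized X a).
Proof. by move=> /(penalized_asm X)[]. Qed.

Lemma repE X : Rtt X -> \forall w \ae P, phi X w = essinf P (penalized X @` D) w.
Proof. exact: rep. Qed.

(** The normalization esssup gamma = 0, read on the infimum of - gamma. *)
Lemma penalty_glb (h : T -> \bar R) : measurable_fun setT h ->
  (forall a, D a -> \forall w \ae P, (h w <= - gamma a w)%E) ->
  \forall w \ae P, (h w <= 0)%E.
Proof.
move=> mh H; have mg a : D a -> measurable_fun setT (gamma a).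
  by move=> /(penalty_meas pg)[].
have [_ _ Hsup] := @esssupP _ _ _ P _ _ Dset_nonempty gamma mg.
have mNh : measurable_fun setT (fun w => (- h w)%E) by exact: measurableT_comp.
have : \forall w \ae P, (esssup P (gamma @` D) w <= - h w)%E.
  by apply: Hsup => // _ [a Da <-]; apply: filterS (H a Da) => w; rewrite leeNr.
by apply: filterS2 (penalty_sup pg) => w ->; rewrite leeNr oppe0.
Qed.

Lemma rep_bound X (m : R) : Rtt X -> (\forall w \ae P, forall t, `|X t w| <= m) ->
  \forall w \ae P, ((- m)%:E <= phi X w <= m%:E)%E.
Proof.
move=> RX Xm; have bX := Rtt_bm RX.
have mV a : D a -> measurable_fun setT (penalized X a) by exact: penalized_measurable.
have h1 : \forall w \ae P, ((- m)%:E <= essinf P (penalized X @` D) w)%E.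
  apply: (@essinf_glb _ _ _ P _ _ Dset_nonempty (fun=> (- m)%:E)) => // a Da.
  apply: filterS2 (cp_bounds Da bX Xm) (penalty_le0 pg Da) => w.
  by rewrite ler_norml /penalized => /andP[xm _] /ereal_le_shift; apply.
have me := @essinf_measurable _ _ _ P _ _ Dset_nonempty _ mV.
have h2 : \forall w \ae P, (essinf P (penalized X @` D) w - m%:E <= 0)%E.
  apply: penalty_glb.
    by apply: emeasurable_funB => //; exact: measurable_cst.
  move=> a Da; have lb := @essinf_lb _ _ _ P _ _ Dset_nonempty _ _ mV Da.
  apply: filterS2 (cp_bounds Da bX Xm) lb => w.
  by rewrite ler_norml /penalized => /andP[_ xm] /ereal_shift_le; apply.
apply: filterS3 h1 h2 (repE RX) => w h1 h2 ->; rewrite h1/=.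
by move: h2; rewrite leeBlDr// add0e.
Qed.

Lemma rep_real X : Rtt X ->
  exists2 g, Linfty P Ft g & \forall w \ae P, phi X w = (g w)%:E.
Proof.
move=> RX; have [m m0 Xm] := Rtt_bounded RX.
have aV a : D a -> as_measurable P Ft (penalized X a) by exact: penalized_asm.
have ae : as_measurable P Ft (essinf P (penalized X @` D)).
  apply: essinf_asm.
    by have [a Da] := Dset_nonempty; exists (penalized X a), a.
  by move=> _ [a Da <-]; exact: aV.
exists (fun w => fine (essinf P (penalized X @` D) w)).
  split; first by apply: asm_comp ae; exact: fine_measurable.
  exists m; apply: filterS2 (rep_bound RX Xm) (repE RX) => w + <-.
  by move=> /ereal_between[r ->].
apply: filterS2 (rep_bound RX Xm) (repE RX) => w + <-.
by move=> /ereal_between[r ->].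
Qed.

Lemma rep_mono X Y : Rtt X -> Rtt Y ->
  (\forall w \ae P, forall t, X t w <= Y t w) ->
  \forall w \ae P, (phi X w <= phi Y w)%E.
Proof.
move=> RX RY XY.
have : \forall w \ae P, [set: T] w ->
    (essinf P (penalized X @` D) w <= essinf P (penalized Y @` D) w)%E.
  apply: essinf_le_on; [exact: Dset_nonempty|by []| | |].
  - by move=> a Da; exact: penalized_measurable.
  - by move=> a Da; exact: penalized_measurable.
  - move=> a Da.
    have : \forall w \ae P, cp X a w <= cp Y a w.
      apply: cp_mono => //; [exact: Rtt_bm|exact: Rtt_bm|].
      by apply: filterS XY => w XY t _; exact: XY.
    by apply: filterS => w cXY _; rewrite /penalized leeB.
by apply: filterS3 (repE RX) (repE RY) => w -> -> /(_ Logic.I).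
Qed.

Lemma rep_zero : \forall w \ae P, phi (fun _ _ => 0) w = 0%E.
Proof.
have R0' : Rtt (fun _ _ => 0) by exact: Rtt0.
have := rep_bound R0' (m := 0) _; move=> /(_ _)/filterS; apply.
  by move=> w; rewrite oppr0 => h; apply/eqP; rewrite eq_le andbC.
by apply: aeW => w t; rewrite normr0.
Qed.

Lemma rep_eq_on X Y (B : set T) : Rtt X -> Rtt Y -> measurable B ->
  (forall a, D a -> \forall w \ae P, B w -> cp X a w = cp Y a w) ->
  \forall w \ae P, B w -> phi X w = phi Y w.
Proof.
move=> RX RY mB H.
have : \forall w \ae P, B w ->
    essinf P (penalized X @` D) w = essinf P (penalized Y @` D) w.
  apply: essinf_eq_on; [exact: Dset_nonempty|by []| | |].
  - by move=> a Da; exact: penalized_measurable.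
  - by move=> a Da; exact: penalized_measurable.
  - by move=> a /H; apply: filterS => w h /h; rewrite /penalized => ->.
by apply: filterS3 (repE RX) (repE RY) => w -> ->.
Qed.

Lemma rep_local X A : Rtt X -> Ft A ->
  \forall w \ae P, phi (fun t w => \1_A w * X t w) w = ((\1_A w)%:E * phi X w)%E.
Proof.
move=> RX FA; have mA := FM FA.
have RA : Rtt (fun t w => \1_A w * X t w) by exact: Rtt_indic.
have R0' : Rtt (fun _ _ => 0) by exact: Rtt0.
have lA := Linfty_indic P FM FA.
have cpA a : D a -> \forall w \ae P, cp (fun t w => \1_A w * X t w) a w = \1_A w * cp X a w.
  move=> Da; have sa := Dset_sum Da.
  apply: cp_scale => //; [exact: Rtt_bm|exact: Rtt_bm|].
  by apply: aeW => w t _; rewrite mulrA.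
have cp0 a : D a -> \forall w \ae P, cp (fun _ _ => 0) a w = 0.
  move=> Da; have := @cp_bounds (fun _ _ => 0) a 0 Da (bmeas_cst 0).
  move=> /(_ _)/filterS; apply; first by move=> w; rewrite normr_le0 => /eqP.
  by apply: aeW => w t; rewrite normr0.
have h1 : \forall w \ae P, A w -> phi (fun t w => \1_A w * X t w) w = phi X w.
  apply: rep_eq_on => // a /cpA; apply: filterS => w -> Aw.
  by rewrite indicE mem_set// mul1r.
have h2 : \forall w \ae P, (~` A) w -> phi (fun t w => \1_A w * X t w) w = phi (fun _ _ => 0) w.
  apply: rep_eq_on => //; first exact: measurableC.
  move=> a Da; apply: filterS2 (cpA a Da) (cp0 a Da) => w -> -> Aw.
  by rewrite indicE memNset// mul0r.
apply: filterS3 h1 h2 rep_zero => w h1 h2 h3.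
have [Aw|nAw] := pselect (A w).
  by rewrite h1// indicE mem_set// mul1e.
by rewrite h2// indicE memNset// mul0e.
Qed.

Lemma rep_translation X m : Rtt X -> Linfty P Ft m ->
  \forall w \ae P, phi (add_from_tau tau X m) w = (phi X w + (m w)%:E)%E.
Proof.
move=> RX lm; have RXm : Rtt (add_from_tau tau X m) by exact: Rtt_add_from_tau.
have mV Y a : D a -> measurable_fun setT (penalized Y a) by exact: penalized_measurable.
have cpm a : D a -> \forall w \ae P, cp (add_from_tau tau X m) a w = cp X a w + m w.
  move=> Da; have : \forall w \ae P, cp (add_from_tau tau X m) a w = 1 * cp X a w + m w.
    apply: (@cp_affine (fun=> 1)) => //; [exact: Rtt_bm|exact: Rtt_bm|].
    by apply: aeW => w t /andP[st _]; rewrite /add_from_tau st mulr1 mul1r.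
  by apply: filterS => w; rewrite mul1r.
have mm : measurable_fun setT (fun w => (m w)%:E) by apply/measurable_EFinP; case: lm => -[].
have me Y := @essinf_measurable _ _ _ P _ _ Dset_nonempty _ (mV Y).
have h1 : \forall w \ae P, (essinf P (penalized X @` D) w + (m w)%:E
    <= essinf P (penalized (add_from_tau tau X m) @` D) w)%E.
  apply: (essinf_glb Dset_nonempty); [exact: mV|exact: (emeasurable_funD (me X) mm)|].
  move=> a Da; have lb := @essinf_lb _ _ _ P _ _ Dset_nonempty _ _ (mV X) Da.
  apply: filterS2 (cpm a Da) lb => w; rewrite /penalized => ->.
  exact: ereal_shiftD.
have h2 : \forall w \ae P, (essinf P (penalized (add_from_tau tau X m) @` D) w - (m w)%:E
    <= essinf P (penalized X @` D) w)%E.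
  apply: (essinf_glb Dset_nonempty); [exact: mV|exact: (emeasurable_funB (me _) mm)|].
  move=> a Da; have lb := @essinf_lb _ _ _ P _ _ Dset_nonempty _ _ (mV (add_from_tau tau X m)) Da.
  apply: filterS2 (cpm a Da) lb => w; rewrite /penalized => ->.
  by move=> /(ereal_shiftD (- m w)); rewrite addrK.
apply: filterS2 (filterI h1 h2) (filterI (repE RX) (repE RXm)) => w [h1w h2w] [-> ->].
apply/eqP; rewrite eq_le h1w andbT -leeBlDr//.
Qed.

Lemma rep_concave X Y l : Rtt X -> Rtt Y -> Linfty P Ft l ->
  (\forall w \ae P, 0 <= l w <= 1) ->
  \forall w \ae P, ((l w)%:E * phi X w + (1 - l w)%:E * phi Y w
    <= phi (fun t w => l w * X t w + (1 - l w) * Y t w)%R w)%E.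
Proof.
move=> RX RY ll l01; have l1 : Linfty P Ft (fun w => 1 - l w) by exact: LinftyB.
pose Z : process := fun t w => l w * X t w + (1 - l w) * Y t w.
have RZ : Rtt Z by exact: Rtt_comb.
have mV X' a : D a -> measurable_fun setT (penalized X' a) by exact: penalized_measurable.
have [gX [aX _] XE] := rep_real RX; have [gY [aY _] YE] := rep_real RY.
have al := ll.1; have al1 := l1.1.
pose h w := l w * gX w + (1 - l w) * gY w.
have mh : measurable_fun setT h.
  have [] : as_measurable P Ft h by apply: asmD; exact: asmM.
  by [].
have H : \forall w \ae P, ((h w)%:E <= essinf P (penalized Z @` D) w)%E.
  apply: (essinf_glb Dset_nonempty); [exact: mV|exact/measurable_EFinP|].
  move=> a Da; have sa := Dset_sum Da.
  have lbX := @essinf_lb _ _ _ P _ _ Dset_nonempty _ _ (mV X) Da.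
  have lbY := @essinf_lb _ _ _ P _ _ Dset_nonempty _ _ (mV Y) Da.
  have cz : \forall w \ae P, cp Z a w =
      l w * cp X a w + (1 - l w) * cp Y a w.
    apply: cp_comb => //; [exact: Rtt_bm|exact: Rtt_bm|exact: Rtt_bm|].
    by apply: aeW => w t _; rewrite /Z mulrDl !mulrA.
  have h1 : \forall w \ae P, ((gX w)%:E <= penalized X a w)%E.
    by apply: filterS3 lbX XE (repE RX) => w + <- ->.
  have h2 : \forall w \ae P, ((gY w)%:E <= penalized Y a w)%E.
    by apply: filterS3 lbY YE (repE RY) => w + <- ->.
  apply: filterS3 cz (filterI h1 h2) l01 => w + [] + + /andP[lw0 lw1].
  rewrite /penalized /h => ->.
  exact: ereal_convex_combination.
apply: filterS3 (filterI XE YE) H (repE RZ) => w [-> ->] Hw ->.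
exact: Hw.
Qed.

Lemma rep_concave_utility : concave_monetary_utility P F tau theta phi.
Proof.
split; last exact: rep_concave.
split; [exact: rep_real|exact: rep_local|exact: rep_mono|exact: rep_translation].
Qed.

End from_penalty.

Let D0 : D !=set0. Proof. exact: Dset_nonempty. Qed.
Let bm X : Rtt X -> bmeas X. Proof. exact: Rtt_bmeas. Qed.

(** * Represented functionals have closed acceptance sets *)

Section test_processes.

Definition at_time t (f : T -> R) : process := fun s w => if s == t then f w else 0.

Lemma ssum_at (b : nat -> R) t : (forall s, s != t -> b s = 0) -> ssum b = b t.
Proof.
move=> b0; apply: cvg_lim => //; apply: cvg_near_cst; exists t.+1 => // n /= tn.
rewrite /series/= (bigD1_seq t)//= ?iota_uniq ?mem_index_iota//.
by rewrite big1 ?addr0// => s /b0.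
Qed.

Lemma psummable_at t f : L1 P f -> psummable P (at_time t f).
Proof.
move=> Lf; have Ls s : L1 P (at_time t f s).
  by rewrite /at_time; case: eqP => _ //; exact: L1_cst.
apply: psummableP => //; exists (mean P (fun w => `|f w|)) => n.
apply: le_trans (_ : \sum_(0 <= s < n | s == t) mean P (fun w => `|f w|) <= _).
  rewrite [leRHS]big_mkcond/=; apply: ler_sum => s _; rewrite /at_time.
  case: eqP => // _; under eq_fun do rewrite normr0.
  by rewrite mean_cst.
rewrite big_mkcond/=.
have [tn|nt] := ltnP t n.
  rewrite (bigD1_seq t)//= ?iota_uniq ?mem_index_iota// eqxx big1 ?addr0//.
  by move=> s /negbTE ->.
rewrite big1_seq; first by apply: Rintegral_ge0.
by move=> s; rewrite mem_index_iota => /= sn; case: eqP => // st; rewrite st ltnNge nt in sn.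
Qed.

Lemma psum_at X t f w : psum (fun s w => X s w * at_time t f s w) w = X t w * f w.
Proof.
rewrite /psum (ssum_at (t := t)) /at_time; first by rewrite eqxx.
by move=> s /negbTE ->; rewrite mulr0.
Qed.

Lemma asm_at t f s : as_measurable P (F t) f -> as_measurable P (F s) (at_time t f s).
Proof.
rewrite /at_time; case: eqP => [-> //|_ _].
by apply: asm_cst; exact: (filtration_sub).
Qed.

Lemma psum_pairing X z : pairing P X (cumul z) = mean P (psum (fun t w => X t w * z t w)).
Proof. by rewrite pairing_mean incr_cumulE. Qed.

Lemma pairing_at X t f : pairing P X (cumul (at_time t f)) = mean P (fun w => X t w * f w).
Proof.
rewrite psum_pairing; congr mean; apply/funext => w; exact: psum_at.
Qed.

End test_processes.

Lemma mean_square_eq0 (f : T -> R) : measurable_fun setT f ->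
  (exists m : R, \forall w \ae P, `|f w| <= m) -> mean P (fun w => f w * f w) = 0 ->
  \forall w \ae P, f w = 0.
Proof.
move=> mf [m fm] f0.
have H : \forall w \ae P, f w * f w = 0.
  apply: (@mean_eq0 _ _ _ P (fun w => f w * f w)); last by rewrite f0.
    apply: (@L1M _ _ _ P f f m) => //; exact: L1_bounded fm.
  by apply: aeW => w; rewrite -expr2 sqr_ge0.
by apply: filterS H => w /eqP; rewrite mulf_eq0 orbb => /eqP.
Qed.

(** This keeps weak limits inside R_(tau,theta). Values before tau are detected by
    a variable placed at time t, motion after theta by the pair f at time t + 1
    and - E[f | F_t] at time t, which vanishes against adapted processes that
    are constant where f is not zero. *)
Lemma Rtt_tests X : Rinfty P F X ->
  (forall a, A1 P F a -> (forall Y, Rtt Y -> pairing P Y a = 0) -> pairing P X a = 0) ->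
  Rtt X.
Proof.
move=> RX test; have [aX [m Xm]] := RX.
have lX t : Linfty P (F t) (X t) by split => //; exists m; apply: filterS Xm.
have FtM t := filtration_sub (t := t).
have L1l t f : Linfty P (F t) f -> L1 P f.
  by move=> [[mf _] [c fc]]; exact: L1_bounded fc.
have before t : \forall w \ae P, ~~ started w t -> X t w = 0.
  pose B := ~` [set w | started w t].
  have FB : F t B by apply: sigma_setC; [exact: filtration_sigma|exact: started_set].
  pose f w := \1_B w * X t w.
  have lf : Linfty P (F t) f by apply: LinftyM => //; exact: Linfty_indic.
  have f0 : mean P (fun w => X t w * f w) = 0.
    rewrite -pairing_at; apply: test.
      apply: A1_cumul => //; last by apply: psummable_at; exact: L1l lf.
      by move=> s; apply: asm_at; case: lf.
    move=> Y RY; rewrite pairing_at -(mean_cst P 0); apply: mean_ae_eq.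
    - apply: measurable_funM; first exact: Rtt_measurable RY.
      by case: lf => -[].
    - exact: measurable_cst.
    - apply: filterS (Rtt_off RY) => w /(_ t) Y0; rewrite /f indicE.
      case: (boolP (w \in B)) => [/set_mem/negP/Y0 ->|_]; by rewrite ?mul0r ?mulr0.
  have ff : \forall w \ae P, f w = 0.
    apply: mean_square_eq0; [by case: lf => -[]|by case: lf|].
    rewrite -f0; congr mean; apply/funext => w; rewrite /f indicE.
    by case: (w \in B); rewrite ?mul1r ?mul0r ?mulr0.
  apply: filterS ff => w + nst; rewrite /f indicE mem_set ?mul1r//.
  exact/negP.
have after t : \forall w \ae P, time_le (theta w) (Some t) -> X t.+1 w = X t w.
  pose B := [set w | time_le (theta w) (Some t)].
  have FB : F t.+1 B by apply: (filtration_le (leqnSn t)); exact: htheta.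
  have lXt : Linfty P (F t.+1) (X t).
    split; last by case: (lX t).
    by apply: asm_mono (aX t); exact: filtration_le.
  pose f w := \1_B w * (X t.+1 w - X t w).
  have lf : Linfty P (F t.+1) f.
    by apply: LinftyM; [exact: Linfty_indic|exact: LinftyB].
  have Lf := L1l _ _ lf.
  pose g := condexp P (F t) f.
  have Lg : L1 P g by exact: condexp_L1.
  have Lgn : L1 P (fun w => -1 * g w) by exact: L1Z.
  pose z : process := fun s w => at_time t.+1 f s w + at_time t (fun w => -1 * g w) s w.
  have sz : psummable P z by apply: psummableD; exact: psummable_at.
  have az s : as_measurable P (F s) (z s).
    apply: asmD; first by apply: asm_at; case: lf.
    by apply: asm_at; apply: asmZ; [exact: FtM|exact: condexp_asm].
  have pz Y : (forall s, Linfty P (F s) (Y s)) ->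
      pairing P Y (cumul z) = mean P (fun w => (Y t.+1 w - Y t w) * f w).
    move=> lY; rewrite psum_pairing.
    have LYf : L1 P (fun w => Y t.+1 w * f w) by apply: Linfty_L1 (lY _) _.
    have LYf' : L1 P (fun w => Y t w * f w) by apply: Linfty_L1 (lY _) _.
    have LYg : L1 P (fun w => Y t w * g w) by apply: Linfty_L1 (lY _) _.
    have -> : psum (fun s w => Y s w * z s w) = fun w => Y t.+1 w * f w - Y t w * g w.
      apply/funext => w; rewrite /psum /z.
      transitivity (ssum (fun s => Y s w * at_time t.+1 f s w + Y s w * at_time t (fun w => -1 * g w) s w)).
        by congr ssum; apply/funext => s; rewrite mulrDr.
      have sm u h : abs_summable (fun s => Y s w * at_time u h s w).
        apply/cvg_ex; exists `|Y u w * h w|; apply: cvg_near_cst; exists u.+1 => // n /= un.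
        rewrite /series/= (bigD1_seq u)//= ?iota_uniq ?mem_index_iota//.
        rewrite {1}/at_time eqxx big1 ?addr0// => s /negbTE; rewrite /at_time => ->.
        by rewrite mulr0 normr0.
      rewrite ssumD//; have := psum_at Y t.+1 f w; have := psum_at Y t (fun w => -1 * g w) w.
      by rewrite /psum => -> ->; rewrite mulN1r mulrN.
    rewrite meanB// condexp_pull//; last exact: filtration_sigma.
    rewrite -meanB//; congr mean; apply/funext => w; by rewrite mulrBl.
  have f0 : mean P (fun w => (X t.+1 w - X t w) * f w) = 0.
    rewrite -pz//; apply: test; first exact: A1_cumul.
    move=> Y RY; rewrite pz; last first.
      move=> s; split; first exact: Rtt_asm RY.
      have [c _ Yc] := Rtt_bounded RY.
      by exists c; apply: filterS Yc.
    rewrite -(mean_cst P 0); apply: mean_ae_eq.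
    - apply: measurable_funM; last by case: lf => -[].
      by apply: measurable_funB; exact: Rtt_measurable RY.
    - exact: measurable_cst.
    - apply: filterS2 (Rtt_stopped RY) htau_theta => w sY tt.
      rewrite /f indicE; case: (boolP (w \in B)) => [/set_mem|_]; last by rewrite mul0r mulr0.
      rewrite /B/= => Bw; suff -> : Y t.+1 w = Y t w by rewrite subrr mul0r.
      rewrite sY [RHS]sY /stopped_proj /time_min.
      move: tt Bw; case: (theta w) => [n|]//; case: (tau w) => [k|]//= kn nt.
      have kt := leq_trans kn nt.
      by rewrite kt (leqW kt) (minn_idPr nt) (minn_idPr (leqW nt)).
  have ff : \forall w \ae P, f w = 0.
    apply: mean_square_eq0; [by case: lf => -[]|by case: lf|].
    rewrite -f0; congr mean; apply/funext => w; rewrite /f indicE.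
    by case: (w \in B); rewrite ?mul1r ?mul0r ?mulr0.
  apply: filterS ff => w + nst; rewrite /f indicE mem_set ?mul1r// => /eqP.
  by rewrite subr_eq0 => /eqP.
apply/(RttP); split => //.
have be := ae_foralln before; have af := ae_foralln after.
apply: filterS2 be af => w be af t; rewrite /stopped_proj.
case: ifPn => [st|/be//]; rewrite /time_min.
case thw: (theta w) => [n|]//; have [tn|nt] := leqP t n; first by [].
elim: t {st} nt => // t IH; rewrite ltnS leq_eqVlt => /orP[/eqP e|nt].
  by rewrite -e; apply: af; rewrite thw/=.
by rewrite -IH//; apply: af; rewrite thw/= ltnW.
Qed.

(** The factor is only known at tau, but the increments vanish before tau. *)
Lemma dual_scale_asm (u : T -> R) a t : Linfty P Ft u ->
  dual_increments (incr a) ->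
  as_measurable P (F t) (fun w => u w * incr a t w).
Proof.
move=> [au _] [aa _ _ aoff].
apply: (@asm_ae _ _ _ P (F t) _ _ (fun w => (u w * (started w t)%:R) * incr a t w)).
- by apply: asmM => //; exact: asm_started.
- by apply: measurable_funM; [case: au|case: (aa t)].
- apply: filterS aoff => w /(_ t); rewrite /active_at.
  case: (started w t) => /=; first by rewrite mulr1.
  by move=> ->//; rewrite !mulr0.
Qed.

Lemma A1_scale (u : T -> R) a : Linfty P Ft u ->
  dual_increments (incr a) ->
  A1 P F (cumul (fun t w => u w * incr a t w)).
Proof.
move=> lu da; have [_ sa _ _] := da; apply: A1_cumul => //.
  by move=> t; exact: dual_scale_asm.
have [[mu _] [c uc]] := lu.
exact: (@psummableM _ _ _ P (fun _ => u) c).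
Qed.

(** If <X, a> - gamma(a) were negative on an event B known at tau, the weakly
    continuous functional Y |-> E[1_B <Y, a>] would separate X from the acceptance
    set, where it is at least E[1_B gamma(a)]. *)
Lemma rep_closed phi gamma : penalty P F tau theta gamma ->
  representation P F tau theta phi gamma ->
  weakly_closed P F (acceptance P F tau theta phi).
Proof.
move=> pg rep; rewrite /weakly_closed => x clx.
set X := val x; have RX : Rinfty P F X by exact: set_valP.
have approx a (e : R) : A1 P F a -> 0 < e ->
    exists Y, C phi Y /\ `|pairing P X a - pairing P Y a| < e.
  by move=> Aa e0; have [Y [CY ?]] := weak_closure_approx clx Aa e0; exists (val Y).
have RttX : Rtt X.
  apply: Rtt_tests => // a Aa a0; apply/eqP; rewrite -normr_eq0 eq_le normr_ge0 andbT.
  apply/ler_addgt0Pr => e e0; rewrite add0r.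
  have [Y [[RY _] /ltW]] := approx a e Aa e0.
  by rewrite (a0 Y RY) subr0.
split => //.
have mV a : D a -> measurable_fun setT (penalized gamma X a).
  exact: penalized_measurable.
suff H : \forall w \ae P, (0 <= essinf P (penalized gamma X @` D) w)%E.
  by apply: filterS2 H (rep X RttX) => w H ->.
apply: (@essinf_glb _ _ _ P _ _ D0 (fun=> 0%E)) => // a Da.
have da := Dset_dual Da; have [_ sa a0 _] := da.
have aV : as_measurable P Ft (penalized gamma X a) by exact: penalized_asm.
have [B FB BE] := asm_set sF aV (emeasurable_itv `]-oo, 0%E[).
have g0 := penalty_le0 pg Da.
have ag : as_measurable P Ft (fun w => fine (gamma a w)).
  by apply: asm_comp (penalty_meas pg Da); exact: fine_measurable.
have BX : \forall w \ae P, B w -> (cp X a w < fine (gamma a w) <= 0) /\ gamma a w = (fine (gamma a w))%:E.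
  apply: filterS2 BE g0 => w BE + /BE; rewrite /= in_itv/= /penalized.
  case: (gamma a w) => [r| |].
  - by rewrite -EFinB lte_fin lee_fin subr_lt0 => -> ->.
  - by rewrite leye_eq.
  - by move=> _; rewrite /= addey// => /[apply].
have lB : Linfty P Ft (\1_B : T -> R) by exact: Linfty_indic.
have LX : L1 P (fun w => \1_B w * cp X a w) by apply: Linfty_L1 lB _; exact: cp_L1.
have Lg : L1 P (fun w => \1_B w * fine (gamma a w)).
  apply: (@L1_le _ _ _ P _ (fun w => `|cp X a w|)); last by apply: L1_norm; exact: cp_L1.
    by apply: measurable_funM; [exact: measurable_indic (FM FB)|case: ag].
  apply: filterS BX => w; rewrite indicE; case: (boolP (w \in B)) => [/set_mem Bw /(_ Bw)|_ _].
    move=> [/andP[x1 x2] _]; rewrite mul1r (ler0_norm x2) ler0_norm ?lerN2; first exact: ltW.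
    exact: ltW (lt_le_trans x1 x2).
  by rewrite mul0r normr0.
pose Z := cumul (fun t w => \1_B w * incr a t w).
have AZ : A1 P F Z.
  exact: (A1_scale lB da).
have pZ Y : Rtt Y -> pairing P Y Z = mean P (fun w => \1_B w * cp Y a w).
  by move=> RY; apply: pairing_cond => //; exact: bm.
have key : mean P (fun w => \1_B w * fine (gamma a w)) <= mean P (fun w => \1_B w * cp X a w).
  apply/ler_addgt0Pr => e e0.
  have [Y [[RY CY] /ltW]] := approx Z e AZ e0.
  rewrite !pZ// ler_norml => /andP[+ _]; rewrite lerBrDr addrC lerBlDr => H.
  apply: (le_trans _ H) => {H}.
  apply: mean_le; [exact: Lg|by apply: Linfty_L1 lB _; exact: cp_L1|].
  have mY a1 : D a1 -> measurable_fun setT (penalized gamma Y a1) by exact: penalized_measurable.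
  have lb := @essinf_lb _ _ _ P _ _ D0 _ _ mY Da.
  apply: filterS3 (filterI CY (rep Y RY)) lb BX => w [c1 c2] c3 BXw.
  rewrite indicE; case: (boolP (w \in B)) => [/set_mem Bw|_]; last by rewrite !mul0r.
  have [_ ge] := BXw Bw; move: c3; rewrite /penalized -c2 => /(le_trans c1).
  by rewrite ge -EFinB lee_fin subr_ge0 !mul1r.
have z0 : \forall w \ae P, \1_B w * fine (gamma a w) - \1_B w * cp X a w = 0.
  apply: (@mean_eq0 _ _ _ P (fun w => \1_B w * fine (gamma a w) - \1_B w * cp X a w)).
  - exact: L1B.
  - apply: filterS BX => w; rewrite indicE; case: (boolP (w \in B)) => [/set_mem Bw /(_ Bw)|_ _].
      by move=> [/andP[x1 _] _]; rewrite !mul1r subr_ge0 ltW.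
    by rewrite !mul0r subrr.
  - by rewrite meanB// subr_le0.
apply: filterS3 z0 BX BE => w + BXw BEw; rewrite indicE.
case: (boolP (w \in B)) => [/set_mem Bw|/negP nB] zw.
  have [/andP[x1 _] _] := BXw Bw; move: zw; rewrite !mul1r => /eqP; rewrite subr_eq0 => /eqP e.
  by rewrite e ltxx in x1.
rewrite leNgt; apply/negP => p0; apply: nB; apply/mem_set/BEw.
by rewrite /= in_itv.
Qed.

(** * Closed acceptance sets give continuity from above *)

Lemma decreasing_limit (g : nat -> T -> R) (l : T -> R) :
  (forall n, \forall w \ae P, g n.+1 w <= g n w) ->
  (forall n, \forall w \ae P, l w <= g n w) ->
  \forall w \ae P, [/\ (fun n => g n w) @ \oo --> limn (g ^~ w),
    l w <= limn (g ^~ w) & forall n, limn (g ^~ w) <= g n w].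
Proof.
move=> /ae_foralln gd /ae_foralln gl; apply: filterS2 gd gl => w gd gl.
have ni : nonincreasing_seq (g ^~ w) by apply/nonincreasing_seqP => n; exact: gd.
have cg : cvgn (g ^~ w).
  by apply: nonincreasing_is_cvgn => //; exists (l w) => _ [n _ <-].
split; first exact: cg.
  by apply: limr_ge => //; exact: nearW.
by move=> n; exact: (nonincreasing_cvgn_ge ni).
Qed.

Lemma Rtt_below (Xs : nat -> process) X :
  (forall n, \forall w \ae P, forall t, Xs n.+1 t w <= Xs n t w) ->
  (forall t, \forall w \ae P, (fun n => Xs n t w) @ \oo --> X t w) ->
  forall n, \forall w \ae P, forall t, X t w <= Xs n t w.
Proof.
by move=> dec XX n; apply: filterS (decreasing_lower dec XX) => w h t; exact: h.
Qed.

Lemma pairing_cvg (Xs : nat -> process) X a (m : R) : A1 P F a ->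
  (forall n t, measurable_fun setT (Xs n t)) -> (forall t, measurable_fun setT (X t)) ->
  (forall n t, \forall w \ae P, `|Xs n t w| <= m) ->
  (forall t, \forall w \ae P, (fun n => Xs n t w) @ \oo --> X t w) ->
  (fun n => pairing P (Xs n) a) @ \oo --> pairing P X a.
Proof.
move=> Aa mXs mX Xm XX; have [aa sa] := A1_incr Aa.
have ma t : measurable_fun setT (incr a t) by case: (aa t).
rewrite pairing_mean; under eq_fun do rewrite pairing_mean.
have [|||||_ H] := @psum_dct _ _ _ P (fun n t w => Xs n t w * incr a t w)
  (fun t w => X t w * incr a t w) (fun t w => m * incr a t w); last exact: H.
- by move=> n t; apply: measurable_funM.
- by move=> t; apply: measurable_funM.
- exact: psummableZ.
- move=> n t; apply: filterS (Xm n t) => w xm; rewrite !normrM ler_wpM2r//.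
  exact: le_trans xm (ler_norm _).
- by move=> t; apply: filterS (XX t) => w xx; exact: cvgMr_tmp.
Qed.

(** Subtracting the limit of the phi (Xs n) from tau on makes all Xs n accepted,
    hence their weak limit as well. *)
Lemma closed_continuous phi : monetary_utility P F tau theta phi ->
  weakly_closed P F (C phi) -> continuous_decreasing P F tau theta phi.
Proof.
move=> mphi clC Xs X RXs RX dec XX.
have [gX lX gXE] := muf_Linfty mphi RX.
have /choice[g Hg] n : exists g, Linfty P Ft g /\ \forall w \ae P, phi (Xs n) w = (g w)%:E.
  by have [g ? ?] := muf_Linfty mphi (RXs n); exists g.
have lg n : Linfty P Ft (g n) by case: (Hg n).
have gE : \forall w \ae P, forall n, phi (Xs n) w = (g n w)%:E.
  by apply: ae_foralln => n; case: (Hg n).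
have gd n : \forall w \ae P, g n.+1 w <= g n w.
  by apply: filterS2 gE (muf_mono mphi (RXs n.+1) (RXs n) (dec n)) => w gE; rewrite !gE.
have gl n : \forall w \ae P, gX w <= g n w.
  have := muf_mono mphi RX (RXs n) (Rtt_below dec XX n).
  by apply: filterS3 gE gXE => w gE gXE; rewrite gE gXE.
have dl := decreasing_limit gd gl.
pose L w := limn (g ^~ w).
have mL : measurable_fun setT L by apply: measurable_limn => n; case: (lg n) => -[].
have lL : Linfty P Ft L.
  split.
    apply: (@asm_lim _ _ _ P Ft g) => // [n|]; first by case: (lg n).
    by apply: filterS dl => w [].
  have [_ [m0 g0m]] := lg 0%N; have [_ [mX gXm]] := lX; exists (m0 + mX).
  apply: filterS3 dl g0m gXm => w [_ l1 /(_ 0%N) l2]; rewrite -/(L w) in l1 l2 *.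
  rewrite !ler_norml => /andP[a1 a2] /andP[b1 b2]; apply/andP; split; lra.
have lLN : Linfty P Ft (fun w => 0 - L w) by exact: LinftyB.
pose Z := add_from_tau tau X (fun w => 0 - L w).
pose Zs n := add_from_tau tau (Xs n) (fun w => 0 - L w).
have RZ : Rtt Z by exact: Rtt_add_from_tau.
have RZs n : Rtt (Zs n) by exact: Rtt_add_from_tau.
have CZs n : C phi (Zs n).
  split => //; apply: filterS3 (muf_translation mphi (RXs n) lLN) gE dl => w -> -> [_ _ /(_ n)] Lg.
  by rewrite -EFinD lee_fin sub0r subr_ge0.
have inR Y : Rtt Y -> Rinfty P F Y by move=> /(RttP)[].
pose z : Rinfty P F := SigSub (mem_set (inR _ RZ)).
pose zs n : Rinfty P F := SigSub (mem_set (inR _ (RZs n))).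
have CZ : C phi Z.
  have near : \forall n \near \oo, ([set Y : Rinfty P F | C phi (val Y)] : set (weak_Rinfty P F)) (zs n).
    by apply: nearW => n; exact: CZs.
  suff cz : (zs : nat -> weak_Rinfty P F) @ \oo --> (z : weak_Rinfty P F).
    exact: (@closed_cvg _ _ _ _ (zs : nat -> weak_Rinfty P F) _ clC near _ cz).
  apply: weak_cvg => a /=.
  have [m0 m00 Xm0] := Rtt_bounded (RXs 0%N).
  have [mX mX0 XmX] := Rtt_bounded RX.
  have [_ [mL' Lm]] := lL.
  apply: (@pairing_cvg _ _ _ (m0 + mX + mL')).
  - exact: set_valP.
  - by move=> n t; exact: Rtt_measurable (RZs n).
  - by move=> t; exact: Rtt_measurable RZ.
  - move=> n t; have ch := decreasing_chain dec.
    apply: filterS3 (filterI Xm0 XmX) (filterI Lm ch) (Rtt_below dec XX n).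
    move=> w [/(_ t) x0 /(_ t) xX] [Lw /(_ t 0%N n (leq0n n)) ch0] /(_ t) Xn.
    rewrite /Zs /add_from_tau; apply: le_trans (ler_normD _ _) _; apply: lerD.
      move: x0 xX; rewrite !ler_norml => /andP[a1 a2] /andP[b1 b2].
      by apply/andP; split; lra.
    rewrite sub0r normrM normrN; case: (started w t); first by rewrite normr1 mulr1.
    by rewrite normr0 mulr0 (le_trans _ Lw).
  - move=> t; apply: filterS (XX t) => w xx; rewrite /Zs /Z /add_from_tau.
    by apply: cvgD => //; exact: cvg_cst.
have LgX : \forall w \ae P, L w <= gX w.
  apply: filterS3 CZ.2 gXE (muf_translation mphi RX lLN) => w + gw e.
  by rewrite e gw -EFinD lee_fin sub0r subr_ge0.
apply: filterS3 (filterI gE gXE) dl LgX => w [gEw gXw] [cg lg' _] Lw.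
rewrite (_ : (fun n => phi (Xs n) w) = EFin \o (g ^~ w)); last by apply/funext => n; rewrite /= gEw.
rewrite gXw; apply/cvg_EFin; first exact: nearW.
suff <- : L w = gX w by [].
by apply/eqP; rewrite eq_le Lw.
Qed.

(** * The conjugate *)

Section conjugate_penalty.
Variable phi : process -> T -> \bar R.
Hypothesis mphi : monetary_utility P F tau theta phi.
Local Notation conj := (conjugate P F tau theta phi).

Lemma muf_zero : \forall w \ae P, phi (fun _ _ => 0) w = 0%E.
Proof.
have := muf_local mphi (Rtt0) (A := set0).
have s0 : Ft set0 by case: sF.
move=> /(_ s0); rewrite (_ : (fun (t : nat) w => \1_(set0 : set T) w * 0) = fun _ _ => (0 : R)); last first.
  by apply/funext => t; apply/funext => w; rewrite mulr0.
by apply: filterS => w ->; rewrite indicE in_set0 mul0e.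
Qed.

Lemma accept0 : C phi (fun _ _ => 0).
Proof.
by split; [exact: Rtt0|apply: filterS muf_zero => w ->].
Qed.

Lemma accept_nonempty : C phi !=set0.
Proof. by exists (fun _ _ => 0); exact: accept0. Qed.

Let C0 := accept_nonempty.
Let mcp a : forall X, C phi X -> measurable_fun setT (fun w => (cp X a w)%:E).
Proof. by move=> X _; exact: cp_measurable. Qed.

Lemma conj_asm a : as_measurable P Ft (conj a).
Proof.
apply: essinf_asm; first by case: C0 => X CX; exists (fun w => (cp X a w)%:E); exists X.
by move=> _ [X _ <-]; exact: cp_easm.
Qed.

Lemma conj_measurable a : measurable_fun setT (conj a).
Proof. by case: (conj_asm a). Qed.

Lemma conj_lb X a : C phi X -> \forall w \ae P, (conj a w <= (cp X a w)%:E)%E.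
Proof. by move=> CX; have := @essinf_lb _ _ _ P _ _ C0 _ _ (mcp a) CX. Qed.

Lemma conj_le0 a : D a -> \forall w \ae P, (conj a w <= 0)%E.
Proof.
move=> Da; have b0 : \forall w \ae P, `|cp (fun _ _ => 0) a w| <= 0.
  apply: cp_bounds => //; first exact: bmeas_cst.
  by apply: aeW => w t; rewrite normr0.
apply: filterS2 (conj_lb a accept0) b0 => w cl c0; move: c0 cl.
by rewrite normr_le0 => /eqP ->.
Qed.

Lemma conj_ext a b : D a -> D b -> (\forall w \ae P, forall t, a t w = b t w) ->
  \forall w \ae P, conj a w = conj b w.
Proof.
move=> Da Db ab.
have H : \forall w \ae P, setT w -> conj a w = conj b w.
  apply: (@essinf_eq_on _ _ _ P _ _ C0 setT _ _ measurableT (mcp a) (mcp b)) => X [RX _].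
  suff : \forall w \ae P, cp X a w = cp X b w by apply: filterS => w ->.
  have sa := Dset_sum Da.
  have sb := Dset_sum Db.
  apply: cp_eq => //; try exact: bm.
  by apply: filterS ab => w e t _; case: t => [|t]; rewrite /incr !e.
by apply: filterS H => w; apply.
Qed.

Lemma incr_paste (A : set T) a b t w :
  incr (fun t w => \1_A w * a t w + \1_(~` A) w * b t w) t w =
  \1_A w * incr a t w + \1_(~` A) w * incr b t w.
Proof. by case: t => [|t] //=; ring. Qed.

Lemma cp_paste (A : set T) X a b : Ft A -> bmeas X -> D a -> D b ->
  \forall w \ae P, cp X (fun t w => \1_A w * a t w + \1_(~` A) w * b t w) w =
    \1_A w * cp X a w + \1_(~` A) w * cp X b w.
Proof.
move=> FA bX Da Db; have FAc : Ft (~` A) by exact: sigma_setC.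
have lA : Linfty P Ft (\1_A : T -> R) by exact: Linfty_indic.
have lAc : Linfty P Ft (\1_(~` A) : T -> R) by exact: Linfty_indic.
have sa := Dset_sum Da.
have sb := Dset_sum Db.
apply: (cp_comb lA lAc bX bX bX _ sa sb).
  rewrite (_ : incr _ = fun t w => \1_A w * incr a t w + \1_(~` A) w * incr b t w); last first.
    by apply/funext => t; apply/funext => w; exact: incr_paste.
  have i1 (B : set T) w : `|\1_B w : R| <= 1.
    by rewrite indicE; case: (_ \in _); rewrite ?normr1 ?normr0.
  apply: psummableD; [apply: (@psummableM _ _ _ P (fun _ => \1_A) 1) => //|
    apply: (@psummableM _ _ _ P (fun _ => \1_(~` A)) 1) => //].
  - by move=> _; case: lA => -[].
  - by move=> _; exact: aeW.
  - by move=> _; case: lAc => -[].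
  - by move=> _; exact: aeW.
by apply: aeW => w t _; rewrite incr_paste; ring.
Qed.

Lemma conj_special : special P F tau theta conj.
Proof.
move=> a b A Da Db FA; have mA := FM FA.
set c := (fun t w => \1_A w * a t w + \1_(~` A) w * b t w).
have cpc X : C phi X -> \forall w \ae P, cp X c w = \1_A w * cp X a w + \1_(~` A) w * cp X b w.
  by move=> [RX _]; apply: cp_paste => //; exact: bm.
have onA : \forall w \ae P, A w -> conj c w = conj a w.
  apply: (@essinf_eq_on _ _ _ P _ _ C0 A _ _ mA (mcp c) (mcp a)) => X CX.
  apply: filterS (cpc X CX) => w -> Aw.
  by rewrite !indicE mem_set// memNset ?mul1r ?mul0r ?addr0.
have onAc : \forall w \ae P, (~` A) w -> conj c w = conj b w.
  apply: (@essinf_eq_on _ _ _ P _ _ C0 (~` A) _ _ (measurableC mA) (mcp c) (mcp b)) => X CX.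
  apply: filterS (cpc X CX) => w -> Aw.
  by rewrite !indicE memNset// mem_set// ?mul1r ?mul0r ?add0r.
apply: filterS2 onA onAc => w; move: (conj a w) (conj b w) (conj c w) => ca cb cc oA oAc.
rewrite !indicE; have [Aw|Aw] := pselect (A w).
  by rewrite oA// mem_set// memNset ?mul1e ?mul0e ?adde0//; apply/contrapT.
by rewrite oAc// memNset// mem_set// mul1e mul0e add0e.
Qed.

(** X minus phi X from tau on is accepted. *)
Lemma conj_rep_le X a : Rtt X -> D a ->
  \forall w \ae P, (phi X w <= penalized conj X a w)%E.
Proof.
move=> RX Da; have [g lg gE] := muf_Linfty mphi RX.
have lNg : Linfty P Ft (fun w => 0 - g w) by exact: LinftyB.
pose Y := add_from_tau tau X (fun w => 0 - g w).
have RY : Rtt Y by exact: Rtt_add_from_tau.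
have CY : C phi Y.
  split => //; apply: filterS2 (muf_translation mphi RX lNg) gE => w -> ->.
  by rewrite -EFinD sub0r subrr.
have cY : \forall w \ae P, cp Y a w = 1 * cp X a w + (0 - g w).
  apply: (cp_affine Da (Lc 1) lNg (bm RY) (bm RX)).
  apply: aeW => w t /andP[st _]; by rewrite /Y /add_from_tau st mulr1 mul1r.
apply: filterS3 gE cY (conj_lb a CY) => w -> -> cl; rewrite /penalized.
have := conj_le0 Da.
move: cl; rewrite mul1r sub0r; case: (conj a w) => [r| |] //=.
  by rewrite -EFinB !lee_fin => ? _; lra.
by rewrite addey// leey.
Qed.

(** For accepted X the representation gives 0 <= <X, a> - gamma(a). *)
Lemma penalty_le_conj gamma a : penalty P F tau theta gamma ->
  representation P F tau theta phi gamma -> D a ->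
  \forall w \ae P, (gamma a w <= conj a w)%E.
Proof.
move=> pg rep Da.
have ag := penalty_meas pg Da.
apply: (@essinf_glb _ _ _ P _ _ C0 _ _ (mcp a)); first by case: ag.
move=> X [RX CX].
have mX b : D b -> measurable_fun setT (penalized gamma X b).
  exact: penalized_measurable.
have lb := @essinf_lb _ _ _ P _ _ D0 _ _ mX Da.
apply: filterS3 (filterI CX (penalty_le0 pg Da)) (rep X RX) lb => w [c0 g0] e l.
have : (0 <= penalized gamma X a w)%E by apply: le_trans l; rewrite -e.
rewrite /penalized; case: (gamma a w) g0 => [r| |] _.
- by rewrite -EFinB !lee_fin subr_ge0.
- by [].
- by rewrite leNye.
Qed.

(** The supremum of the conjugate is 0 because phi 0 = 0 is represented. *)
Lemma conj_penalty : representation P F tau theta phi conj ->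
  penalty P F tau theta conj.
Proof.
move=> rep; have mc a : D a -> measurable_fun setT (conj a) by move=> _; exact: conj_measurable.
split.
- by move=> a _; exact: conj_asm.
- by move=> a; exact: conj_le0.
- exact: conj_ext.
have [mS ubS lubS] := @esssupP _ _ _ P _ _ D0 _ mc.
have S0 : \forall w \ae P, (esssup P (conj @` D) w <= 0)%E.
  by apply: lubS => [//|_ [a Da <-]]; exact: conj_le0.
have R0' := Rtt0.
have mP a : D a -> measurable_fun setT (penalized conj (fun _ _ => 0%R) a).
  move=> _; apply: (asm_measurable (G := Ft)); apply: easmB; [exact: cp_easm|exact: conj_asm].
have : \forall w \ae P, (- esssup P (conj @` D) w <=
    essinf P (penalized conj (fun _ _ => 0%R) @` D) w)%E.
  apply: (@essinf_glb _ _ _ P _ _ D0 _ _ mP).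
    by apply: measurableT_comp => //; exact: measurable_oppe.
  move=> a Da; have b0 : \forall w \ae P, `|cp (fun _ _ => 0) a w| <= 0.
    apply: cp_bounds => //; first exact: bmeas_cst.
    by apply: aeW => w t; rewrite normr0.
  have uS : \forall w \ae P, (conj a w <= esssup P (conj @` D) w)%E by apply: ubS; exists a.
  apply: filterS2 b0 uS => w + uS; rewrite normr_le0 => /eqP c0.
  by rewrite /penalized c0 sub0e leeN2.
move=> low; apply: filterS3 S0 low (filterI (rep _ R0') muf_zero) => w s0 l [e z].
apply/eqP; rewrite eq_le s0 -leeN2 oppe0; apply: le_trans l _.
by rewrite -z e.
Qed.

End conjugate_penalty.

(** * Bounded almost sure limits of accepted processes *)

Lemma sups_ge (u : nat -> R) n (r : R) : (forall k, `|u k| <= r) -> u n <= sups u n.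
Proof.
move=> ur; apply: ub_le_sup; last by exists n => /=.
by exists r => _ [k _ <-]; exact: le_trans (ler_norm _) (ur k).
Qed.

Lemma sups_norm_le (u : nat -> R) n (r : R) : (forall k, `|u k| <= r) -> `|sups u n| <= r.
Proof.
move=> ur; rewrite ler_norml; apply/andP; split.
  by apply: le_trans (sups_ge n ur); move: (ur n); rewrite ler_norml => /andP[].
apply: ge_sup; first by exists (u n), n => /=.
by move=> _ [k _ <-]; exact: le_trans (ler_norm _) (ur k).
Qed.

Lemma asm_sups (G : set (set T)) (u : nat -> T -> R) n (r : R) :
  (forall k, as_measurable P G (u k)) -> (forall k w, `|u k w| <= r) ->
  as_measurable P G (fun w => sups (u ^~ w) n).
Proof.
move=> au ur; have ubs (v : nat -> T -> R) : (forall k w, `|v k w| <= r) ->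
    forall w, has_ubound (range (v ^~ w)).
  by move=> vr w; exists r => _ [k _ <-]; exact: le_trans (ler_norm _) (vr k w).
split.
  apply: measurable_fun_sups => [w _|k]; first exact: ubs.
  by case: (au k).
have /choice[v Hv] k : exists v, sub_measurable G v /\ \forall w \ae P, u k w = v w.
  by have [_ [v ? ?]] := au k; exists v.
(* the versions are clipped: a real supremum must be bounded at every point *)
exists (fun w => sups (fun k => v k w - excess r (v k w)) n).
  have r0 (w : T) : 0 <= r by apply: le_trans (ur 0%N w).
  apply: (@measurable_fun_sups _ (g_sigma_algebraType G) R setT
     (fun k w => v k w - excess r (v k w))) => [w _|k].
    exists r => _ [k _ <-]; apply: le_trans (ler_norm _) _; exact: excess_clip (r0 w).
  have [mv _] := Hv k; apply: measurable_funB => //.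
  apply: measurable_funB => //; apply: measurable_maxr; first exact: measurable_cst.
  by apply: measurable_minr => //; exact: measurable_cst.
have : \forall w \ae P, forall k, u k w = v k w.
  by apply: ae_foralln => k; case: (Hv k).
apply: filterS => w uv; congr (sups _ n); apply/funext => k.
by rewrite -uv excess_eq0 ?subr0.
Qed.

Lemma Rtt_lim (Xs : nat -> process) (L : process) (r : R) : (forall k, Rtt (Xs k)) ->
  (forall k t w, `|Xs k t w| <= r) -> (forall t, measurable_fun setT (L t)) ->
  (\forall w \ae P, forall t, (fun k => Xs k t w) @ \oo --> L t w) -> Rtt L.
Proof.
move=> RX Xr mL XL; apply/(RttP); split.
  split.
    move=> t; apply: (@asm_lim _ _ _ P (F t) (fun k => Xs k t)) => //.
      by move=> k; exact: Rtt_asm (RX k).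
    by apply: filterS XL => w; exact.
  exists r; apply: filterS XL => w XL t.
  apply: (@ler_cvg_to _ _ _ _ (fun k => `|Xs k t w|) (fun=> r) _ _ (cvg_norm (XL t)) (cvg_cst r)).
  by apply: nearW => k; exact: Xr.
have st : \forall w \ae P, forall k t, Xs k t w = proj (Xs k) t w.
  by apply: ae_foralln => k; exact: Rtt_stopped (RX k).
apply: filterS2 st XL => w st XL t; apply/esym/(cvg_unique _ _ (XL t)) => //.
rewrite (_ : (fun k => Xs k t w) = fun k => proj (Xs k) t w); last first.
  by apply/funext => k; exact: st.
rewrite /stopped_proj; case: ifP => _; first exact: XL.
exact: cvg_cst.
Qed.

Lemma Rtt_sups (Xs : nat -> process) n (r : R) : (forall k, Rtt (Xs k)) ->
  (forall k t w, `|Xs k t w| <= r) ->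
  Rtt (fun t w => sups (fun k => Xs k t w) n).
Proof.
move=> RX Xr; apply/(RttP); split.
  split=> [t|].
    apply: (@asm_sups _ (fun k => Xs k t) n r); last by move=> k w; exact: Xr.
    by move=> k; exact: Rtt_asm (RX k).
  by exists r; apply: aeW => w t; apply: sups_norm_le => k; exact: Xr.
have st : \forall w \ae P, forall k t, Xs k t w = proj (Xs k) t w.
  by apply: ae_foralln => k; exact: Rtt_stopped (RX k).
apply: filterS st => w st t.
rewrite (_ : (fun k => Xs k t w) = fun k => proj (Xs k) t w); last first.
  by apply/funext => k; exact: st.
rewrite /stopped_proj; case: ifP => // _.
have n0 (k : nat) : `|(0 : R)| <= 0 by rewrite normr0.
by have := sups_norm_le n n0; rewrite normr_le0 => /eqP.
Qed.

(** Continuity from above yields closedness under bounded almost sure limits: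
    the suprema of the tails decrease to the limit and dominate the sequence. *)
Lemma accept_bounded_lim phi (Xs : nat -> process) X0 (L : process) (r : R) :
  monetary_utility P F tau theta phi -> continuous_decreasing P F tau theta phi ->
  Rtt X0 -> (forall k, Rtt (Xs k)) -> (forall k t w, `|Xs k t w| <= r) -> Rtt L ->
  (\forall w \ae P, forall t, (fun k => Xs k t w) @ \oo --> L t w) ->
  (forall k, C phi (fun t w => X0 t w + Xs k t w)) ->
  C phi (fun t w => X0 t w + L t w).
Proof.
move=> mphi cont RX0 RXs Xr RL XL CX.
have RL' : Rtt (fun t w => X0 t w + L t w) by exact: Rtt_add.
split => //.
pose Y k : process := fun t w => X0 t w + sups (fun j => Xs j t w) k.
have RY k : Rtt (Y k) by apply: Rtt_add => //; exact: Rtt_sups.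
have dec k : \forall w \ae P, forall t, Y k.+1 t w <= Y k t w.
  apply: aeW => w t; rewrite lerD2l.
  apply: (nonincreasing_sups (u := fun j => Xs j t w) _ (leqnSn k)).
  by exists r => _ [j _ <-]; exact: le_trans (ler_norm _) (Xr j t w).
have YL t : \forall w \ae P, (fun k => Y k t w) @ \oo --> X0 t w + L t w.
  by apply: filterS XL => w XL; apply: cvgD; [exact: cvg_cst|exact: cvg_sups (XL t)].
have Y0 : \forall w \ae P, forall k, (0 <= phi (Y k) w)%E.
  apply: ae_foralln => k; have XY : \forall w \ae P, forall t, X0 t w + Xs k t w <= Y k t w.
    by apply: aeW => w t; rewrite lerD2l; apply: sups_ge => j; exact: Xr.
  have [RXk c0] := CX k.
  by apply: filterS2 c0 (muf_mono mphi RXk (RY k) XY) => w; exact: le_trans.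
apply: filterS2 Y0 (cont Y _ RY RL' dec YL) => w Y0 cv.
have := @cvg_lim _ _ _ _ _ _ _ cv => /(_ (@ereal_hausdorff R)) <-.
by apply: lime_ge; [apply/cvg_ex; eexists; exact: cv|exact: nearW].
Qed.

(** * The weighted mean of bounded processes *)

Local Notation S := (nat * T)%type.

Definition slice (f : S -> R) : process := fun t w => f (t, w).
(** Summable weights, carried by the active window because an element of
    R_(tau,theta) is determined by its values there. *)
Definition weight : process := fun t w => 2^-1 ^+ t * (active t w)%:R.
(** Bounded at every point rather than almost surely, since the separation
    theorem is about functions. *)
Definition bounded_slices : set (S -> R) :=
  [set f | (forall t, measurable_fun setT (slice f t)) /\ exists m : R, forall s, `|f s| <= m].
Definition weighted f : process := fun t w => slice f t w * weight t w.
Definition wmean f : R := mean P (psum (weighted f)).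

Lemma weight_ge0 t w : 0 <= weight t w.
Proof. by rewrite mulr_ge0// exprn_ge0// invr_ge0. Qed.

Lemma weight_le t w : weight t w <= 2^-1 ^+ t.
Proof.
rewrite /weight ler_piMr ?exprn_ge0 ?invr_ge0//.
by case: (active t w).
Qed.

Lemma measurable_weight t : measurable_fun setT (weight t).
Proof.
rewrite (_ : weight t = fun w => if active t w then 2^-1 ^+ t else 0).
  apply: measurable_fun_ifT; [|exact: measurable_cst|exact: measurable_cst].
  exact: (measurable_active).
by apply/funext => w; rewrite /weight; case: (active t w); rewrite ?mulr1 ?mulr0.
Qed.

Lemma half_series n : \sum_(0 <= k < n) 2^-1 ^+ k <= 2 :> R.
Proof.
suff -> : \sum_(0 <= k < n) 2^-1 ^+ k = 2 - 2 * 2^-1 ^+ n :> R.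
  by rewrite lerBlDr lerDl mulr_ge0// exprn_ge0// invr_ge0.
elim: n => [|n IH]; first by rewrite big_nil expr0 mulr1 subrr.
by rewrite big_nat_recr//= IH exprS; field.
Qed.

Lemma weight_summable : psummable P weight.
Proof.
have L1w t : L1 P (weight t).
  apply: (@L1_bounded _ _ _ P _ (2^-1 ^+ t)); first exact: measurable_weight.
  by apply: aeW => w; rewrite ger0_norm ?weight_ge0 ?weight_le.
apply: psummableP => //; exists 2 => n; apply: le_trans (half_series n).
apply: ler_sum => t _; rewrite -[leRHS](mean_cst P); apply: mean_le => //.
- exact: L1_norm.
- exact: L1_cst.
- by apply: aeW => w; rewrite ger0_norm ?weight_ge0 ?weight_le.
Qed.

Lemma weighted_summable f : bounded_slices f -> psummable P (weighted f).
Proof.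
move=> [mf [m fm]]; apply: (@psummableM _ _ _ P (slice f) m) => //; last exact: weight_summable.
by move=> t; apply: aeW => w; exact: fm.
Qed.

Lemma wmean_functional : positive_functional bounded_slices wmean.
Proof.
have Lp f : bounded_slices f -> L1 P (psum (weighted f)).
  by move=> bf; apply: L1_psum; exact: weighted_summable.
split.
- move=> f g [mf [m fm]] [mg [n gn]]; split.
    by move=> t; apply: measurable_funD; [exact: mf|exact: mg].
  exists (m + n) => s; apply: le_trans (ler_normD _ _) _; exact: lerD.
- move=> c f [mf [m fm]]; split.
    by move=> t; apply: measurable_funM => //; exact: mf.
  by exists (`|c| * m) => s; rewrite normrM ler_wpM2l.
- move=> f g [mf [m fm]] [mg [n gn]]; split.
    by move=> t; apply: measurable_funM; [exact: mf|exact: mg].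
  by exists (m * n) => s; rewrite normrM ler_pM.
- move=> f [mf [m fm]]; split; last by exists m => s; rewrite normr_id.
  by move=> t; exact: (measurableT_comp (@normr_measurable R setT) (mf t)).
- move=> f g bf bg; have sf := weighted_summable bf; have sg := weighted_summable bg.
  have -> : wmean (fun s => f s + g s) = mean P (psum (fun t w => weighted f t w + weighted g t w)).
    by congr (mean P (psum _)); apply/funext => t; apply/funext => w; rewrite /weighted mulrDl.
  rewrite /wmean -meanD; [|exact: Lp|exact: Lp].
  apply: mean_ae_eq; last exact: psumD.
    by apply: (L1_measurable (P := P)); apply: L1_psum; exact: psummableD.
  by apply: (L1_measurable (P := P)); apply: L1D; exact: Lp.
- move=> c f bf; have sf := weighted_summable bf.
  have -> : wmean (fun s => c * f s) = mean P (psum (fun t w => c * weighted f t w)).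
    by congr (mean P (psum _)); apply/funext => t; apply/funext => w; rewrite /weighted mulrA.
  rewrite /wmean -meanZ; last exact: Lp.
  apply: mean_ae_eq; last exact: (psumM (fun=> c)).
    by apply: (L1_measurable (P := P)); apply: L1_psum; exact: psummableZ.
  by apply: (L1_measurable (P := P)); apply: L1Z; exact: Lp.
- move=> f bf f0; apply: mean_ge0; first exact: Lp.
  apply: filterS (psummable_cvg (weighted_summable bf)) => w sf.
  by apply: ssum_ge0 => // t; rewrite mulr_ge0 ?weight_ge0//; exact: f0.
Qed.

Lemma wmean_one_le : wmean (fun=> 1) <= 2.
Proof.
have b1 : bounded_slices (fun=> 1).
  by split; [move=> t; exact: measurable_cst|exists 1 => s; rewrite normr1].
rewrite -(mean_cst P 2); apply: mean_le.
- by apply: L1_psum; exact: weighted_summable.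
- exact: L1_cst.
apply: filterS (psummable_cvg (weighted_summable b1)) => w /abs_summable_cvg sf.
apply: limr_le; first exact: sf.
apply: nearW => n; apply: le_trans (half_series n).
by apply: ler_sum => t _; rewrite /weighted /slice mul1r weight_le.
Qed.

Lemma bounded_excess r f : 0 <= r -> bounded_slices f -> bounded_slices (fun s => excess r (f s)).
Proof.
move=> r0 [mf [m fm]]; split.
  by move=> t; exact: (measurableT_comp (measurable_excess r) (mf t)).
by exists m => s; apply: le_trans (excess_le _ r0) _.
Qed.

(** From 2 |x| <= 2 ^ k x ^ 2 + 2 ^- k. *)
Lemma wmean_norm_sqr f k : bounded_slices f -> wmean (fun s => f s ^+ 2) <= 4^-1 ^+ k ->
  wmean (fun s => `|f s|) <= 2 * 2^-1 ^+ k.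
Proof.
move=> bf fk.
have b1 : bounded_slices (fun=> 1).
  by split; [move=> t; exact: measurable_cst|exists 1 => s; rewrite normr1].
have PF := wmean_functional; have b2 := pf_memX2 PF bf.
have bz := pf_memZ PF.
pose c : R := 2 ^+ k; have c0 : 0 < c by rewrite exprn_gt0.
have cE : 2^-1 ^+ k = c^-1 by rewrite exprVn.
have c4 : 4^-1 ^+ k = c^-1 * c^-1.
  by rewrite -cE -exprMn; congr (_ ^+ k); field.
apply: le_trans (_ : wmean (fun s => (c / 2) * f s ^+ 2 + (c^-1 / 2) * 1) <= _).
  apply: (pf_le PF); [exact: (pf_memN PF)|by apply: (pf_memD PF); exact: bz|].
  move=> s; rewrite -(real_normK (num_real (f s))); set x := `|f s|.
  rewrite -subr_ge0.
  have -> : c / 2 * x ^+ 2 + c^-1 / 2 * 1 - x = (c * x - 1) ^+ 2 * (c^-1 / 2).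
    by field; rewrite gt_eqF.
  by rewrite mulr_ge0 ?sqr_ge0// divr_ge0// invr_ge0 ltW.
rewrite (pf_D PF); [|exact: bz|exact: bz].
rewrite !(pf_Z PF)//; have := wmean_one_le; rewrite cE.
move: fk; rewrite c4; set A := wmean _; set B := wmean _ => fk B2.
have i0 : 0 < c^-1 by rewrite invr_gt0.
have : c / 2 * A <= c / 2 * (c^-1 * c^-1) by rewrite ler_pM2l// divr_gt0.
have -> : c / 2 * (c^-1 * c^-1) = c^-1 / 2 by field; rewrite gt_eqF.
have : c^-1 / 2 * B <= c^-1 / 2 * 2 by rewrite ler_pM2l// divr_gt0.
have -> : c^-1 / 2 * 2 = c^-1 by field; rewrite gt_eqF.
by move=> h1 h2; lra.
Qed.

Lemma slice_mean_le f t : bounded_slices f ->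
  mean P (fun w => (active t w)%:R * `|f (t, w)|) <= 2 ^+ t * wmean (fun s => `|f s|).
Proof.
move=> bf; have bN := pf_memN wmean_functional bf.
have sN := weighted_summable bN.
rewrite /wmean mean_psum//.
have ge s : 0 <= mean P (weighted (fun s => `|f s|) s).
  apply: mean_ge0; first exact: psummable_L1.
  by apply: aeW => w; rewrite mulr_ge0 ?weight_ge0// /slice.
have sm : abs_summable (fun s => mean P (weighted (fun s => `|f s|) s)).
  apply: abs_summableW (psummable_mean sN) => s.
  by apply: le_trans (ler_norm _); apply: mean_norm_le; exact: psummable_L1.
have := ssum_ge_term t sm ge.
have -> : mean P (weighted (fun s => `|f s|) t) =
    2^-1 ^+ t * mean P (fun w => (active t w)%:R * `|f (t, w)|).
  rewrite -meanZ; first by congr (mean P); apply/funext => w; rewrite /weighted /weight /slice; ring.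
  have -> : (fun w => (active t w)%:R * `|f (t, w)|) =
      (fun w => 2 ^+ t * weighted (fun s => `|f s|) t w).
    apply/funext => w; rewrite /weighted /weight /slice exprVn.
    by field; rewrite expf_neq0.
  by apply: L1Z; exact: psummable_L1.
set x := mean P _; set y := ssum _ => h.
have : 2 ^+ t * (2^-1 ^+ t * x) <= 2 ^+ t * y by rewrite ler_pM2l// exprn_gt0.
by rewrite mulrA -exprMn divff// expr1n mul1r.
Qed.

(** * Pairings with countable combinations *)

Local Notation V := bounded_slices.
Let PF : positive_functional V wmean. Proof. exact: wmean_functional. Qed.

Lemma V_cst (c : R) : V (fun=> c).
Proof.
by split; [move=> t; exact: measurable_cst|exists `|c|].
Qed.

Lemma ssum0 : ssum (fun _ : nat => 0) = 0 :> R.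
Proof. by rewrite (ssum_at (t := 0%N)). Qed.

Lemma ssum_sum (c : nat -> nat -> R) N : (forall t, abs_summable (c ^~ t)) ->
  abs_summable (fun n => \sum_(0 <= t < N) c n t) /\
  \sum_(0 <= t < N) ssum (c ^~ t) = ssum (fun n => \sum_(0 <= t < N) c n t).
Proof.
move=> sc; elim: N => [|N [IH1 IH2]].
  have -> : (fun n => \sum_(0 <= t < 0) c n t) = fun _ : nat => 0.
    by apply/funext => n; rewrite big_nil.
  rewrite big_nil ssum0; split => //.
  by rewrite -[abs_summable _]/(cvgn (series _)); apply/cvg_ex; exists 0; apply: cvg_near_cst; apply: nearW => n; rewrite /series/= big1// => ? _; rewrite normr0.
have -> : (fun n => \sum_(0 <= t < N.+1) c n t) = fun n => \sum_(0 <= t < N) c n t + c n N.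
  by apply/funext => n; rewrite big_nat_recr.
by rewrite big_nat_recr// IH2 ssumD//; split => //; exact: abs_summableD.
Qed.

Section combination.
Variables (Z : nat -> S -> R) (c : nat -> R) (B : R).
Hypothesis VZ : forall n, V (Z n).
Hypothesis cZ : forall n, `|c n| * wmean (fun s => `|Z n s|) <= B * 2^-1 ^+ n.

Definition combination : process := fun t w => ssum (fun n => c n * weighted (Z n) t w).
Definition majorant : process := fun t w => ssum (fun n => `|c n * weighted (Z n) t w|).

Let mW n t : measurable_fun setT (weighted (Z n) t).
Proof. by case: (weighted_summable (VZ n)). Qed.

Let mcW n t : measurable_fun setT (fun w => c n * weighted (Z n) t w).
Proof. exact: measurable_funM. Qed.

Let sW n : psummable P (fun t w => c n * weighted (Z n) t w).
Proof. by apply: psummableZ; exact: (weighted_summable (VZ n)). Qed.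

Let mean_terms n : ssum (fun t => mean P (fun w => `|c n * weighted (Z n) t w|)) <= B * 2^-1 ^+ n.
Proof.
apply: le_trans (cZ n); rewrite /wmean -meanZ; last first.
  by apply: L1_psum; apply: (weighted_summable); exact: (pf_memN PF).
have sN := weighted_summable (pf_memN PF (VZ n)).
have sN' := psummableZ `|c n| sN.
rewrite le_eqVlt; apply/orP; left; apply/eqP.
rewrite -[LHS](_ : mean P (psum (fun t w => `|c n| * weighted (fun s => `|Z n s|) t w)) = _).
  apply: mean_ae_eq; last exact: (psumM (fun=> `|c n|)).
    by apply: (L1_measurable (P := P)); exact: L1_psum.
  by apply: (L1_measurable (P := P)); apply: L1Z; exact: L1_psum.
rewrite mean_psum//; congr ssum; apply/funext => t; congr (mean P); apply/funext => w.
have w0 : `|weight t w| = weight t w by rewrite ger0_norm// weight_ge0.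
by rewrite /weighted /slice normrM [in RHS]normrM w0.
Qed.

Lemma summable_in_index t : psummable P (fun n w => c n * weighted (Z n) t w).
Proof.
apply: psummableP; first by move=> n; exact: psummable_L1 t (sW n).
exists (B * 2) => N.
apply: le_trans (_ : \sum_(0 <= n < N) B * 2^-1 ^+ n <= _); last first.
  rewrite -mulr_sumr ler_wpM2l ?half_series//.
  have := cZ 0%N; rewrite expr0 mulr1; apply: le_trans; rewrite mulr_ge0//.
  apply: (pf_ge0 PF) => //; exact: (pf_memN PF).
apply: ler_sum => n _; apply: le_trans (mean_terms n).
apply: (ssum_ge_term t (b := fun t => mean P (fun w => `|c n * weighted (Z n) t w|))).
  exact: psummable_mean.
by move=> s; apply: Rintegral_ge0.
Qed.

(** Tonelli: the double sum of mean absolute values is finite in one order by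
    hypothesis, and is needed in the other one. *)
Lemma majorant_summable : psummable P majorant.
Proof.
have sm t := psummable_normL1 (summable_in_index t).
apply: psummableP => //.
pose e n t := mean P (fun w => `|c n * weighted (Z n) t w|).
have se t : abs_summable (e ^~ t) by exact: psummable_mean (summable_in_index t).
exists (ssum (fun n => B * 2^-1 ^+ n)) => N.
have -> : \sum_(0 <= t < N) mean P (fun w => `|majorant t w|) = \sum_(0 <= t < N) ssum (e ^~ t).
  apply: eq_bigr => t _.
  have sN : psummable P (fun n w => `|c n * weighted (Z n) t w|).
    apply: (psummable_le (f := fun n w => c n * weighted (Z n) t w)).
    - by move=> n; exact: (measurableT_comp (@normr_measurable R setT) (mcW n t)).
    - by move=> n; apply: aeW => w; rewrite normr_id.
    - exact: summable_in_index.
  rewrite -(mean_psum sN); apply: mean_ae_eq.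
  - exact: (measurableT_comp (@normr_measurable R setT) (L1_measurable (sm t))).
  - by apply: measurable_psum; case: sN.
  - apply: filterS (psummable_cvg sN) => w sw; rewrite ger0_norm//.
    by apply: ssum_ge0.
have [s1 ->] := ssum_sum N se.
have [s2 _] : abs_summable (fun n => B * 2^-1 ^+ n) /\ True.
  split => //; apply: geom_bounded_summable; exists `|B| => n.
  by rewrite normrM [`|2^-1 ^+ n|]ger0_norm// exprn_ge0// invr_ge0.
apply: ssum_le => // n; apply: le_trans (mean_terms n).
apply: partial_sum_le; first by move=> t; apply: Rintegral_ge0.
by apply: abs_summable_cvg; exact: psummable_mean.
Qed.

Lemma combination_summable : psummable P combination.
Proof.
apply: (psummable_le (f := majorant)).
- by move=> t; apply: (measurable_psum (f := fun n w => c n * weighted (Z n) t w)).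
- move=> t; apply: filterS (psum_norm_le (summable_in_index t)) => w h.
  exact: le_trans h (ler_norm _).
- exact: majorant_summable.
Qed.

(** Dominated convergence of the partial sums in n, with the majorant as bound. *)
Lemma combination_pairing (X : S -> R) : V X ->
  mean P (psum (fun t w => slice X t w * combination t w)) =
  ssum (fun n => c n * wmean (fun s => X s * Z n s)).
Proof.
move=> VX; have [mX [m Xm]] := VX.
pose u N : process := fun t w => slice X t w * \sum_(0 <= n < N) c n * weighted (Z n) t w.
have mu N t : measurable_fun setT (u N t).
  by apply: measurable_funM => //; apply: measurable_sum => n.
have uE N : mean P (psum (u N)) = \sum_(0 <= n < N) c n * wmean (fun s => X s * Z n s).
  have Vs : V (fun s => \sum_(0 <= n < N) c n * (X s * Z n s)).
    elim: N => [|N IH].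
      by under eq_fun do rewrite big_nil; exact: V_cst.
    under eq_fun do rewrite big_nat_recr//=.
    by apply: (pf_memD PF) => //; apply: (pf_memZ PF); exact: (pf_memM PF).
  transitivity (wmean (fun s => \sum_(0 <= n < N) c n * (X s * Z n s))).
    congr (mean P (psum _)); apply/funext => t; apply/funext => w.
    rewrite /u /weighted /slice mulr_sumr mulr_suml; apply: eq_bigr => n _; ring.
  elim: N {Vs} => [|N IH].
    under eq_fun do rewrite big_nil; rewrite big_nil.
    rewrite -[RHS](mul0r (wmean (fun=> 1))) -(pf_Z PF 0 (V_cst 1)); congr wmean.
    by apply/funext => s; rewrite mul0r.
  rewrite big_nat_recr//= -IH.
  have V1 M : V (fun s => \sum_(0 <= n < M) c n * (X s * Z n s)).
    elim: M => [|M IHM].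
      by under eq_fun do rewrite big_nil; exact: V_cst.
    under eq_fun do rewrite big_nat_recr//=.
    by apply: (pf_memD PF) => //; apply: (pf_memZ PF); exact: (pf_memM PF).
  have V2 : V (fun s => X s * Z N s) by exact: (pf_memM PF).
  rewrite -(pf_Z PF)// -(pf_D PF)//; last exact: (pf_memZ PF).
  by congr wmean; apply/funext => s; rewrite big_nat_recr.
have [|||||_ H] := @psum_dct _ _ _ P u (fun t w => slice X t w * combination t w)
    (fun t w => m * majorant t w).
- exact: mu.
- by move=> t; apply: measurable_funM => //; case: combination_summable.
- by apply: psummableZ; exact: majorant_summable.
- move=> N t; apply: filterS (psummable_cvg (summable_in_index t)) => w sw.
  rewrite /u !normrM; apply: ler_pM => //.
    exact: le_trans (Xm _) (ler_norm _).
  apply: le_trans (ler_norm _); apply: le_trans (ler_norm_sum _ _ _) _.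
  exact: partial_sum_le.
- move=> t; apply: filterS (psummable_cvg (summable_in_index t)) => w /abs_summable_cvg sw.
  by apply: cvgMl_tmp; exact: sw.
rewrite -(cvg_lim (@Rhausdorff R) H); congr (lim (_ @ \oo)).
by apply/funext => N; exact: uE.
Qed.

End combination.

(** * Separating accepted processes from a rejected one *)

Section concave_continuous.
Variable phi : process -> T -> \bar R.
Hypothesis cphi : concave_monetary_utility P F tau theta phi.
Hypothesis cont : continuous_decreasing P F tau theta phi.
Let mphi : monetary_utility P F tau theta phi. Proof. exact: cmuf_monetary cphi. Qed.
Local Notation conj := (conjugate P F tau theta phi).
Let C0 : C phi (fun _ _ => 0). Proof. exact: accept0. Qed.

Lemma accept_le X Y : C phi X -> Rtt Y -> (\forall w \ae P, forall t, X t w <= Y t w) ->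
  C phi Y.
Proof.
move=> [RX X0] RY XY; split => //.
by apply: filterS2 X0 (muf_mono mphi RX RY XY) => w; exact: le_trans.
Qed.

(** Shifting by X0 moves the rejected process to the origin. *)
Definition accepted_shifts X0 : set (S -> R) :=
  [set f | [/\ V f, Rtt (slice f) & C phi (fun t w => X0 t w + slice f t w)]].
Local Notation K := accepted_shifts.

Lemma active_stop t w : time_le (tau w) (theta w) -> started w t ->
  active (time_min t (theta w)) w.
Proof.
rewrite /active_at /time_min; case: (tau w) => [k|]//; case: (theta w) => [n|]//=.
  by move=> kn kt; rewrite leq_min kt kn geq_minr.
by move=> _ ->.
Qed.

(** The mean distances of consecutive terms are summable at every time of the
    active window; outside it, stopping carries the convergence over. *)
Lemma slices_cvg (Xs : nat -> S -> R) : (forall k, V (Xs k)) ->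
  (forall k, Rtt (slice (Xs k))) ->
  (forall k, wmean (fun s => (Xs k.+1 s - Xs k s) ^+ 2) <= 4^-1 ^+ k) ->
  \forall w \ae P, forall t, cvgn (fun k => Xs k (t, w)).
Proof.
move=> VX RX cX.
have act : \forall w \ae P, forall t, active t w -> cvgn (fun k => Xs k (t, w)).
  apply: ae_foralln => t.
  pose u k w := (active t w)%:R * Xs k (t, w).
  have ma := measurable_active t.
  have Lu k : L1 P (u k).
    have [mX [m Xm]] := VX k.
    rewrite (_ : u k = fun w => if active t w then Xs k (t, w) else 0); last first.
      by apply/funext => w; rewrite /u; case: (active t w); rewrite ?mul1r ?mul0r.
    apply: (@L1_bounded _ _ _ P _ `|m|).
      by apply: measurable_fun_ifT => //; exact: mX.
    apply: aeW => w; case: (active t w); last by rewrite normr0.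
    exact: le_trans (Xm _) (ler_norm _).
  have [|h [_ uh _]] := L1_cauchy_cvg Lu.
    exists (2 ^+ t * 2 * 2) => n.
    apply: le_trans (_ : \sum_(0 <= k < n) 2 ^+ t * 2 * 2^-1 ^+ k <= _); last first.
      by rewrite -mulr_sumr ler_pM2l ?half_series// mulr_gt0// exprn_gt0.
    apply: ler_sum => k _.
    have VD : V (fun s => Xs k.+1 s - Xs k s) by exact: (pf_memB PF).
    have := slice_mean_le t VD.
    have := wmean_norm_sqr VD (cX k).
    rewrite (_ : mean P (fun w => `|_|) = mean P (fun w => (active t w)%:R * `|Xs k.+1 (t, w) - Xs k (t, w)|)); last first.
      congr (mean P); apply/funext => w; rewrite /u -mulrBr normrM.
      by case: (active t w); rewrite ?normr1 ?normr0.
    move=> h1 h2; apply: le_trans h2 _; rewrite -mulrA ler_pM2l// exprn_gt0//.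
  apply: filterS uh => w uh a; apply/cvg_ex; exists (h w).
  rewrite (_ : (fun k => Xs k (t, w)) = u ^~ w)//.
  by apply/funext => k; rewrite /u a mul1r.
have st : \forall w \ae P, forall k t, slice (Xs k) t w = proj (slice (Xs k)) t w.
  by apply: ae_foralln => k; exact: Rtt_stopped (RX k).
apply: filterS3 htau_theta act st => w tt act st t.
rewrite (_ : (fun k => Xs k (t, w)) = fun k => proj (slice (Xs k)) t w); last first.
  by apply/funext => k; exact: st.
rewrite /stopped_proj; have [sw|_] := boolP (started w t); last exact: is_cvg_cst.
by apply: act; exact: active_stop.
Qed.

Lemma stopped_active_eq0 X : Rtt X -> (forall t, \forall w \ae P, active t w -> X t w = 0) ->
  \forall w \ae P, forall t, X t w = 0.
Proof.
move=> RX /ae_foralln X0; apply: filterS3 (Rtt_stopped RX) htau_theta X0 => w sX tt X0 t.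
rewrite sX /stopped_proj; case: ifP => // sw; apply: X0; exact: active_stop.
Qed.

(** The closedness that the separation theorem asks for. The sequence converges
    almost surely, its limit is accepted by continuity from above, and clipping
    the limit at r changes it on a null set only. *)
Lemma accepted_shifts_closed X0 (r r' : R) (Xs : nat -> S -> R) :
  Rtt X0 -> 0 < r ->
  (forall k, K X0 (Xs k)) -> (forall k s, `|Xs k s| <= r') ->
  (forall k, wmean (fun s => (Xs k.+1 s - Xs k s) ^+ 2) <= 4^-1 ^+ k) ->
  (forall k, wmean (fun s => excess r (Xs k s) ^+ 2) <= 2^-1 ^+ k) ->
  exists X : S -> R, [/\ K X0 X, forall s, `|X s| <= r &
    (fun k => wmean (fun s => `|Xs k s - X s|)) @ \oo --> (0 : R)].
Proof.
move=> RX0 r0 KX Xr cX eX.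
have VX k : V (Xs k) by case: (KX k).
have RX k : Rtt (slice (Xs k)) by case: (KX k).
have cv := slices_cvg VX RX cX.
pose L : process := fun t w => limn (fun k => Xs k (t, w)).
have mX k t : measurable_fun setT (slice (Xs k) t) by case: (VX k).
have mL t : measurable_fun setT (L t).
  by apply: measurable_limn => k; exact: mX.
have cvL : \forall w \ae P, forall t, (fun k => Xs k (t, w)) @ \oo --> L t w.
  by apply: filterS cv => w cv t; exact: cv.
have RL : Rtt L by apply: (Rtt_lim RX _ mL cvL) => k t w; exact: Xr.
have Re : Rtt (fun t w => excess r (L t w)) by apply: Rtt_excess => //; exact: ltW.
have ex0 t : \forall w \ae P, active t w -> excess r (L t w) = 0.
  have Ve k : V (fun s => excess r (Xs k s) ^+ 2).
    by apply: (pf_memX2 PF); apply: bounded_excess => //; exact: ltW.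
  pose u k w := (active t w)%:R * excess r (Xs k (t, w)) ^+ 2.
  pose f w := (active t w)%:R * excess r (L t w) ^+ 2.
  have mact : measurable_fun setT (fun w => (active t w)%:R : R).
    rewrite (_ : (fun w => _) = fun w => if active t w then 1 else 0); last first.
      by apply/funext => w; case: (active t w).
    apply: measurable_fun_ifT; [|exact: measurable_cst|exact: measurable_cst].
    exact: (measurable_active).
  have me (g : T -> R) : measurable_fun setT g -> measurable_fun setT (fun w => excess r (g w) ^+ 2).
    by move=> mg; apply: measurable_funX; exact: (measurableT_comp (measurable_excess r) mg).
  have mf : measurable_fun setT f by apply: measurable_funM => //; exact: me.
  have [|||||Lf _ mu] := @mean_dct _ _ _ P u f (fun=> r' ^+ 2).
  - by move=> k; apply: measurable_funM => //; exact: (me _ (mX k t)).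
  - exact: mf.
  - exact: L1_cst.
  - move=> k; apply: aeW => w; rewrite /u; case: (active t w); last first.
      by rewrite mul0r normr0 sqr_ge0.
    rewrite mul1r normrX; apply: lerXn2r; rewrite ?nnegrE//.
      exact: le_trans (normr_ge0 _) (Xr k (t, w)).
    by apply: le_trans (excess_le _ (ltW r0)) _; exact: Xr.
  - apply: filterS cvL => w cvL; apply: cvgMl_tmp.
    have ce : (fun k => excess r (Xs k (t, w))) @ \oo --> excess r (L t w).
      exact: (continuous_cvg _ (@continuous_excess R r _) (cvL t)).
    rewrite expr2; under eq_fun do rewrite expr2.
    exact: cvgM.
  have f0 : mean P f <= 0.
    rewrite -(cvg_lim (@Rhausdorff R) mu).
    have g0 : (fun k => 2 ^+ t * 2^-1 ^+ k) @ \oo --> (0 : R).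
      by apply: cvg_geometric; rewrite ger0_norm//; lra.
    rewrite -(cvg_lim (@Rhausdorff R) g0); apply: ler_lim.
    + by apply/cvg_ex; eexists; exact: mu.
    + by apply/cvg_ex; eexists; exact: g0.
    apply: nearW => k; have := slice_mean_le t (Ve k).
    have nE x : `|excess r x ^+ 2| = excess r x ^+ 2 :> R by rewrite ger0_norm// sqr_ge0.
    under eq_fun do rewrite nE.
    rewrite (_ : (fun s => `|_|) = fun s => excess r (Xs k s) ^+ 2); last first.
      by apply/funext => s; exact: nE.
    move=> h; apply: le_trans h _; rewrite ler_pM2l// exprn_gt0//.
  have f0' : \forall w \ae P, f w = 0.
    by apply: mean_eq0 => //; apply: aeW => w; rewrite /f mulr_ge0// sqr_ge0.
  apply: filterS f0' => w + a; rewrite /f a mul1r => /eqP.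
  by rewrite expf_eq0/= => /eqP.
have e0 := stopped_active_eq0 Re ex0.
pose X : S -> R := fun s => L s.1 s.2 - excess r (L s.1 s.2).
have XL : \forall w \ae P, forall t, L t w = slice X t w.
  by apply: filterS e0 => w e0 t; rewrite /slice /X /= e0 subr0.
have mXX t : measurable_fun setT (slice X t).
  apply: (@measurable_funB _ _ _ _ (L t) (fun w => excess r (L t w))) => //.
  exact: (measurableT_comp (measurable_excess r) (mL t)).
have Xn s : `|X s| <= r by apply: excess_clip; exact: ltW.
have VXX : V X by split => //; exists r.
have RXX : Rtt (slice X)  by exact: Rtt_ae RL mXX XL.
have cvX : \forall w \ae P, forall t, (fun k => slice (Xs k) t w) @ \oo --> slice X t w.
  by apply: filterS2 cvL XL => w cvL XL t; rewrite -XL; exact: cvL.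
exists X; split => //.
  split => //; apply: (accept_bounded_lim mphi cont RX0 RX _ RXX cvX).
    by move=> k t w; exact: Xr.
  by move=> k; case: (KX k).
have VD k : V (fun s => `|Xs k s - X s|) by apply: (pf_memN PF); exact: (pf_memB PF).
have [|||||_ H] := @psum_dct _ _ _ P (fun k => weighted (fun s => `|Xs k s - X s|))
    (fun _ _ => 0) (fun t w => (`|r'| + r) * weight t w).
- by move=> k t; case: (weighted_summable (VD k)).
- by move=> t; exact: measurable_cst.
- by apply: psummableZ; exact: (weight_summable).
- move=> k t; apply: aeW => w; rewrite /weighted !normrM ler_wpM2r// /slice normr_id.
  rewrite (ger0_norm (addr_ge0 (normr_ge0 r') (ltW r0))); apply: le_trans (ler_normB _ _) _; apply: lerD => //.
  exact: le_trans (Xr _ _) (ler_norm _).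
- move=> t; apply: filterS cvX => w /(_ t) cX'.
  rewrite -(mul0r (weight t w)); apply: cvgMr_tmp.
  rewrite -(@normr0 _ R) -(subrr (slice X t w)).
  by apply: cvg_norm; apply: cvgB => //; exact: cvg_cst.
have -> : (0 : R) = mean P (psum (fun (_ : nat) (_ : T) => 0)).
  rewrite -[LHS](mean_cst P); congr (mean P); apply/funext => w.
  by rewrite /psum (ssum_at (t := 0%N)).
exact: H.
Qed.

Lemma summable_pairing X (z : process) : psummable P z -> bmeas X ->
  psummable P (fun t w => X t w * z t w).
Proof.
move=> sz [mX [m Xm]]; apply: (@psummableM _ _ _ P X m) => //.
by move=> t; apply: filterS Xm.
Qed.

(** Clipping makes an almost sure bound hold everywhere. *)
Lemma shift_mem X0 Y : Rtt X0 -> C phi Y ->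
  exists2 f, K X0 f & \forall w \ae P, forall t, slice f t w = Y t w - X0 t w.
Proof.
move=> RX0 CY; have [RY _] := CY.
have RU : Rtt (fun t w => 1 * Y t w + -1 * X0 t w) by exact: Rtt_comb.
have [m m0 Um] := Rtt_bounded RU.
pose f (s : S) : R := let u := 1 * Y s.1 s.2 + -1 * X0 s.1 s.2 in u - excess m u.
have fE : \forall w \ae P, forall t, 1 * Y t w + -1 * X0 t w = slice f t w.
  by apply: filterS Um => w Um t; rewrite /slice /f /= excess_eq0 ?subr0.
have mf t : measurable_fun setT (slice f t).
  have mU := Rtt_measurable t RU.
  apply: (@measurable_funB _ _ _ _ (fun w => 1 * Y t w + -1 * X0 t w)
    (fun w => excess m (1 * Y t w + -1 * X0 t w))) => //.
  exact: (measurableT_comp (measurable_excess m) mU).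
have Rf : Rtt (slice f) by exact: Rtt_ae RU mf fE.
have fY : \forall w \ae P, forall t, slice f t w = Y t w - X0 t w.
  by apply: filterS fE => w fE t; rewrite -fE mul1r mulN1r.
exists f => //; split => //.
  by split => //; exists m => s; exact: excess_clip.
apply: (accept_le CY); first exact: Rtt_add.
by apply: filterS fY => w fY t; rewrite fY addrC subrK.
Qed.

Lemma shifts_convex X0 : Rtt X0 -> convex_functions (K X0).
Proof.
move=> RX0 f g l [Vf Rf Cf] [Vg Rg Cg] /andP[l0 l1].
have VV : V (fun s => f s + l * (g s - f s)).
  by apply: (pf_memD PF) => //; apply: (pf_memZ PF); exact: (pf_memB PF).
have RR : Rtt (slice (fun s => f s + l * (g s - f s))).
  rewrite (_ : slice _ = fun t w => (1 - l) * slice f t w + l * slice g t w).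
    by apply: Rtt_comb.
  by apply/funext => t; apply/funext => w; rewrite /slice; ring.
split => //; split; first exact: Rtt_add.
have [RF F0] := Cf; have [RG G0] := Cg.
have := cmuf_concave cphi RG RF (Lc l).
rewrite (_ : (fun t w => l * _ + _) =
   fun t w => X0 t w + slice (fun s => f s + l * (g s - f s)) t w); last first.
  by apply/funext => t; apply/funext => w; rewrite /slice; ring.
have l01 : \forall w \ae P, 0 <= l <= 1 by apply: aeW => w; rewrite l0.
move=> /(_ l01); apply: filterS3 F0 G0 => w F0 G0; apply: le_trans.
by apply: adde_ge0; apply: mule_ge0; rewrite // lee_fin ?subr_ge0.
Qed.

(** If f <= e / 2, then X0 + e / 2 is accepted, so that phi X0 >= - e / 2. *)
Lemma shifts_not_small X0 (e : R) : Rtt X0 -> 0 < e ->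
  ~ (\forall w \ae P, ((- e)%:E < phi X0 w)%E) ->
  forall f, K X0 f -> ~ (forall s, `|f s| <= e / 2).
Proof.
move=> RX0 e0 nX0 f [_ Rf [RXf Xf0]] fe; apply: nX0.
have [g lg gE] := muf_Linfty mphi RX0.
have RY : Rtt (add_from_tau tau X0 (fun=> e / 2)) by exact: Rtt_add_from_tau.
have le : \forall w \ae P, forall t, X0 t w + slice f t w <= add_from_tau tau X0 (fun=> e / 2) t w.
  apply: filterS (Rtt_off Rf) => w off t.
  rewrite /add_from_tau lerD2l; case: (boolP (started w t)) => [_|/off ->]; last by rewrite mulr0.
  by rewrite mulr1; exact: le_trans (ler_norm _) (fe _).
apply: filterS3 (filterI Xf0 gE) (muf_mono mphi RXf RY le) (muf_translation mphi RX0 (Lc (e / 2))).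
move=> w [x0 ->] + te; rewrite te => /(le_trans x0).
by rewrite -EFinD lee_fin lte_fin => h; lra.
Qed.

(** The separating functionals are excesses of elements of K, hence adapted
    processes, and so is their weighted sum: the separation takes place in A1. *)
Theorem separating_increments X0 (e : R) : Rtt X0 -> 0 < e ->
  ~ (\forall w \ae P, ((- e)%:E < phi X0 w)%E) ->
  exists z : process, [/\ forall t, as_measurable P (F t) (z t), psummable P z,
    \forall w \ae P, forall t, ~~ active t w -> z t w = 0
    & forall Y, C phi Y -> mean P (psum (fun t w => X0 t w * z t w)) + 1 <=
        mean P (psum (fun t w => Y t w * z t w))].
Proof.
move=> RX0 e0 nX0.
have [Z [c [ZE [B cZ] sep]]] : exists (Z : nat -> S -> R) (c : nat -> R),
   [/\ forall n, exists r f, [/\ 0 <= r, K X0 f & Z n = (fun s => excess r (f s))],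
   exists B : R, forall n, `|c n| * wmean (fun s => `|Z n s|) <= B * 2^-1 ^+ n &
   forall f, K X0 f -> 1 <= ssum (fun n => c n * wmean (fun s => f s * Z n s))].
  have Vb (f : S -> R) : V f -> exists m : R, forall s, `|f s| <= m by move=> [].
  have Ve (r : R) (f : S -> R) : 0 <= r -> V f -> V (fun s => excess r (f s)) by exact: bounded_excess.
  apply: (krein_smulian_separation PF (V_cst 1) Vb Ve (r0 := e / 2)).
  - by rewrite divr_gt0.
  - by move=> f [].
  - by have [f Kf _] := shift_mem RX0 C0; exists f.
  - exact: shifts_convex.
  - by move=> r r' Xs r0 KX Xr cX eX; apply: (accepted_shifts_closed RX0 r0 KX Xr cX eX).
  - exact: shifts_not_small nX0.
have VZ n : V (Z n).
  by have [r [f [r0 [Vf _ _] ->]]] := ZE n; exact: bounded_excess.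
have RZ n : Rtt (slice (Z n)).
  have [r [f [r0 [_ Rf _] ->]]] := ZE n.
  exact: (Rtt_excess r0 Rf).
have sz := combination_summable VZ cZ.
exists (combination Z c); split => //.
- move=> t; apply: (asm_ssum (u := fun n w => c n * weighted (Z n) t w)) => n.
  have FtM := filtration_sub (t := t).
  apply: asmZ => //; apply: asmM; first exact: Rtt_asm (RZ n).
  apply: asmZ => //; under eq_fun do rewrite -indic_bool.
  exact: (asm_indic _ FtM (active_set t)).
- apply: aeW => w t na; rewrite /combination -[RHS](ssum0); congr ssum; apply/funext => n.
  by rewrite /weighted /weight (negbTE na) !mulr0.
move=> Y CY; have [f Kf fE] := shift_mem RX0 CY; have [RY _] := CY.
have [Vf Rf _] := Kf.
have := sep f Kf; rewrite -(combination_pairing VZ cZ Vf).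
have sY := summable_pairing sz (bm RY); have sX := summable_pairing sz (bm RX0).
rewrite (_ : mean P (psum (fun t w => slice f t w * _)) =
    mean P (psum (fun t w => Y t w * combination Z c t w)) -
    mean P (psum (fun t w => X0 t w * combination Z c t w))).
  by rewrite lerBrDr addrC.
apply/eqP; rewrite eq_sym subr_eq; apply/eqP.
rewrite -meanD; [|by apply: L1_psum; exact: (summable_pairing sz (bm Rf))|exact: L1_psum].
apply: mean_ae_eq; [by apply: measurable_psum; case: sY| |].
  by apply: measurable_funD; apply: measurable_psum; [case: (summable_pairing sz (bm Rf))|case: sX].
have := psumD (summable_pairing sz (bm Rf)) sX.
apply: filterS2 fE => w fE <-; rewrite /psum; congr ssum; apply/funext => t.
by rewrite -mulrDl fE subrK.
Qed.

(** Multiples of a nonnegative process are accepted, so their pairings, being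
    bounded below, are nonnegative. The process tested is the indicator of
    {z t < 0} at time t. *)
Lemma increments_ge0 (z : process) (k : R) : (forall t, as_measurable P (F t) (z t)) ->
  psummable P z -> (\forall w \ae P, forall t, ~~ active t w -> z t w = 0) ->
  (forall Y, C phi Y -> k <= mean P (psum (fun t w => Y t w * z t w))) ->
  \forall w \ae P, forall t, 0 <= z t w.
Proof.
move=> az sz off bound.
have pos Q : Rtt Q -> (\forall w \ae P, forall t, 0 <= Q t w) ->
    0 <= mean P (psum (fun t w => Q t w * z t w)).
  move=> RQ Q0; set q := mean _ _; rewrite leNgt; apply/negP => q0.
  pose l := (`|k| + 1) / - q.
  have l0 : 0 <= l by rewrite divr_ge0// ?addr_ge0// oppr_ge0 ltW.
  have RlQ : Rtt (fun t w => l * Q t w) by apply: Rtt_scale.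
  have CQ : C phi (fun t w => l * Q t w).
    apply: (accept_le C0) => //.
    by apply: filterS Q0 => w Q0 t; rewrite mulr_ge0.
  have := bound _ CQ.
  rewrite (_ : psum _ = psum (fun t w => l * (Q t w * z t w))); last first.
    by congr psum; apply/funext => t; apply/funext => w; rewrite mulrA.
  have sQ := summable_pairing sz (bm RQ).
  rewrite (_ : mean P _ = l * q); last first.
    rewrite -meanZ; last exact: L1_psum.
    apply: mean_ae_eq; last exact: (psumM (fun=> l)).
      by apply: (L1_measurable (P := P)); apply: L1_psum; exact: psummableZ.
    by apply: (L1_measurable (P := P)); apply: L1Z; exact: L1_psum.
  have -> : l * q = - (`|k| + 1) by rewrite /l invrN mulrN mulNr -mulrA mulVf ?mulr1// lt_eqF.
  have := ler_norm (- k); rewrite normrN => h1 h2; lra.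
apply: ae_foralln => t.
have [B FB BE] := asm_set (filtration_sigma t) (az t) (measurable_itv `]-oo, 0[).
have aB : as_measurable P (F t) (\1_B : T -> R) by exact: (asm_indic _ (filtration_sub (t := t)) FB).
pose Q : process := proj (at_time t (\1_B)).
have aQ s : as_measurable P (F s) (at_time t (\1_B : T -> R) s) by exact: asm_at.
have i01 (A : set T) w : 0 <= (\1_A w : R) <= 1.
  by rewrite indicE; case: (_ \in _); rewrite ?lexx ler01.
have a01 s w : 0 <= at_time t (\1_B : T -> R) s w <= 1.
  by rewrite /at_time; case: eqP => // _; rewrite lexx ler01.
have Q01 s w : 0 <= Q s w <= 1.
  by rewrite /Q /stopped_proj; case: ifP => // _; rewrite lexx ler01.
have RQ : Rtt Q.
  apply/(RttP); split; last first.
    by apply: filterS (stopped_proj_idem (at_time t (\1_B))) => w h s; rewrite h.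
  split; first by move=> s; exact: asm_stopped_proj.
  by exists 1; apply: aeW => w s; have /andP[q0 q1] := Q01 s w; rewrite ger0_norm.
have := pos Q RQ; rewrite (_ : mean P _ = mean P (fun w => \1_B w * z t w)); last first.
  apply: mean_ae_eq.
  - by apply: measurable_psum => s; apply: measurable_funM; [exact: Rtt_measurable RQ|case: (az s)].
  - by apply: measurable_funM; [case: aB|case: (az t)].
  apply: filterS off => w off; rewrite /psum (ssum_at (t := t)).
    have [act|na] := boolP (active t w); last by rewrite (off _ na) !mulr0.
    congr (_ * _); rewrite /Q /stopped_proj.
    move: act; rewrite /active_at /time_min /at_time => /andP[-> ]; case: (theta w) => [n|] /=.
      by move=> tn; rewrite (minn_idPl tn) eqxx.
    by rewrite eqxx.
  move=> s st; have [act|na] := boolP (active s w); last by rewrite (off _ na) mulr0.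
  rewrite /Q /stopped_proj; move: act; rewrite /active_at /time_min /at_time => /andP[-> ].
  case: (theta w) => [n|] /=; last by rewrite (negbTE st) mul0r.
  by move=> tn; rewrite (minn_idPl tn) (negbTE st) mul0r.
move=> /(_ _) H; have {}H : 0 <= mean P (fun w => \1_B w * z t w).
  by apply: H; apply: aeW => w s; case/andP: (Q01 s w).
have Lz := psummable_L1 t sz.
have LBz : L1 P (fun w => \1_B w * z t w) by apply: L1_indic => //; exact: (filtration_sub FB).
have z0 : \forall w \ae P, -1 * (\1_B w * z t w) = 0.
  apply: (@mean_eq0 _ _ _ P (fun w => -1 * (\1_B w * z t w))).
  - exact: L1Z.
  - apply: filterS BE => w BE; rewrite indicE; case: (boolP (w \in B)) => [/set_mem /BE|_].
      by rewrite /= in_itv/= mul1r mulN1r oppr_ge0 => /ltW.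
    by rewrite mul0r mulr0.
  - by rewrite meanZ// mulN1r oppr_le0.
apply: filterS2 z0 BE => w + BE; rewrite leNgt => zE; apply/negP => zn.
have Bw : B w by apply/BE; rewrite /= in_itv.
by move: zE; rewrite indicE mem_set// mul1r mulN1r => /eqP; rewrite oppr_eq0 lt_eqF.
Qed.

(** * The gap between the conjugate and a rejected process *)

Lemma accept_paste A X Y : Ft A -> C phi X -> C phi Y ->
  C phi (fun t w => \1_A w * X t w + (1 - \1_A w) * Y t w).
Proof.
move=> FA [RX X0] [RY Y0].
have lA : Linfty P Ft (\1_A : T -> R) by exact: Linfty_indic.
have lA' : Linfty P Ft (fun w => 1 - \1_A w : R) by exact: LinftyB.
have A01 w : 0 <= (\1_A w : R) <= 1.
  by rewrite indicE; case: (_ \in _); rewrite ?lexx ler01.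
split; first exact: Rtt_comb.
have := cmuf_concave cphi RX RY lA (aeW _ A01).
apply: filterS3 X0 Y0 => w x0 y0; apply: le_trans.
by have /andP[a0 a1] := A01 w; apply: adde_ge0; apply: mule_ge0; rewrite // lee_fin ?subr_ge0.
Qed.

(** Pasting along the event where the first pairing is smaller. *)
Lemma accept_min a X Y : psummable P (incr a) -> C phi X -> C phi Y ->
  exists2 Z, C phi Z & \forall w \ae P, cp Z a w = Num.min (cp X a w) (cp Y a w).
Proof.
move=> sa CX CY; have [RX _] := CX; have [RY _] := CY.
have ad : as_measurable P Ft (fun w => cp X a w - cp Y a w) by apply: asmB => //; exact: cp_asm.
have [A FA AE] := asm_set sF ad (measurable_itv `]-oo, 0[).
have lA : Linfty P Ft (\1_A : T -> R) by exact: Linfty_indic.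
have lA' : Linfty P Ft (fun w => 1 - \1_A w : R) by exact: LinftyB.
have CZ := accept_paste FA CX CY; exists (fun t w => \1_A w * X t w + (1 - \1_A w) * Y t w) => //.
have := @cp_comb _ _ _ X Y a a a lA lA' (bm CZ.1) (bm RX) (bm RY) sa sa sa.
move=> H; have {H} : \forall w \ae P, cp (fun t w => \1_A w * X t w + (1 - \1_A w) * Y t w) a w =
    \1_A w * cp X a w + (1 - \1_A w) * cp Y a w.
  by apply: H; apply: aeW => w t _; ring.
apply: filterS2 AE => w AE ->; rewrite indicE.
case: (boolP (w \in A)) => [/set_mem/AE|/negP nA].
  by rewrite /= in_itv/= subr_lt0 mul1r subrr mul0r addr0 => /ltW/min_idPl ->.
rewrite mul0r subr0 mul1r add0r; apply/esym/min_idPr; rewrite leNgt; apply/negP => lt.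
by apply: nA; apply/mem_set/AE; rewrite /= in_itv/= subr_lt0.
Qed.

Lemma norm_max_le (x y z : R) : y <= x -> `|Num.max y z| <= `|x| + `|z|.
Proof.
move=> yx; have := ler_norm x; have := normr_ge0 x; have := normr_ge0 z.
have := ler_norm z; have := ler_norm (- z); rewrite normrN ler_norml.
by move=> *; case: (leP y z) => zy; apply/andP; split; lra.
Qed.

Lemma dist_max_le (x z e : R) : x <= z + e -> 0 <= e -> `|z - Num.max x z| <= e.
Proof.
by move=> xz e0; rewrite ler_norml; case: (leP x z) => zx; apply/andP; split; lra.
Qed.

Lemma running_min_le (m y : nat -> R) (b : R) n k :
  (forall n, m n.+1 = Num.min (m n) (y n)) -> y n <= b -> (n < k)%N -> m k <= b.
Proof.
move=> mE yb; elim: k => [|k IH]; first by rewrite ltn0.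
rewrite ltnS leq_eqVlt mE ge_min => /orP[/eqP <-|/IH ->//].
by rewrite yb orbT.
Qed.

(** From means to conditional pairings: by pasting, the essential infimum conj a is
    the decreasing limit of pairings <Z n, a> with Z n accepted. Were it at most
    <X0, a>, the means of the maxima of <Z n, a> and <X0, a> would tend to the
    mean of <X0, a>, which they exceed by 1. *)
Lemma conj_gap a X0 : psummable P (incr a) ->
  (forall Y, C phi Y -> mean P (cp X0 a) + 1 <= mean P (cp Y a)) ->
  ~ (\forall w \ae P, (conj a w <= (cp X0 a w)%:E)%E).
Proof.
move=> sa gap small.
pose Sa := [set (fun w => (cp X a w)%:E) | X in C phi].
have S0 : Sa !=set0 by exists (fun w => (cp (fun _ _ => 0%R) a w)%:E); exists (fun _ _ => 0).
have mS f : Sa f -> measurable_fun setT f by move=> [X _ <-]; exact: cp_measurable.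
have [g [Sg einfg]] := essinf_countable P S0 mS.
have gE := is_essinf_unique einfg (essinfP P S0 mS).
have /choice[Y HY] n : exists X, C phi X /\ (fun w => (cp X a w)%:E) = g n.
  by have [X CX XE] := Sg n; exists X.
have /choice[sel selP] (p : process * process) : exists Z, C phi p.1 -> C phi p.2 ->
    C phi Z /\ \forall w \ae P, cp Z a w = Num.min (cp p.1 a w) (cp p.2 a w).
  have [C1|] := pselect (C phi p.1); last by exists p.1.
  have [C2|] := pselect (C phi p.2); last by exists p.1.
  by have [Z CZ ZE] := accept_min sa C1 C2; exists Z.
have [Z [CZ Zmin]] : exists Z : nat -> process, (forall n, C phi (Z n)) /\
    \forall w \ae P, forall n, cp (Z n.+1) a w = Num.min (cp (Z n) a w) (cp (Y n) a w).
  pose Z := fix Z n := if n is k.+1 then sel (Z k, Y k) else (fun _ _ => 0) : process.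
  have CZ n : C phi (Z n).
    by elim: n => [|n IH] /=; [exact: C0|case: (selP (Z n, Y n) IH (HY n).1)].
  exists Z; split; first exact: CZ.
  by apply: ae_foralln => n; case: (selP (Z n, Y n) (CZ n) (HY n).1).
pose v w := cp X0 a w; pose u n w := Num.max (cp (Z n) a w) (v w).
have Lv : L1 P v by exact: cp_L1.
have mv : measurable_fun setT v by exact: L1_measurable Lv.
have mZ n : measurable_fun setT (cp (Z n) a) by exact: L1_measurable (cp_L1 _ _).
have mu n : measurable_fun setT (u n) := measurable_maxr (mZ n) mv.
have dZ : \forall w \ae P, forall n, cp (Z n) a w <= cp (Z 0%N) a w.
  apply: filterS Zmin => w Zmin; elim=> [|n IH]; first exact: lexx.
  by rewrite Zmin; apply: le_trans IH; rewrite ge_min; apply/orP; left; exact: lexx.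
have bound n : \forall w \ae P, `|u n w| <= `|cp (Z 0%N) a w| + `|v w|.
  by apply: filterS dZ => w h; exact: norm_max_le (h n).
have lim : \forall w \ae P, u ^~ w @ \oo --> v w.
  apply: filterS3 Zmin small gE => w Zmin small gE; apply/cvgrPdist_le => e e0.
  have [n ltn] : exists n, cp (Y n) a w < v w + e.
    apply/not_existsP => H; have : ((v w + e)%:E <= (v w)%:E)%E.
      apply: le_trans small; rewrite -[X in (_ <= X)%E]gE; apply: le_einf => n.
      have := (HY n).2 => <-; rewrite lee_fin leNgt; apply/negP; exact: H.
    by rewrite lee_fin gerDl leNgt e0.
  exists n.+1 => // k /= nk.
  have Zk : cp (Z k) a w <= v w + e.
    exact: (running_min_le (m := fun n => cp (Z n) a w) (y := fun n => cp (Y n) a w) Zmin (ltW ltn) nk).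
  exact: dist_max_le Zk (ltW e0).
have Lb : L1 P (fun w => `|cp (Z 0%N) a w| + `|v w|).
  by apply: L1D; apply: L1_norm; [exact: cp_L1|exact: Lv].
have [|||||Lu _ lm] := @mean_dct _ _ _ P u v (fun w => `|cp (Z 0%N) a w| + `|v w|).
- exact: mu.
- exact: mv.
- exact: Lb.
- exact: bound.
- exact: lim.
have : mean P v + 1 <= mean P v.
  rewrite -[leRHS](cvg_lim (@Rhausdorff R) lm); apply: limr_ge.
    by apply/cvg_ex; eexists; exact: lm.
  apply: nearW => n; apply: le_trans (gap _ (CZ n)) _; apply: mean_le.
  - exact: cp_L1.
  - apply: (@L1_le _ _ _ P _ (fun w => `|cp (Z 0%N) a w| + `|v w|)); [exact: mu|exact: bound|exact: Lb].
  - by apply: aeW => w; rewrite /u; move: (cp _ a w) (v w) => x y; rewrite le_max lexx.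
by rewrite gerDl leNgt ltr01.
Qed.

(** * Representation by the conjugate *)

Lemma measurable_inv_max (k : R) : 0 < k ->
  measurable_fun setT (fun x : R => (Num.max k x)^-1).
Proof.
move=> k0; apply: continuous_measurable_fun => x.
apply: cvgV; first by rewrite gt_eqF// lt_max k0.
apply: (@continuous_max _ R (fun=> k) idfun); first exact: cst_continuous.
exact: cvg_id.
Qed.

Lemma conj_dual_le0 a : psummable P (incr a) -> \forall w \ae P, (conj a w <= 0)%E.
Proof.
move=> sa; have c0 : \forall w \ae P, cp (fun _ _ => 0) a w = 0 * cp (fun _ _ => 0) a w.
  apply: cp_scale => //; [exact: bmeas_cst|exact: bmeas_cst|].
  by apply: aeW => w t _; rewrite !mul0r.
have lb := conj_lb mphi a C0.
by apply: filterS2 lb c0 => w l e; move: l; rewrite e mul0r.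
Qed.

(** Where the mass <1, a> vanishes, so does <X0, a>, while the conjugate is
    nonpositive: the gap lies in the event of positive mass. *)
Lemma gap_positive_mass a X0 : dual_increments (incr a) -> Rtt X0 ->
  ~ (\forall w \ae P, (conj a w <= (cp X0 a w)%:E)%E) ->
  exists2 k : R, 0 < k & ~ (\forall w \ae P, k <= cp (fun _ _ => 1) a w ->
    (conj a w <= (cp X0 a w)%:E)%E).
Proof.
move=> [_ sa a0 _] RX0 gap; apply/not_exists2P => H; apply: gap.
have [m m0 Xm] := Rtt_bounded RX0.
have small : \forall w \ae P, forall n, n.+1%:R^-1 <= cp (fun _ _ => 1) a w ->
    (conj a w <= (cp X0 a w)%:E)%E.
  by apply: ae_foralln => n; have [/negP|/contrapT//] := H n.+1%:R^-1; rewrite invr_gt0 ltr0Sn.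
have b1 := bmeas_cst 1; have b0 := bmeas_cst 0; have bNm := bmeas_cst (- m).
have z0 : \forall w \ae P, cp (fun _ _ => 0) a w = 0 * cp (fun _ _ => 1) a w.
  by apply: cp_scale => //; apply: aeW => w t _; rewrite !mul0r.
have g0 : \forall w \ae P, cp (fun _ _ => 0) a w <= cp (fun _ _ => 1) a w.
  by apply: cp_le => //; apply: filterS a0 => w a0 t _; rewrite ler_wpM2r.
have zm : \forall w \ae P, cp (fun _ _ => - m) a w = - m * cp (fun _ _ => 1) a w.
  by apply: (cp_scale (Lc (- m))) => //; apply: aeW => w t _; rewrite mul1r.
have vm : \forall w \ae P, cp (fun _ _ => - m) a w <= cp X0 a w.
  apply: cp_le => //; first exact: bm.
  apply: filterS2 a0 Xm => w a0 Xm t _; rewrite ler_wpM2r//.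
  by have := Xm t; rewrite ler_norml => /andP[].
apply: filterS3 (filterI small (conj_dual_le0 sa)) (filterI z0 g0) (filterI zm vm).
move=> w [sw cw] [z0' g0'] [zm' vm']; rewrite z0' mul0r in g0'; rewrite zm' in vm'.
move: sw cw g0' vm'; clear.
move: (cp _ a w) (cp _ a w) (conj a w) => g v c sw cw + vg; move: vg => /[swap].
rewrite le_eqVlt => /orP[/eqP <-|g0'].
  by rewrite mulr0 => v0; apply: le_trans cw _; rewrite lee_fin.
move=> _; have [k] := ltr_add_invr g0'; rewrite add0r => /ltW; exact: sw.
Qed.

(** Division by the mass <1, a> where it is at least k, completed by a unit mass at
    tau elsewhere, leads into D and keeps the gap. *)
Lemma normalise a X0 : dual_increments (incr a) -> Rtt X0 ->
  ~ (\forall w \ae P, (conj a w <= (cp X0 a w)%:E)%E) ->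
  exists2 b, D b & ~ (\forall w \ae P, (0 <= penalized conj X0 b w)%E).
Proof.
move=> da RX0 /(gap_positive_mass da RX0)[k k0 gap].
have [aa sa a0 aoff] := da.
pose g := cp (fun _ _ => 1) a.
have ag : as_measurable P Ft g by exact: cp_asm.
have [B FB BE] := asm_set sF ag (measurable_itv `[k, +oo[).
pose u w : R := \1_B w * (Num.max k (g w))^-1.
have lB : Linfty P Ft (\1_B : T -> R) by exact: Linfty_indic.
have FBc : Ft (~` B) by exact: sigma_setC.
have lBc : Linfty P Ft (\1_(~` B) : T -> R) by exact: Linfty_indic.
have max0 w : 0 < Num.max k (g w) by rewrite lt_max k0.
have lu : Linfty P Ft u.
  apply: LinftyM => //; split.
    by apply: (asm_comp (measurable_inv_max k0) ag).
  exists k^-1; apply: aeW => w; rewrite ger0_norm ?invr_ge0 ?(ltW (max0 w))//.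
  by rewrite lef_pV2 ?posrE// le_max lexx.
have u0 w : 0 <= u w by rewrite mulr_ge0 ?invr_ge0 ?(ltW (max0 w))// indicE.
pose i : process := unit_at_tau.
have Di : D i by exact: Dset_unit.
have di := Dset_dual Di; have [ai si i0 ioff] := di.
pose z : process := fun t w => u w * incr a t w + \1_(~` B) w * incr i t w.
have scale_sum (v : T -> R) b : Linfty P Ft v -> psummable P (incr b) ->
    psummable P (fun t w => v w * incr b t w).
  by move=> [[mv _] [c vc]] sb; exact: (@psummableM _ _ _ P (fun _ => v) c).
have dz : dual_increments z.
  split.
  - by move=> t; exact: asmD (dual_scale_asm t lu da) (dual_scale_asm t lBc di).
  - by apply: psummableD; exact: scale_sum.
  - apply: filterS2 a0 i0 => w a0 i0 t; by apply: addr_ge0; apply: mulr_ge0.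
  - by apply: filterS2 aoff ioff => w aoff ioff t na; rewrite /z aoff// ioff// !mulr0 addr0.
have sz : psummable P (incr (cumul z)) by rewrite incr_cumulE; case: dz.
have cpz X : bmeas X -> \forall w \ae P, cp X (cumul z) w = u w * cp X a w + \1_(~` B) w * cp X i w.
  move=> bX; apply: cp_comb => //; apply: aeW => w t _; rewrite incr_cumul /z; ring.
have uB w : B w -> k <= g w -> u w * g w = 1 /\ 0 < u w.
  move=> Bw kg; have gp : 0 < g w by exact: lt_le_trans kg.
  by rewrite /u indicE mem_set// mul1r (max_idPr kg) mulVf ?gt_eqF// invr_gt0.
have Dz : D (cumul z).
  apply: Dset_cumul => //.
  have one := Dset_one Di.
  apply: filterS3 BE (cpz _ (bmeas_cst 1)) one => w BEw -> ->; rewrite -/g.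
  have [Bw|nB] := pselect (B w).
    have kg : k <= g w by have := (BEw.1 Bw); rewrite /= in_itv/= andbT.
    by have [-> _] := uB w Bw kg; rewrite indicE memNset ?mul0r ?addr0//; apply/contrapT.
  by rewrite /u !indicE memNset// mem_set// !mul0r mul1r add0r.
exists (cumul z) => // pos; apply: gap.
have mcp b X : C phi X -> measurable_fun setT (fun w => (cp X b w)%:E).
  by move=> _; exact: cp_measurable.
have low : \forall w \ae P, B w -> ((u w)%:E * conj a w <= conj (cumul z) w)%E.
  apply: (@essinf_glb_on _ _ _ P _ _ (accept_nonempty mphi) B
     (fun w => (u w)%:E * conj a w)%E _ (FM FB) (mcp (cumul z))).
    apply: emeasurable_funM; last exact: (conj_measurable mphi).
    by apply/measurable_EFinP; case: lu => -[].
  move=> X CX; have lb := conj_lb mphi a CX.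
  apply: filterS2 lb (cpz X (bm CX.1)) => w lb -> Bw.
  rewrite indicE memNset ?mul0r ?addr0; last exact.
  have ue : (0 <= (u w)%:E)%E by rewrite lee_fin.
  exact: (lee_wpmul2l ue lb).
apply: filterS3 (filterI low pos) (filterI BE (cpz X0 (bm RX0))) (conj_dual_le0 sa).
move=> w [low' +] [BEw cE] c0 kg; rewrite -/(g w) in kg.
have Bw : B w by apply/BEw; rewrite /= in_itv/= kg.
have [_ up] := uB w Bw kg; have {low'} := low' Bw.
rewrite /penalized cE indicE memNset ?mul0r ?addr0; last exact.
move: (conj a w) (conj (cumul z) w) (cp X0 a w) (u w) up c0 => ca cz v x x0 c0 h1 h2.
have h3 : (cz <= (x * v)%:E)%E by rewrite -sube_ge0 ?orbT.
have := le_trans h1 h3; rewrite EFinM lee_pmul2l//.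
Qed.

Lemma dual_witness X0 (e : R) : Rtt X0 -> 0 < e ->
  ~ (\forall w \ae P, ((- e)%:E < phi X0 w)%E) ->
  exists2 b, D b & ~ (\forall w \ae P, (0 <= penalized conj X0 b w)%E).
Proof.
move=> RX0 e0 nX0.
have [z [az sz off sep]] := separating_increments RX0 e0 nX0.
have z0 := increments_ge0 az sz off sep.
have da : dual_increments (incr (cumul z)) by rewrite incr_cumulE.
have [_ sa _ _] := da.
apply: (normalise da RX0); apply: conj_gap => // Y CY.
have pE X : Rtt X -> mean P (psum (fun t w => X t w * z t w)) = mean P (cp X (cumul z)).
  move=> RX; rewrite mean_cp//; last exact: bm.
  have mt : psummable P (pairing_terms X (cumul z)) by exact: (psummable_terms (bm RX) sa).
  have sX := summable_pairing sz (bm RX).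
  apply: mean_ae_eq; [by apply: measurable_psum; case: sX|by apply: measurable_psum; case: mt|].
  apply: psum_eq => t; apply: filterS (dual_terms X da) => w /(_ t) ->.
  by rewrite incr_cumul.
by have := sep Y CY; rewrite (pE X0 RX0) (pE Y CY.1).
Qed.

(** If the infimum exceeded phi X by more than e on an event A, then X minus
    phi X + e, switched off outside A, would be rejected; the b in D obtained
    from dual_witness has <X0, b> < conj b on part of A, contrary to the choice
    of A. *)
Theorem conj_representation : representation P F tau theta phi conj.
Proof.
move=> X RX; have [g lg gE] := muf_Linfty mphi RX.
pose V := penalized conj X.
have aV a : as_measurable P Ft (V a).
  by apply: easmB; [exact: cp_easm|exact: (conj_asm mphi)].
have mV a : D a -> measurable_fun setT (V a) by move=> _; case: (aV a).
pose s := essinf P (V @` D).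
have as' : as_measurable P Ft s.
  apply: essinf_asm; first by case: D0 => a Da; exists (V a), a.
  by move=> _ [a _ <-]; exact: aV.
have mg : measurable_fun setT (fun w => (g w)%:E) by apply/measurable_EFinP; case: lg => -[].
have gs : \forall w \ae P, ((g w)%:E <= s w)%E.
  apply: (@essinf_glb _ _ _ P _ _ D0 _ _ mV mg) => a Da.
  have := conj_rep_le mphi RX Da.
  by apply: filterS2 gE => w ->.
suff sg : \forall w \ae P, (s w <= (g w)%:E)%E.
  by apply: filterS3 gE gs sg => w -> gs sg; apply/eqP; rewrite eq_le gs.
have near n : \forall w \ae P, (s w <= (g w + n.+1%:R^-1)%:E)%E.
  apply: contrapT => no; pose e : R := n.+1%:R^-1; have e0 : 0 < e by rewrite invr_gt0.
  have lge : Linfty P Ft (fun w => 0 - (g w + e)) by apply: LinftyB => //; exact: LinftyD.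
  have asg : as_measurable P Ft (fun w => s w - (g w + e)%:E)%E.
    apply: easmB => //; have [ae _] := LinftyD lg (Lc e).
    by apply: asm_comp ae.
  have [A FA AE] := asm_set sF asg (emeasurable_itv `]0%E, +oo[).
  have lA : Linfty P Ft (\1_A : T -> R) by exact: Linfty_indic.
  pose Y := add_from_tau tau X (fun w => 0 - (g w + e)).
  have RY : Rtt Y by exact: Rtt_add_from_tau.
  pose X0 : process := fun t w => \1_A w * Y t w.
  have RX0 : Rtt X0 by exact: Rtt_indic.
  have pX0 : \forall w \ae P, phi X0 w = (\1_A w * - e)%:E.
    have l1 := muf_local mphi RY FA; have l2 := muf_translation mphi RX lge.
    apply: filterS3 l1 l2 gE => w -> -> ->; rewrite -EFinD -EFinM; congr (_ * _)%:E.
    by rewrite sub0r opprD addrA subrr add0r.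
  have nX0 : ~ (\forall w \ae P, ((- e)%:E < phi X0 w)%E).
    move=> H; apply: no; apply: filterS3 H pX0 AE => w + e1 AEw; rewrite e1 lte_fin.
    have [Aw|nA _] := pselect (A w); first by rewrite indicE mem_set// mul1r ltxx.
    rewrite leNgt; apply/negP => lt; apply: nA; apply/AEw.
    suff : (0 < s w - (g w + e)%:E)%E by rewrite /= in_itv/= andbT.
    by rewrite sube_gt0.
  have [b Db] := dual_witness RX0 e0 nX0; apply.
  have lAY : Linfty P Ft (fun w => \1_A w * (0 - (g w + e))) by exact: LinftyM.
  have cX0 : \forall w \ae P, cp X0 b w = \1_A w * cp X b w + \1_A w * (0 - (g w + e)).
    apply: (cp_affine Db lA lAY (bm RX0) (bm RX)).
    apply: aeW => w t /andP[st _]; rewrite /X0 /Y /add_from_tau st mulr1; ring.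
  have sV := @essinf_lb _ _ _ P _ _ D0 _ _ mV Db.
  have c0 := conj_le0 mphi Db.
  rewrite /penalized; apply: filterS3 (filterI cX0 sV) c0 AE => w [-> +] c0 AEw; rewrite -/s.
  have [Aw|nA _] := pselect (A w); last first.
    by rewrite indicE memNset// !mul0r addr0 sub0e oppe_ge0.
  have : (0 < s w - (g w + e)%:E)%E by have := AEw.1 Aw; rewrite /= in_itv/= andbT.
  rewrite sube_gt0 indicE mem_set// !mul1r /V /penalized.
  move: (cp X b w) (conj b w) (s w) (g w) c0 => x c y r c0 h1 h2.
  have := lt_le_trans h1 h2; case: c c0 {h1 h2} => [q| |] c0; [|by rewrite leye_eq in c0|by move=> _; rewrite addey// leey].
  by rewrite -!EFinB lte_fin lee_fin => h; lra.
have := ae_foralln near; apply: filterS => w h; apply/lee_addgt0Pr => e e0.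
have [n] := ltr_add_invr e0; rewrite add0r => /ltW ne; apply: le_trans (h n) _.
by rewrite -EFinD lee_fin lerD2l.
Qed.

End concave_continuous.

End stopped_processes.

(** * The equivalence *)

Theorem theorem3p15 (d : measure_display) (T : measurableType d) (R : realType)
  (P : probability T R) (F : nat -> set (set T))
  (hF : filtration F) (hF0 : F 0%N = [set set0; setT])
  (tau theta : T -> option nat)
  (htau : stopping_time F tau) (htheta : stopping_time F theta)
  (htau_fin : \forall w \ae P, tau w <> None)
  (htau_theta : \forall w \ae P, time_le (tau w) (theta w))
  (phi : (nat -> T -> R) -> T -> \bar R) :
  let cond1 := exists2 gamma, penalty P F tau theta gamma &
    representation P F tau theta phi gamma in
  let cond2 := concave_monetary_utility P F tau theta phi /\
    weakly_closed P F (acceptance P F tau theta phi) in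
  let cond3 := concave_monetary_utility P F tau theta phi /\
    continuous_decreasing P F tau theta phi in
  ((cond1 <-> cond2) /\ (cond2 <-> cond3)) /\
  (cond1 /\ cond2 /\ cond3 ->
    [/\ penalty P F tau theta (conjugate P F tau theta phi),
        special P F tau theta (conjugate P F tau theta phi),
        (forall gamma, penalty P F tau theta gamma ->
           representation P F tau theta phi gamma ->
           forall a, Dset P F tau theta a ->
             \forall w \ae P, (gamma a w <= conjugate P F tau theta phi a w)%E)
      & representation P F tau theta phi (conjugate P F tau theta phi)]).
Proof.
move=> cond1 cond2 cond3.
have closed_of_rep : cond1 -> cond2.
  move=> [gamma pg rep]; split; first exact: rep_concave_utility pg rep.
  exact: rep_closed pg rep.
have cont_of_closed : cond2 -> cond3.
  by move=> [cphi clC]; split => //; apply: closed_continuous => //; case: cphi.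
have conj_of_cont : cond3 -> penalty P F tau theta (conjugate P F tau theta phi) /\
    representation P F tau theta phi (conjugate P F tau theta phi).
  move=> [cphi cont]; have rep : representation P F tau theta phi (conjugate P F tau theta phi).
    exact: conj_representation.
  by split => //; apply: conj_penalty => //; case: cphi.
have rep_of_cont : cond3 -> cond1.
  by move=> /conj_of_cont[]; exists (conjugate P F tau theta phi).
split.
  split; first by split => // /cont_of_closed/rep_of_cont.
  by split => // /rep_of_cont/closed_of_rep.
move=> [_ [_ c3]]; have [pc rep] := conj_of_cont c3.
have [[mphi _] _] := c3; split => //; first exact: conj_special.
by move=> gamma pg rg a Da; exact: penalty_le_conj pg rg Da.
Qed.
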